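(* The only complete embedded rotational $C^2$ surfaces in $\mathbb{R}^3$ whose second fundamental form has constant positive length (that is, $|A|^2\equiv c$ for some constant $c>0$) are the round sphere and the circular cylinder.
   Context: A rotational surface is a surface obtained, up to a rigid motion, by rotating around the $x$-axis a connected profile curve $\alpha(t)=(x(t),0,z(t))$ contained in the $xz$-plane with $z>0$ (the surface may also contain points of the axis where it closes up, as the round sphere does). Completeness is with respect to the induced metric. $|A|$ denotes the length of the second fundamental form: $|A|^2=\operatorname{trace}(A^2)=\lambda_1^2+\lambda_2^2$, where $A$ is the shape operator and $\lambda_1,\lambda_2$ are the principal curvatures. *)

(* Defs.v *)
From Stdlib Require Import Reals.
From Coquelicot Require Import Coquelicot.

Open Scope R_scope.

(* Derivative of [f] at [p] in the direction [v]. *)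
Definition dirD {V : NormedModule R_AbsRing} (v : V) (f : V -> R) (p : V) : R :=
  Derive (fun t : R => f (plus p (scal t v))) 0.

(* [Ck k U f]: [f] is of class C^k on the open set [U].  It is used for V = R,
   R^2 and R^3 only; in finite dimension, existence and continuity of the
   iterated derivatives in all directions is the same as existence and
   continuity of the iterated partial derivatives. *)
Fixpoint Ck {V : NormedModule R_AbsRing} (k : nat) (U : V -> Prop) (f : V -> R)
  : Prop :=
  match k with
  | O => forall p, U p -> continuous f p
  | S k' => forall v : V,
      (forall p, U p -> ex_derive (fun t : R => f (plus p (scal t v))) 0) /\
      Ck k' U (dirD v f)
  end.

Notation R2 := (R * R)%type.
Notation R3 := (R * R * R)%type.

Definition cx (p : R3) : R := fst (fst p).
Definition cy (p : R3) : R := snd (fst p).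
Definition cz (p : R3) : R := snd p.

Definition dot (p q : R3) : R := cx p * cx q + cy p * cy q + cz p * cz q.

Definition enorm (p : R3) : R := sqrt (dot p p).

Definition cross (p q : R3) : R3 :=
  (cy p * cz q - cz p * cy q,
   cz p * cx q - cx p * cz q,
   cx p * cy q - cy p * cx q).

Definition dirD3 {V : NormedModule R_AbsRing} (v : V) (X : V -> R3) (p : V) : R3 :=
  (dirD v (fun q => cx (X q)) p,
   dirD v (fun q => cy (X q)) p,
   dirD v (fun q => cz (X q)) p).

Definition Ck3 {V : NormedModule R_AbsRing} (k : nat) (U : V -> Prop) (X : V -> R3)
  : Prop :=
  Ck k U (fun q => cx (X q)) /\
  Ck k U (fun q => cy (X q)) /\
  Ck k U (fun q => cz (X q)).

Definition rigid_motion (T : R3 -> R3) : Prop :=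
  exists o e1 e2 e3 : R3,
    dot e1 e1 = 1 /\ dot e2 e2 = 1 /\ dot e3 e3 = 1 /\
    dot e1 e2 = 0 /\ dot e1 e3 = 0 /\ dot e2 e3 = 0 /\
    forall p : R3,
      T p = plus o (plus (scal (cx p) e1) (plus (scal (cy p) e2) (scal (cz p) e3))).

(* Embedded (in the sense of submanifolds) surface of class C^2: locally the
   zero set of a C^2 function with nowhere vanishing differential. *)
Definition embedded_C2_surface (S : R3 -> Prop) : Prop :=
  forall p : R3, S p ->
    exists (V : R3 -> Prop) (F : R3 -> R),
      open V /\ V p /\ Ck 2 V F /\
      (forall q, V q -> exists v : R3, dirD v F q <> 0) /\
      (forall q, V q -> (S q <-> F q = 0)).

(* [X] restricted to the open set [U] is a C^2 regular parametrization of a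
   piece of [S]. *)
Definition C2_patch (S : R3 -> Prop) (U : R2 -> Prop) (X : R2 -> R3) : Prop :=
  open U /\ Ck3 2 U X /\
  (forall u, U u -> cross (dirD3 (1, 0) X u) (dirD3 (0, 1) X u) <> (0, 0, 0)) /\
  (forall u, U u -> S (X u)).

Definition unit_normal (X : R2 -> R3) (u : R2) : R3 :=
  let n := cross (dirD3 (1, 0) X u) (dirD3 (0, 1) X u) in
  scal (/ enorm n) n.

(* Coefficients g_ij and h_ij of the first and second fundamental forms,
   evaluated on coordinate vectors [v], [w]. *)
Definition first_ff (X : R2 -> R3) (u : R2) (v w : R2) : R :=
  dot (dirD3 v X u) (dirD3 w X u).

Definition second_ff (X : R2 -> R3) (u : R2) (v w : R2) : R :=
  dot (unit_normal X u) (dirD3 v (dirD3 w X) u).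

(* |A|^2 = trace(A^2); by the Weingarten equations the matrix of the shape
   operator A in the basis (X_u, X_v) is
     [ E F ]^-1 [ e f ]
     [ F G ]    [ f g ]. *)
Definition sqnorm_A (X : R2 -> R3) (u : R2) : R :=
  let E := first_ff X u (1, 0) (1, 0) in
  let F := first_ff X u (1, 0) (0, 1) in
  let G := first_ff X u (0, 1) (0, 1) in
  let e := second_ff X u (1, 0) (1, 0) in
  let f := second_ff X u (1, 0) (0, 1) in
  let g := second_ff X u (0, 1) (0, 1) in
  let a11 := (G * e - F * f) / (E * G - F * F) in
  let a12 := (G * f - F * g) / (E * G - F * F) in
  let a21 := (E * f - F * e) / (E * G - F * F) in
  let a22 := (E * g - F * f) / (E * G - F * F) in
  a11 * a11 + a12 * a21 + (a21 * a12 + a22 * a22).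

(* |A|^2 is a geometric quantity, so it may be computed in any regular
   parametrization. *)
Definition constant_sqnorm_A (S : R3 -> Prop) (c : R) : Prop :=
  forall (U : R2 -> Prop) (X : R2 -> R3), C2_patch S U X ->
  forall u, U u -> sqnorm_A X u = c.

(* The speed of the curve may vanish, so that every piecewise C^1 curve has a
   C^1 reparametrization; the infimum of the lengths below is therefore the
   usual Riemannian distance. *)
Definition C1_path_in (S : R3 -> Prop) (p q : R3) (gam : R -> R3) : Prop :=
  Ck3 1 (fun _ : R => True) gam /\
  (forall t, 0 <= t <= 1 -> S (gam t)) /\
  gam 0 = p /\ gam 1 = q.

Definition path_length (gam : R -> R3) : R :=
  RInt (fun t => enorm (dirD3 (1 : R) gam t)) 0 1.

(* Equal to +oo when no path in [S] joins [p] to [q]. *)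
Definition intrinsic_dist (S : R3 -> Prop) (p q : R3) : Rbar :=
  Glb_Rbar (fun l => exists gam, C1_path_in S p q gam /\ l = path_length gam).

Definition complete_surface (S : R3 -> Prop) : Prop :=
  forall a : nat -> R3,
    (forall n, S (a n)) ->
    (forall eps : posreal, exists N : nat, forall m n : nat,
        (N <= m)%nat -> (N <= n)%nat -> Rbar_lt (intrinsic_dist S (a m) (a n)) eps) ->
    exists p : R3, S p /\
      forall eps : posreal, exists N : nat, forall n : nat,
        (N <= n)%nat -> Rbar_lt (intrinsic_dist S (a n) p) eps.

(* Regular C^2 curve t |-> (x t, 0, z t), t in the open interval [J], z > 0. *)
Definition profile_curve (J : R -> Prop) (x z : R -> R) : Prop :=
  open J /\ (exists t, J t) /\
  (forall a b t, J a -> J b -> a <= t <= b -> J t) /\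
  Ck 2 J x /\ Ck 2 J z /\
  (forall t, J t -> 0 < z t) /\
  (forall t, J t -> Derive x t <> 0 \/ Derive z t <> 0).

(* Off the axis of rotation, [S] is swept out by the profile curve.  No
   condition is put on the points of [S] lying on the axis: for an embedded
   surface these are limits of points off the axis. *)
Definition rotational (S : R3 -> Prop) : Prop :=
  exists (T : R3 -> R3) (J : R -> Prop) (x z : R -> R),
    rigid_motion T /\ profile_curve J x z /\
    forall p : R3, (cy p <> 0 \/ cz p <> 0) ->
      (S (T p) <->
       exists t th : R, J t /\ p = (x t, z t * sin th, z t * cos th)).

Definition round_sphere (S : R3 -> Prop) : Prop :=
  exists (o : R3) (r : R), 0 < r /\
    forall p : R3, S p <-> enorm (minus p o) = r.

(* Points at distance [r] from the line through [o] with unit direction [d]. *)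
Definition circular_cylinder (S : R3 -> Prop) : Prop :=
  exists (o d : R3) (r : R), 0 < r /\ enorm d = 1 /\
    forall p : R3, S p <-> enorm (cross (minus p o) d) = r.

(* Main.v *)
(** Let [(w, u)] be the unit tangent of the profile and [z] the distance to the
axis. Suitably oriented, the principal curvatures are [p = dw/dz] and [w / z], so
that the condition [p ^ 2 + (w / z) ^ 2 = c] is a differential equation for [w]
as a function of [z]. It has the first integral [(p - w / z) z ^ 2 exp (- phi)],
where [phi] is the polar angle of [(p, w / z)]. If [p] vanishes identically, the
profile is parallel to the axis. Otherwise use the tangent angle as parameter:
each level curve of the first integral is a graph over an interval of angles
symmetric about [0], and if one of its points is on the profile, then completeness
and uniqueness of solutions put all of it on the surface. On level [0] the two
curvatures agree and the level curve is a half circle. On every other level,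
either the curve ends at an angle [d < PI] where [p = 0] but the tangent is not
parallel to the axis, which is impossible because [(w / z) ^ 2 <= c] is maximal
there; or the angle covers [(-PI, PI)] and the curve crosses its mirror image
transversally, so that the surface is not embedded. *)

Require Import Defs.
From Stdlib Require Import Reals Lra Lia FunctionalExtensionality.
From Stdlib Require Import Classical ClassicalEpsilon PropExtensionality.
From Coquelicot Require Import Coquelicot.

Open Scope R_scope.

(** * Functions of class C^k *)

(** Along the profile [p = sqrt c cos phi] and [w / z = sqrt c sin phi]. Since
    [d (w / z) / dz = (p - w / z) / z], this gives [dz / z = cos phi / (cos phi - sin phi) dphi],
    which integrates to the first integral. Solving the equation for [p] involves a square root that
    is not Lipschitz at [p = 0], where solutions may branch. The proof therefore never crosses
    [p = 0]: where [p] keeps its sign the tangent angle is a parameter, and strict monotonicity of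
    the first integral at a fixed angle does the work of a uniqueness theorem. A connectedness
    argument extends the arc. Its delicate half is closedness, as [p] might vanish at the limit
    point; there the Hessian of a local defining function compares the curvature of the profile with
    that of the level curve, which is not zero. Since the level curve is only shown to lie on the
    surface, the sphere case must also show that the rest of the profile lies on the same circle. In
    the converse direction sphere and cylinder form one family of tubes around an axis vector, zero
    for the sphere and of unit length for the cylinder. *)

Lemma line_line {V : NormedModule R_AbsRing} (p v : V) (s t : R) :
  plus (plus p (scal s v)) (scal t v) = plus p (scal (s + t) v).
Proof.
rewrite <- plus_assoc. f_equal. symmetry. apply (scal_distr_r s t v).
Qed.

Lemma line_0 {V : NormedModule R_AbsRing} (p v : V) : plus p (scal 0 v) = p.
Proof. replace (scal 0 v) with (zero : V). apply plus_zero_r. symmetry. apply (scal_zero_l v).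
  Qed.

Lemma continuous_line {V : NormedModule R_AbsRing} (p v : V) (s : R) :
  continuous (fun t : R => plus p (scal t v)) s.
Proof.
apply continuous_plus with (f := fun _ => p) (g := fun t => scal t v).
- apply continuous_const.
- apply (continuous_scal_l (fun t : R => t) v s). apply continuous_id.
Qed.

Lemma line_locally {V : NormedModule R_AbsRing} (U : V -> Prop) (p v : V) (s : R) :
  open U -> U (plus p (scal s v)) -> locally s (fun t : R => U (plus p (scal t v))).
Proof.
intros HU Hp. apply (continuous_line p v s U). now apply HU.
Qed.

Lemma ex_derive_line {V : NormedModule R_AbsRing} (f : V -> R) (p v : V) (s : R) :
  ex_derive (fun t : R => f (plus (plus p (scal s v)) (scal t v))) 0 ->
  is_derive (fun t : R => f (plus p (scal t v))) s (dirD v f (plus p (scal s v))).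
Proof.
intros H. apply Derive_correct in H.
change (Derive (fun t : R => f (plus (plus p (scal s v)) (scal t v))) 0)
  with (dirD v f (plus p (scal s v))) in H.
set (l := dirD v f (plus p (scal s v))) in *.
apply is_derive_ext with (f := fun t : R => (fun r => f (plus (plus p (scal s v)) (scal r v)))
  (t - s)).
- intros t. rewrite line_line. do 3 f_equal. lra.
- replace l with (scal 1 l) by (unfold scal; simpl; unfold mult; simpl; ring).
  apply (is_derive_comp (fun r => f (plus (plus p (scal s v)) (scal r v))) (fun t => t - s)).
  + replace (s - s) with 0 by ring. exact H.
  + auto_derive; trivial; lra.
Qed.

Lemma is_dirD {V : NormedModule R_AbsRing} (f : V -> R) (p v : V) (l : R) :
  is_derive (fun t : R => f (plus p (scal t v))) 0 l -> dirD v f p = l.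
Proof. apply is_derive_unique. Qed.

Lemma dirD_correct {V : NormedModule R_AbsRing} (f : V -> R) (p v : V) :
  ex_derive (fun t : R => f (plus p (scal t v))) 0 ->
  is_derive (fun t : R => f (plus p (scal t v))) 0 (dirD v f p).
Proof. apply Derive_correct. Qed.

(* Unlike [Ck], this provides the derivatives of lower order, so that it is
   stable under products in any normed module. *)
Fixpoint Cks {V : NormedModule R_AbsRing} (k : nat) (U : V -> Prop) (f : V -> R)
  : Prop :=
  (forall p, U p -> continuous f p) /\
  match k with
  | O => True
  | S k' => forall v : V,
      (forall p, U p -> ex_derive (fun t : R => f (plus p (scal t v))) 0) /\
      Cks k' U (dirD v f)
  end.

Lemma Cks_Ck {V : NormedModule R_AbsRing} k (U : V -> Prop) f : Cks k U f -> Ck k U f.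
Proof.
revert f. induction k as [|k IH]; intros f [H0 H]; simpl; [exact H0|].
intros v. destruct (H v) as [H1 H2]. split; [exact H1|]. now apply IH.
Qed.

Lemma Cks_pred {V : NormedModule R_AbsRing} k (U : V -> Prop) f : Cks (S k) U f -> Cks k U f.
Proof.
revert f. induction k as [|k IH]; intros f [H0 H].
- now split.
- split; [exact H0|]. intros v. destruct (H v) as [H1 H2]. split; [exact H1|]. now apply IH.
Qed.

(** Openness of [U] keeps short segments inside it, so equality on [U] passes to the directional
    derivatives and the induction can continue. *)
Lemma Cks_ext_on {V : NormedModule R_AbsRing} k (U : V -> Prop) (f g : V -> R) :
  open U -> (forall p, U p -> f p = g p) -> Cks k U f -> Cks k U g.
Proof.
intros HU. revert f g.
assert (E : forall f g : V -> R, (forall p, U p -> f p = g p) -> forall p v, U p ->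
  locally 0 (fun t : R => f (plus p (scal t v)) = g (plus p (scal t v)))).
{ intros f g Hfg p v Hp.
  apply filter_imp with (2 := line_locally U p v 0 HU (eq_ind_r U Hp (line_0 p v))).
  intros t Ht. now apply Hfg. }
assert (C : forall f g : V -> R, (forall p, U p -> f p = g p) ->
   (forall p, U p -> continuous f p) -> forall p, U p -> continuous g p).
{ intros f g Hfg Hf p Hp. apply continuous_ext_loc with f.
  - apply filter_imp with (2 := HU p Hp). intros q Hq. now apply Hfg.
  - now apply Hf. }
induction k as [|k IH]; intros f g Hfg [H0 H]; split.
- now apply C with f.
- trivial.
- now apply C with f.
- intros v. destruct (H v) as [H1 H2]. split.
  + intros p Hp. apply ex_derive_ext_loc with (f := fun t : R => f (plus p (scal t v))).
    * now apply E.
    * now apply H1.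
  + apply IH with (dirD v f); trivial.
    intros p Hp. apply Derive_ext_loc. now apply E.
Qed.

Lemma Cks_const {V : NormedModule R_AbsRing} k (U : V -> Prop) (c : R) : Cks k U (fun _ => c).
Proof.
revert c. induction k as [|k IH]; intros c; split; trivial;
  try (intros p _; apply continuous_const).
intros v. split.
- intros p _. apply ex_derive_const.
- replace (dirD v (fun _ : V => c)) with (fun _ : V => 0).
  + apply IH.
  + apply functional_extensionality. intros p. symmetry. apply is_dirD.
    apply (is_derive_const c).
Qed.

Lemma Cks_plus {V : NormedModule R_AbsRing} k (U : V -> Prop) (f g : V -> R) :
  open U -> Cks k U f -> Cks k U g -> Cks k U (fun p => f p + g p).
Proof.
intros HU. revert f g. induction k as [|k IH]; intros f g [Hf0 Hf] [Hg0 Hg]; split; trivial;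
  try (intros p Hp; apply (continuous_plus f g); auto).
intros v. destruct (Hf v) as [Hf1 Hf2]. destruct (Hg v) as [Hg1 Hg2]. split.
- intros p Hp. apply (ex_derive_plus (fun t : R => f (plus p (scal t v)))); auto.
- apply Cks_ext_on with (fun p => dirD v f p + dirD v g p); auto.
  intros p Hp. symmetry. apply is_dirD.
  apply (is_derive_plus (fun t : R => f (plus p (scal t v)))); apply dirD_correct; auto.
Qed.

Lemma Cks_mult {V : NormedModule R_AbsRing} k (U : V -> Prop) (f g : V -> R) :
  open U -> Cks k U f -> Cks k U g -> Cks k U (fun p => f p * g p).
Proof.
intros HU. revert f g. induction k as [|k IH]; intros f g Hf' Hg';
 pose proof Hf' as [Hf0 Hf]; pose proof Hg' as [Hg0 Hg]; split; trivial;
  try (intros p Hp; apply (continuous_mult f g); auto).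
intros v. destruct (Hf v) as [Hf1 Hf2]. destruct (Hg v) as [Hg1 Hg2]. split.
- intros p Hp. apply (ex_derive_mult (fun t : R => f (plus p (scal t v)))); auto.
- apply Cks_ext_on with (fun p => dirD v f p * g p + f p * dirD v g p); auto.
  + intros p Hp. symmetry. apply is_dirD.
    pose proof (is_derive_mult (fun t : R => f (plus p (scal t v))) (fun t : R => g (plus p
      (scal t v))) 0
      _ _ (dirD_correct f p v (Hf1 p Hp)) (dirD_correct g p v (Hg1 p Hp)) Rmult_comm) as H.
    cbv beta in H. rewrite !line_0 in H. exact H.
  + apply Cks_plus; auto; apply IH; auto; now apply Cks_pred.
Qed.

(** Along a line of direction [v] the argument of [f] runs along a line of direction [l v]; a
    directional derivative is therefore again a composition with [l], and the induction applies to
    it. It serves for functions such as [x (fst q)] and [sin (snd q)]. *)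
Lemma Cks_comp_linear {V : NormedModule R_AbsRing} k (U : R -> Prop) (l : V -> R) (f : R -> R) :
  (forall p v (t : R), l (plus p (scal t v)) = l p + t * l v) ->
  (forall p, continuous l p) ->
  Cks k (U : R_NormedModule -> Prop) f -> Cks k (fun p => U (l p)) (fun p => f (l p)).
Proof.
intros Hl Cl. revert f. induction k as [|k IH]; intros f [Hf0 Hf]; split; trivial;
  try (intros p Hp; apply continuous_comp; [apply Cl | now apply Hf0]).
intros v. destruct (Hf (l v)) as [Hf1 Hf2].
assert (E : forall p, (fun t : R => f (l (plus p (scal t v)))) =
   (fun t : R => f (plus (l p : R_NormedModule) (scal t (l v : R_NormedModule))))).
{ intros p. apply functional_extensionality. intros t. now rewrite Hl. }
split.
- intros p Hp. rewrite E. now apply Hf1.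
- replace (dirD v (fun p => f (l p))) with (fun p => dirD (l v : R_NormedModule) f (l p)).
  + now apply IH.
  + apply functional_extensionality. intros p. unfold dirD. now rewrite E.
Qed.

Lemma Cks_id k (U : R -> Prop) : Cks k (U : R_NormedModule -> Prop) (fun t => t).
Proof.
assert (D : forall p v : R, is_derive (fun t : R => plus p (scal t v)) 0 v).
{ intros p v. unfold plus, scal; simpl; unfold mult; simpl. auto_derive; trivial; ring. }
destruct k; split; trivial; try (intros p _; apply continuous_id).
intros v. split.
- intros p _. eexists. apply D.
- replace (dirD (v : R_NormedModule) (fun t => t)) with (fun _ : R => v).
  + apply (@Cks_const R_NormedModule).
  + apply functional_extensionality. intros p. symmetry. apply is_dirD. apply D.
Qed.

Lemma Cks_linear {V : NormedModule R_AbsRing} k (U : V -> Prop) (l : V -> R) :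
  (forall p v (t : R), l (plus p (scal t v)) = l p + t * l v) ->
  (forall p, continuous l p) -> Cks k U l.
Proof.
intros Hl Cl.
assert (D : forall p v, is_derive (fun t : R => l (plus p (scal t v))) 0 (l v)).
{ intros p v. apply is_derive_ext with (fun t : R => l p + t * l v).
  - intros t. now rewrite Hl.
  - auto_derive; trivial; ring. }
destruct k; split; trivial; try (intros p _; apply Cl).
intros v. split.
- intros p _. eexists. apply D.
- replace (dirD v l) with (fun _ : V => l v).
  + apply Cks_const.
  + apply functional_extensionality. intros p. symmetry. apply is_dirD. apply D.
Qed.

Lemma dirD_R (v : R) (f : R -> R) (p l : R) :
  is_derive f p l -> is_derive (fun t : R => f (plus (p : R_NormedModule) (scal t (v :
    R_NormedModule)))) 0 (v * l).
Proof.
intros H. apply (is_derive_comp f (fun t : R => plus (p : R_NormedModule) (scal t (v :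
  R_NormedModule)))).
- unfold plus, scal; simpl; unfold mult; simpl. replace (p + 0 * v) with p by ring. exact H.
- unfold plus, scal; simpl; unfold mult; simpl. auto_derive; trivial; ring.
Qed.

Lemma ex_derive_dirD_R (f : R -> R) (p : R) :
  ex_derive (fun t : R => f (plus (p : R_NormedModule) (scal t (1 : R_NormedModule)))) 0 ->
    ex_derive f p.
Proof.
intros H.
apply ex_derive_ext with (f := fun s : R => (fun t => f (plus (p : R_NormedModule) (scal t (1 :
  R_NormedModule)))) (s - p)).
- intros s. f_equal. unfold plus, scal; simpl; unfold mult; simpl. ring.
- apply (ex_derive_comp (fun t : R => f (plus (p : R_NormedModule) (scal t (1 :
  R_NormedModule)))) (fun s => s - p)).
  + replace (p - p) with 0 by ring. exact H.
  + auto_derive; trivial.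
Qed.

(** On the real line the derivative in direction [1] is the ordinary one, and differentiability
    gives the continuity that [Ck] does not ask for. *)
Lemma Ck_Cks_R k (U : R -> Prop) (f : R -> R) :
  Ck k (U : R_NormedModule -> Prop) f -> Cks k (U : R_NormedModule -> Prop) f.
Proof.
revert f. induction k as [|k IH]; intros f H; split; trivial.
- intros p Hp. apply (ex_derive_continuous f p). apply ex_derive_dirD_R. now apply (H 1).
- intros v. destruct (H v) as [H1 H2]. split; trivial. now apply IH.
Qed.

(** Indexing a function together with all its derivatives lets one induction treat every member at
    once; sine and cosine are then families of period 4. *)
Lemma Cks_smooth_R (fam : nat -> R -> R) (U : R -> Prop) :
  (forall n p, is_derive (fam n) p (fam (S n) p)) ->
  forall k n, Cks k (U : R_NormedModule -> Prop) (fam n).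
Proof.
intros H. assert (open (fun _ : R_NormedModule => True)) as HT by (intros p _;
  apply filter_true).
assert (C : forall n p, continuous (fam n) p).
{ intros n p. apply (ex_derive_continuous (fam n)). eexists. apply H. }
assert (G : forall k n, Cks k ((fun _ => True) : R_NormedModule -> Prop) (fam n)).
{ induction k as [|k IH]; intros n; split; trivial; try (intros p _; apply C).
  intros v. split.
  - intros p _. eexists. apply (dirD_R v (fam n) p). apply H.
  - replace (dirD (v : R_NormedModule) (fam n)) with (fun p : R => v * fam (S n) p).
    + apply (@Cks_mult R_NormedModule k _ (fun _ => v) (fam (S n))); auto.
      apply (@Cks_const R_NormedModule).
    + apply functional_extensionality. intros p. symmetry. apply is_dirD.
      apply (dirD_R v (fam n) p). apply H. }
assert (M : forall k (f : R -> R),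
  Cks k ((fun _ => True) : R_NormedModule -> Prop) f -> Cks k (U : R_NormedModule -> Prop) f).
{ induction k as [|k IH]; intros f [H0 H1]; split; auto.
  intros v. destruct (H1 v). split; auto. }
intros k n. apply M. apply G.
Qed.

Lemma Cks_cos k (U : R -> Prop) : Cks k (U : R_NormedModule -> Prop) cos.
Proof.
apply (Cks_smooth_R (fun n => match Nat.modulo n 4 with
  0 => cos | 1 => fun t => - sin t | 2 => fun t => - cos t |
    _ => sin end)%nat U) with (n := 0%nat).
intros n p. replace (S n mod 4)%nat with (S (n mod 4) mod 4)%nat.
2:{ rewrite <- Nat.add_1_r. rewrite Nat.Div0.add_mod_idemp_l. now rewrite Nat.add_1_r. }
pose proof (Nat.mod_upper_bound n 4 ltac:(lia)) as Hn.
destruct (n mod 4)%nat as [|[|[|[|m]]]]; try lia; cbn -[cos sin]; auto_derive; trivial; ring.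
Qed.

Lemma Cks_sin k (U : R -> Prop) : Cks k (U : R_NormedModule -> Prop) sin.
Proof.
apply (Cks_smooth_R (fun n => match Nat.modulo n 4 with
  0 => sin | 1 => cos | 2 => fun t => - sin t |
    _ => fun t => - cos t end)%nat U) with (n := 0%nat).
intros n p. replace (S n mod 4)%nat with (S (n mod 4) mod 4)%nat.
2:{ rewrite <- Nat.add_1_r. rewrite Nat.Div0.add_mod_idemp_l. now rewrite Nat.add_1_r. }
pose proof (Nat.mod_upper_bound n 4 ltac:(lia)) as Hn.
destruct (n mod 4)%nat as [|[|[|[|m]]]]; try lia; cbn -[cos sin]; auto_derive; trivial; ring.
Qed.

Lemma Ck1_R (f f1 : R -> R) :
  (forall t, is_derive f t (f1 t)) -> (forall t, continuous f1 t) ->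
  Ck 1 ((fun _ => True) : R_NormedModule -> Prop) f.
Proof.
intros D C v. split.
- intros p _. eexists. apply (dirD_R v f p). apply D.
- simpl. replace (dirD (v : R_NormedModule) f) with (fun p : R => v * f1 p).
  + intros p _. apply (continuous_mult (fun _ => v) f1); auto. apply continuous_const.
  + apply functional_extensionality. intros p. symmetry. apply is_dirD.
    apply (dirD_R v f p). apply D.
Qed.

Lemma dirD_R_1 (f : R -> R) (p : R) : dirD (1 : R_NormedModule) f p = Derive f p.
Proof.
unfold dirD.
transitivity (Derive (fun s => f (p + s)) 0).
- apply Derive_ext. intros t. f_equal. unfold plus, scal; simpl; unfold mult; simpl. ring.
- unfold Derive. f_equal. apply Lim_ext. intros y. rewrite !Rplus_0_r, Rplus_0_l. reflexivity.
Qed.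

Lemma continuous_cx p : continuous cx p.
Proof.
apply (continuous_comp (fun q : R3 => fst q) (fun q : R * R => fst q)); apply continuous_fst.
Qed.
Lemma continuous_cy p : continuous cy p.
Proof.
apply (continuous_comp (fun q : R3 => fst q) (fun q : R * R => snd q));
  [apply continuous_fst | apply continuous_snd].
Qed.
Lemma continuous_cz p : continuous cz p.
Proof. apply continuous_snd. Qed.

Lemma open_full {V : NormedModule R_AbsRing} : open (fun _ : V => True).
Proof. intros p _. apply filter_true. Qed.

(** * Curves in space and the intrinsic distance *)

Lemma is_derive_const_R (c x : R) : is_derive (fun _ : R => c) x 0.
Proof. apply (is_derive_const (K := R_AbsRing) (V := R_NormedModule)). Qed.

Lemma is_derive_id_R (x : R) : is_derive (fun t : R => t) x 1.
Proof. apply (is_derive_id (K := R_AbsRing)). Qed.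

Lemma is_derive_plus_R (f g : R -> R) (x l l' : R) : is_derive f x l -> is_derive g x l' ->
  is_derive (fun t => f t + g t) x (l + l').
Proof. apply (is_derive_plus (K := R_AbsRing) (V := R_NormedModule)). Qed.

Lemma is_derive_minus_R (f g : R -> R) (x l l' : R) : is_derive f x l -> is_derive g x l' ->
  is_derive (fun t => f t - g t) x (l - l').
Proof. apply (is_derive_minus (K := R_AbsRing) (V := R_NormedModule)). Qed.

Lemma is_derive_opp_R (f : R -> R) (x l : R) : is_derive f x l ->
  is_derive (fun t => - f t) x (- l).
Proof. apply (is_derive_opp (K := R_AbsRing) (V := R_NormedModule)). Qed.

Lemma is_derive_mult_R (f g : R -> R) (x l l' : R) : is_derive f x l -> is_derive g x l' ->
  is_derive (fun t => f t * g t) x (l * g x + f x * l').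
Proof. intros Hf Hg. exact (is_derive_mult f g x l l' Hf Hg Rmult_comm). Qed.

Lemma is_derive_comp_R (f g : R -> R) (x l l' : R) : is_derive f (g x) l -> is_derive g x l' ->
  is_derive (fun t => f (g t)) x (l' * l).
Proof. apply (is_derive_comp (K := R_AbsRing) (V := R_NormedModule)). Qed.

Lemma continuous_plus_R (f g : R -> R) (x : R) : continuous f x -> continuous g x ->
  continuous (fun t => f t + g t) x.
Proof. apply (continuous_plus (K := R_AbsRing) (V := R_NormedModule)). Qed.

Lemma continuous_minus_R (f g : R -> R) (x : R) : continuous f x -> continuous g x ->
  continuous (fun t => f t - g t) x.
Proof. apply (continuous_minus (K := R_AbsRing) (V := R_NormedModule)). Qed.

Lemma continuous_opp_R (f : R -> R) (x : R) : continuous f x -> continuous (fun t => - f t) x.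
Proof. apply (continuous_opp (K := R_AbsRing) (V := R_NormedModule)). Qed.

Lemma continuous_mult_R (f g : R -> R) (x : R) : continuous f x -> continuous g x ->
  continuous (fun t => f t * g t) x.
Proof. apply (continuous_mult (K := R_AbsRing)). Qed.

Lemma is_derive_continuous (f : R -> R) (x l : R) : is_derive f x l -> continuous f x.
Proof. intros D. apply (ex_derive_continuous f). now exists l. Qed.

Lemma sin_cos_sq t : sin t * sin t + cos t * cos t = 1.
Proof. pose proof (sin2_cos2 t) as E. unfold Rsqr in E. exact E. Qed.

Definition is_derive3 (q : R -> R3) (t : R) (l : R3) : Prop :=
  is_derive (fun s => cx (q s)) t (cx l) /\
  is_derive (fun s => cy (q s)) t (cy l) /\
  is_derive (fun s => cz (q s)) t (cz l).

Definition continuous3 (q : R -> R3) (t : R) : Prop :=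
  continuous (fun s => cx (q s)) t /\
  continuous (fun s => cy (q s)) t /\
  continuous (fun s => cz (q s)) t.

Lemma R3_eq (p q : R3) : cx p = cx q -> cy p = cy q -> cz p = cz q -> p = q.
Proof. destruct p as [[]], q as [[]]; unfold cx, cy, cz; simpl. congruence. Qed.

Lemma dirD3_is_derive3 (q : R -> R3) t l : is_derive3 q t l ->
  dirD3 (1 : R_NormedModule) q t = l.
Proof.
intros (H1 & H2 & H3). apply R3_eq; unfold dirD3, cx at 1, cy at 1, cz at 1; simpl;
 rewrite dirD_R_1; now apply is_derive_unique.
Qed.

Lemma is_derive_eq (f : R -> R) (x l l' : R) : is_derive f x l -> l = l' -> is_derive f x l'.
Proof. now intros H <-. Qed.

Lemma is_derive_dot (p q : R -> R3) t p1 q1 :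
  is_derive3 p t p1 -> is_derive3 q t q1 ->
  is_derive (fun s => dot (p s) (q s)) t (dot p1 (q t) + dot (p t) q1).
Proof.
intros (A1 & A2 & A3) (B1 & B2 & B3). unfold dot.
eapply is_derive_eq.
- apply is_derive_plus_R; [apply is_derive_plus_R|];
  (apply is_derive_mult_R; [eassumption | eassumption]).
- cbv beta. ring.
Qed.

Lemma is_derive3_const (p : R3) t : is_derive3 (fun _ => p) t (0, 0, 0).
Proof. split; [|split]; apply is_derive_const_R. Qed.

Lemma continuous_dot (p q : R -> R3) t : continuous3 p t -> continuous3 q t ->
  continuous (fun s => dot (p s) (q s)) t.
Proof.
intros (A1 & A2 & A3) (B1 & B2 & B3). unfold dot.
apply continuous_plus_R; [apply continuous_plus_R|];
  now apply continuous_mult_R.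
Qed.

Lemma continuous3_const (p : R3) t : continuous3 (fun _ => p) t.
Proof. split; [|split]; apply continuous_const. Qed.

Lemma continuous_enorm (q : R -> R3) t : continuous3 q t -> continuous (fun s => enorm (q s)) t.
Proof.
intros H. apply (continuous_comp (fun s => dot (q s) (q s)) sqrt).
- now apply continuous_dot.
- apply continuous_sqrt.
Qed.

Lemma dot_ge_0 p : 0 <= dot p p.
Proof. unfold dot. pose proof (Rle_0_sqr (cx p)). pose proof (Rle_0_sqr (cy p)).
  pose proof (Rle_0_sqr (cz p)). unfold Rsqr in *. lra. Qed.

Lemma cauchy_schwarz p q : dot p q <= enorm p * enorm q.
Proof.
unfold enorm. rewrite <- sqrt_mult by apply dot_ge_0.
apply Rle_trans with (Rabs (dot p q)); [apply Rle_abs|].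
rewrite <- sqrt_Rsqr_abs. apply sqrt_le_1_alt. unfold Rsqr.
pose proof (dot_ge_0 (cross p q)) as H. unfold dot, cross, cx, cy, cz in *. simpl in *. nra.
Qed.

Lemma enorm_sq p : enorm p * enorm p = dot p p.
Proof. apply sqrt_sqrt. apply dot_ge_0. Qed.

(** Comparison of the speed with the derivative of [G] bounds the length by the variation of [G], so
    that no length has to be computed. *)
Lemma path_length_le (gam g1 : R -> R3) (G Gd : R -> R) :
  (forall t, 0 <= t <= 1 -> is_derive3 gam t (g1 t)) ->
  (forall t, 0 <= t <= 1 -> continuous3 g1 t) ->
  (forall t, 0 <= t <= 1 -> is_derive G t (Gd t)) ->
  (forall t, 0 <= t <= 1 -> continuous Gd t) ->
  (forall t, 0 <= t <= 1 -> enorm (g1 t) <= Gd t) ->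
  path_length gam <= G 1 - G 0.
Proof.
intros H1 H2 H3 H4 H5. unfold path_length.
assert (mm : Rmin 0 1 = 0 /\ Rmax 0 1 = 1) by (split; [apply Rmin_left | apply Rmax_right];
  lra).
destruct mm as [m1 m2].
replace (RInt _ 0 1) with (RInt (fun t => enorm (g1 t)) 0 1).
2:{ apply RInt_ext. rewrite m1, m2. intros t Ht.
  rewrite (dirD3_is_derive3 gam t (g1 t)); trivial. apply H1. lra. }
assert (I : is_RInt Gd 0 1 (minus (G 1) (G 0))).
{ apply (is_RInt_derive G Gd); rewrite m1, m2; intros t Ht; auto. }
replace (G 1 - G 0) with (RInt Gd 0 1).
2:{ apply is_RInt_unique. exact I. }
apply RInt_le; try lra.
- apply (ex_RInt_continuous (V := R_CompleteNormedModule)). rewrite m1, m2. intros t Ht.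
  apply continuous_enorm. auto.
- eexists. apply I.
- intros t Ht. apply H5. lra.
Qed.

Lemma C1_path_derive (S : R3 -> Prop) p q gam : C1_path_in S p q gam ->
  (forall t, is_derive3 gam t (dirD3 (1 : R_NormedModule) gam t)) /\
  (forall t, continuous3 (dirD3 (1 : R_NormedModule) gam) t).
Proof.
intros ((C1 & C2 & C3) & _).
assert (A : forall f : R -> R, Ck 1 ((fun _ => True) : R_NormedModule -> Prop) f ->
   (forall t, is_derive f t (dirD (1 : R_NormedModule) f t)) /\
   forall t, continuous (dirD (1 : R_NormedModule) f) t).
{ intros f Hf. destruct (Hf 1) as [D C]. split.
  - intros t. rewrite dirD_R_1. apply Derive_correct. apply ex_derive_dirD_R. now apply D.
  - intros t. now apply C. }
destruct (A _ C1) as [D1 K1]. destruct (A _ C2) as [D2 K2]. destruct (A _ C3) as [D3 K3].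
split; intros t; (split; [|split]);
  [exact (D1 t) | exact (D2 t) | exact (D3 t) | exact (K1 t) | exact (K2 t) | exact (K3 t)].
Qed.

(** Integrating the velocity against the chord [v] gives the square of [enorm v], while
    Cauchy-Schwarz bounds the integrand by the speed times [enorm v]. *)
Lemma enorm_le_length (S : R3 -> Prop) p q gam : C1_path_in S p q gam ->
  enorm (minus q p) <= path_length gam.
Proof.
intros H. destruct (C1_path_derive _ _ _ _ H) as [D C]. destruct H as (_ & _ & E0 & E1).
set (g1 := dirD3 (1 : R_NormedModule) gam) in *.
set (v := minus q p). unfold path_length. fold g1.
assert (mm : Rmin 0 1 = 0 /\ Rmax 0 1 = 1) by (split; [apply Rmin_left | apply Rmax_right];
  lra).
destruct mm as [m1 m2].
assert (Ce : forall t, continuous (fun s => enorm (g1 s)) t) by (intros;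
  apply continuous_enorm; auto).
assert (I1 : ex_RInt (fun t => enorm (g1 t)) 0 1)
  by (apply (ex_RInt_continuous (V := R_CompleteNormedModule)); auto).
assert (P : 0 <= RInt (fun t => enorm (g1 t)) 0 1).
{ apply RInt_ge_0; auto; try lra. intros. apply sqrt_pos. }
change (RInt (fun t => enorm (dirD3 1 gam t)) 0 1) with (RInt (fun t => enorm (g1 t)) 0 1).
set (L := RInt (fun t => enorm (g1 t)) 0 1) in *.
assert (I2 : is_RInt (fun t => dot (g1 t) v) 0 1 (minus (dot (gam 1) v) (dot (gam 0) v))).
{ apply (is_RInt_derive (fun t => dot (gam t) v)).
  - intros t _. replace (dot (g1 t) v) with (dot (g1 t) v + dot (gam t) (0,0,0)).
    + apply (is_derive_dot gam (fun _ => v)); [apply D | apply is_derive3_const].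
    + unfold dot, cx, cy, cz; simpl; ring.
  - intros t _. apply continuous_dot; [apply C | apply continuous3_const]. }
assert (I3 : is_RInt (fun t => enorm (g1 t) * enorm v) 0 1 (L * enorm v)).
{ replace (L * enorm v) with (scal (enorm v) L) by apply Rmult_comm.
  apply is_RInt_ext with (fun t => scal (enorm v) (enorm (g1 t))).
  - intros t _. apply Rmult_comm.
  - apply (is_RInt_scal (V := R_NormedModule)).
    apply (RInt_correct (V := R_CompleteNormedModule)). exact I1. }
assert (K : minus (dot (gam 1) v) (dot (gam 0) v) <= L * enorm v).
{ apply (is_RInt_le (fun t => dot (g1 t) v) (fun t => enorm (g1 t) * enorm v) 0 1); auto;
  try lra.
  intros t _. apply cauchy_schwarz. }
replace (minus (dot (gam 1) v) (dot (gam 0) v)) with (enorm v * enorm v) in K.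
2:{ rewrite enorm_sq. rewrite E0, E1.
  unfold v, minus, plus, opp, dot, cx, cy, cz; simpl; unfold plus, opp; simpl; ring. }
destruct (Rle_lt_dec (enorm v) 0) as [Z|Z]; [lra|].
apply Rmult_le_reg_r with (enorm v); trivial.
Qed.

Lemma intrinsic_dist_lt (S : R3 -> Prop) p q gam eps :
  C1_path_in S p q gam -> path_length gam < eps -> Rbar_lt (intrinsic_dist S p q) eps.
Proof.
intros H L. unfold intrinsic_dist.
apply Rbar_le_lt_trans with (path_length gam); [|exact L].
apply Glb_Rbar_correct. now exists gam.
Qed.

Lemma intrinsic_dist_enorm (S : R3 -> Prop) p q (eps : R) :
  Rbar_lt (intrinsic_dist S p q) eps -> enorm (minus q p) < eps.
Proof.
intros H. apply Rnot_le_lt. intros H'. apply Rbar_lt_not_le in H. apply H.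
unfold intrinsic_dist. apply Glb_Rbar_correct. intros l (gam & G & ->).
simpl. apply Rle_trans with (1 := H'). eapply enorm_le_length. exact G.
Qed.

(** [C1_path_in] asks for a path of class C^1 on the whole line, although the curves to be used are
    controlled on an interval only. This function maps the whole line into [0, 1], fixes both ends
    and does not decrease on [0, 1]; composing with it gives admissible paths. *)
Definition smoothstep (t : R) : R := (1 - cos (PI * t)) / 2.

Lemma smoothstep_0 : smoothstep 0 = 0.
Proof. unfold smoothstep. rewrite Rmult_0_r, cos_0. lra. Qed.
Lemma smoothstep_1 : smoothstep 1 = 1.
Proof. unfold smoothstep. rewrite Rmult_1_r, cos_PI. lra. Qed.
Lemma smoothstep_bound t : 0 <= smoothstep t <= 1.
Proof. unfold smoothstep. pose proof (COS_bound (PI * t)). lra. Qed.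
Definition smoothstep' (t : R) : R := PI * sin (PI * t) / 2.
Lemma is_derive_smoothstep t : is_derive smoothstep t (smoothstep' t).
Proof. unfold smoothstep, smoothstep'. auto_derive; trivial. field. Qed.
Lemma smoothstep'_pos t : 0 <= t <= 1 -> 0 <= smoothstep' t.
Proof.
intros H. unfold smoothstep'. pose proof PI_RGT_0.
assert (0 <= sin (PI * t)) by (apply sin_ge_0; nra). nra.
Qed.
Lemma continuous_smoothstep' t : continuous smoothstep' t.
Proof. apply (ex_derive_continuous smoothstep'). unfold smoothstep'. auto_derive. trivial. Qed.

Lemma enorm_coord p : Rabs (cx p) <= enorm p /\ Rabs (cy p) <= enorm p /\
  Rabs (cz p) <= enorm p.
Proof.
unfold enorm.
pose proof (Rle_0_sqr (cx p)); pose proof (Rle_0_sqr (cy p)); pose proof (Rle_0_sqr (cz p)).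
unfold Rsqr in *.
repeat split; rewrite <- sqrt_Rsqr_abs; apply sqrt_le_1_alt; unfold dot, Rsqr; lra.
Qed.

Lemma enorm_le_sum p : enorm p <= Rabs (cx p) + Rabs (cy p) + Rabs (cz p).
Proof.
pose proof (Rabs_pos (cx p)); pose proof (Rabs_pos (cy p)); pose proof (Rabs_pos (cz p)).
unfold enorm. apply Rsqr_incr_0_var; [|lra].
rewrite Rsqr_sqrt by apply dot_ge_0. unfold dot, Rsqr.
rewrite <- (Rabs_pos_eq (cx p * cx p)), <- (Rabs_pos_eq (cy p * cy p)),
  <- (Rabs_pos_eq (cz p * cz p)) by apply Rle_0_sqr.
rewrite !Rabs_mult. nra.
Qed.

Definition lim3 (a : nat -> R3) (p : R3) : Prop :=
  is_lim_seq (fun n => cx (a n)) (cx p) /\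
  is_lim_seq (fun n => cy (a n)) (cy p) /\
  is_lim_seq (fun n => cz (a n)) (cz p).

Lemma cx_minus p q : cx (minus p q) = cx p - cx q.
Proof. reflexivity. Qed.
Lemma cy_minus p q : cy (minus p q) = cy p - cy q.
Proof. reflexivity. Qed.
Lemma cz_minus p q : cz (minus p q) = cz p - cz q.
Proof. reflexivity. Qed.

Lemma lim3_enorm a p : lim3 a p <-> forall eps : posreal, exists N, forall n,
  (N <= n)%nat -> enorm (minus p (a n)) < eps.
Proof.
split.
- intros (H1 & H2 & H3) eps.
  assert (E : 0 < eps / 3) by (destruct eps; simpl; lra).
  apply is_lim_seq_spec in H1, H2, H3.
  destruct (H1 (mkposreal _ E)) as [N1 K1]. destruct (H2 (mkposreal _ E)) as [N2 K2].
  destruct (H3 (mkposreal _ E)) as [N3 K3]. simpl in *.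
  exists (N1 + N2 + N3)%nat. intros n Hn.
  specialize (K1 n ltac:(lia)). specialize (K2 n ltac:(lia)). specialize (K3 n ltac:(lia)).
  apply Rle_lt_trans with (1 := enorm_le_sum _). rewrite cx_minus, cy_minus, cz_minus.
  rewrite (Rabs_minus_sym (cx p)), (Rabs_minus_sym (cy p)), (Rabs_minus_sym (cz p)). lra.
- intros H. split; [|split]; apply is_lim_seq_spec; intros eps; destruct (H eps) as [N HN];
  exists N; intros n Hn; rewrite Rabs_minus_sym; eapply Rle_lt_trans; try apply (HN n Hn);
  apply (enorm_coord (minus p (a n))).
Qed.

(** The intrinsic distance dominates the Euclidean one, so the three coordinates are Cauchy
    sequences of reals. *)
Lemma intrinsic_cauchy_lim (S : R3 -> Prop) (a : nat -> R3) :
  (forall eps : posreal, exists N : nat, forall m n : nat,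
        (N <= m)%nat -> (N <= n)%nat -> Rbar_lt (intrinsic_dist S (a m) (a n)) eps) ->
  exists p, lim3 a p.
Proof.
intros H.
assert (C : forall c : R3 -> R, (forall p, Rabs (c p) <= enorm p) -> (forall p q,
  c (minus p q) = c p - c q) ->
  exists l : R, is_lim_seq (fun n => c (a n)) l).
{ intros c Hc Hm. apply ex_lim_seq_cauchy_corr. intros eps. destruct (H eps) as [N HN].
  exists N. intros n m Hn Hm'. rewrite <- Hm. eapply Rle_lt_trans; [apply Hc|].
  eapply intrinsic_dist_enorm. now apply HN. }
destruct (C cx) as [x Hx]; [apply enorm_coord | apply cx_minus |].
destruct (C cy) as [y Hy]; [apply enorm_coord | apply cy_minus |].
destruct (C cz) as [z Hz]; [apply enorm_coord | apply cz_minus |].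
now exists (x, y, z).
Qed.

Lemma intrinsic_lim (S : R3 -> Prop) (a : nat -> R3) p :
  (forall eps : posreal, exists N : nat, forall n : nat,
        (N <= n)%nat -> Rbar_lt (intrinsic_dist S (a n) p) eps) -> lim3 a p.
Proof.
intros H. apply lim3_enorm. intros eps. destruct (H eps) as [N HN]. exists N. intros n Hn.
eapply intrinsic_dist_enorm. now apply HN.
Qed.

Lemma Ck3_1_path gam g1 : (forall t, is_derive3 gam t (g1 t)) -> (forall t, continuous3 g1 t) ->
  Ck3 1 ((fun _ => True) : R_NormedModule -> Prop) gam.
Proof.
intros D C. split; [|split].
- apply (Ck1_R (fun t => cx (gam t)) (fun t => cx (g1 t))); intros t;
  [exact (proj1 (D t)) | exact (proj1 (C t))].
- apply (Ck1_R (fun t => cy (gam t)) (fun t => cy (g1 t))); intros t;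
  [exact (proj1 (proj2 (D t))) | exact (proj1 (proj2 (C t)))].
- apply (Ck1_R (fun t => cz (gam t)) (fun t => cz (g1 t))); intros t;
  [exact (proj2 (proj2 (D t))) | exact (proj2 (proj2 (C t)))].
Qed.

(** * Spheres and cylinders *)

(** For a unit vector [d] this is the inner product of the components orthogonal to [d]; for [d = 0]
    it is the full inner product. Hence [tube] is a cylinder in the first case and a sphere in the
    second, and both are treated at once. *)
Definition radial_form (d v w : R3) : R := dot v w - dot v d * dot w d.

Definition tube (o d : R3) (r : R) (p : R3) : Prop := radial_form d (minus p o) (minus p o) = r
  * r.

Ltac coords := unfold radial_form, enorm, cross; unfold dot;
  unfold minus, plus, scal, opp, cx, cy, cz; simpl;
  unfold plus, scal, opp, mult; simpl; unfold plus, scal, opp, mult; simpl.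

Lemma cx_linear (p v : R3) (t : R) : cx (plus p (scal t v)) = cx p + t * cx v.
Proof. reflexivity. Qed.
Lemma cy_linear (p v : R3) (t : R) : cy (plus p (scal t v)) = cy p + t * cy v.
Proof. reflexivity. Qed.
Lemma cz_linear (p v : R3) (t : R) : cz (plus p (scal t v)) = cz p + t * cz v.
Proof. reflexivity. Qed.

Lemma Cks_coords k (U : R3 -> Prop) : Cks k U cx /\ Cks k U cy /\ Cks k U cz.
Proof.
split; [|split].
- exact (Cks_linear k U cx cx_linear continuous_cx).
- exact (Cks_linear k U cy cy_linear continuous_cy).
- exact (Cks_linear k U cz cz_linear continuous_cz).
Qed.

Lemma Cks_radial_form k (o d : R3) (c : R) : Cks k (fun _ => True) (fun q => radial_form d
  (minus q o) (minus q o) + c).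
Proof.
pose proof (@open_full (prod_NormedModule R_AbsRing (prod_NormedModule R_AbsRing R_NormedModule
  R_NormedModule) R_NormedModule)) as HO.
destruct (Cks_coords k (fun _ => True)) as (Hx & Hy & Hz).
assert (Hc : forall c : R, Cks k (fun _ : R3 => True) (fun _ => c)) by (intros;
  apply Cks_const).
assert (Hl : forall a b e f : R,
  Cks k (fun _ : R3 => True) (fun q => a * cx q + b * cy q + e * cz q + f)).
{ intros a b e f.
  apply (Cks_plus k _ (fun q : R3 => a * cx q + b * cy q + e * cz q) (fun _ => f)); auto.
  apply (Cks_plus k _ (fun q : R3 => a * cx q + b * cy q) (fun q => e * cz q)); auto.
  apply (Cks_plus k _ (fun q : R3 => a * cx q) (fun q => b * cy q)); auto.
  apply (Cks_mult k _ (fun _ => a) cx); auto.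
  apply (Cks_mult k _ (fun _ => b) cy); auto.
  apply (Cks_mult k _ (fun _ => e) cz); auto. }
pose (l1 := fun q : R3 => 1 * cx q + 0 * cy q + 0 * cz q + - cx o).
pose (l2 := fun q : R3 => 0 * cx q + 1 * cy q + 0 * cz q + - cy o).
pose (l3 := fun q : R3 => 0 * cx q + 0 * cy q + 1 * cz q + - cz o).
pose (l4 := fun q : R3 => cx d * cx q + cy d * cy q + cz d * cz q + - dot o d).
apply (Cks_ext_on k _ (fun q => l1 q * l1 q + l2 q * l2 q + l3 q * l3 q + (-1) * (l4 q * l4 q)
  + c)); auto.
{ intros [[q1 q2] q3] _. unfold l1, l2, l3, l4. clear.
  destruct o as [[o1 o2] o3], d as [[d1 d2] d3]. coords. ring. }
assert (H1 : Cks k (fun _ => True) l1) by apply Hl.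
assert (H2 : Cks k (fun _ => True) l2) by apply Hl.
assert (H3 : Cks k (fun _ => True) l3) by apply Hl.
assert (H4 : Cks k (fun _ => True) l4) by apply Hl.
clearbody l1 l2 l3 l4.
apply (Cks_plus k _ (fun q => l1 q * l1 q + l2 q * l2 q + l3 q * l3 q + (-1) * (l4 q * l4 q))
  (fun _ => c)); auto.
apply (Cks_plus k _ (fun q => l1 q * l1 q + l2 q * l2 q + l3 q * l3 q) (fun q => (-1) * (l4 q *
  l4 q))); auto.
apply (Cks_plus k _ (fun q => l1 q * l1 q + l2 q * l2 q) (fun q => l3 q * l3 q)); auto.
apply (Cks_plus k _ (fun q => l1 q * l1 q) (fun q => l2 q * l2 q)); auto.
apply (Cks_mult k _ l1 l1); auto.
apply (Cks_mult k _ l2 l2); auto.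
apply (Cks_mult k _ l3 l3); auto.
apply (Cks_mult k _ (fun _ => -1) (fun q => l4 q * l4 q)); auto.
apply (Cks_mult k _ l4 l4); auto.
Qed.

Lemma Cks_mono {V : NormedModule R_AbsRing} k (U W : V -> Prop) f :
  (forall p, W p -> U p) -> Cks k U f -> Cks k W f.
Proof.
intros HUW. revert f. induction k as [|k IH]; intros f [H0 H1]; split; auto.
intros v. destruct (H1 v). split; auto.
Qed.

Lemma dirD_radial_form o d c (q v : R3) : dirD v (fun q => radial_form d (minus q o) (minus q
  o) + c) q = 2 * radial_form d (minus q o) v.
Proof.
apply is_dirD.
apply is_derive_ext with (fun t => radial_form d (minus q o) (minus q o) + c + t * (2 *
  radial_form d (minus q o) v) + t * t * radial_form d v v).
- intros t. destruct q as [[q1 q2] q3], o as [[o1 o2] o3], d as [[d1 d2] d3],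
  v as [[v1 v2] v3]. coords. ring.
- auto_derive; trivial. ring.
Qed.

Lemma tube_embedded (o d : R3) (r : R) : 0 < r -> embedded_C2_surface (tube o d r).
Proof.
intros Hr p Hp.
assert (Cont : forall q : R3, continuous (fun q : R3 => radial_form d (minus q o) (minus p o))
  q).
{ assert (C1 : Cks 0 (fun _ => True) (fun q => radial_form d (minus q o) (minus q o) + 0)) by
  apply Cks_radial_form.
  intros q.
  apply continuous_ext with (fun q : R3 => (cx (minus p o) - dot (minus p o) d * cx d) * cx q +
     (cy (minus p o) - dot (minus p o) d * cy d) * cy q + (cz (minus p o) - dot (minus p o) d *
       cz d) * cz q + (- radial_form d o (minus p o))).
  - intros [[q1 q2] q3]. destruct p as [[p1 p2] p3], o as [[o1 o2] o3], d as [[d1 d2] d3].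
    clear. coords. ring.
  - apply (continuous_plus (fun q : R3 => _ * cx q + _ * cy q + _ * cz q) (fun _ => _));
    [|apply continuous_const].
    apply (continuous_plus (fun q : R3 => _ * cx q + _ * cy q) (fun q => _ * cz q));
      [apply (continuous_plus (fun q : R3 => _ * cx q) (fun q => _ * cy q))|].
    + apply (continuous_mult (fun _ => _) cx); [apply continuous_const | apply continuous_cx].
    + apply (continuous_mult (fun _ => _) cy); [apply continuous_const | apply continuous_cy].
    + apply (continuous_mult (fun _ => _) cz); [apply continuous_const | apply continuous_cz]. }
(* On this half-space the derivative of the quadratic form in the direction [p - o] is twice the
   expression that defines it, hence positive. At [p] the expression is [r * r]. *)
exists (fun q => 0 < radial_form d (minus q o) (minus p o)),
  (fun q => radial_form d (minus q o) (minus q o) + - (r * r)).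
split; [|split; [|split; [|split]]].
- intros q Hq. apply (Cont q). now apply (open_gt 0).
- unfold tube in Hp. rewrite Hp. nra.
- apply Cks_Ck. apply Cks_mono with (fun _ => True); auto. apply Cks_radial_form.
- intros q Hq. exists (minus p o). rewrite dirD_radial_form. lra.
- intros q Hq. unfold tube. lra.
Qed.

Lemma is_derive3_minus (q : R -> R3) t l o : is_derive3 q t l ->
  is_derive3 (fun s => minus (q s) o) t l.
Proof.
intros (H1 & H2 & H3). split; [|split].
- apply (is_derive_ext (fun s => cx (q s) - cx o)); [reflexivity|]. eapply is_derive_eq.
  + apply (is_derive_minus_R (fun s => cx (q s)) (fun _ => cx o));
    [exact H1 | apply is_derive_const_R].
  + cbv beta. ring.
- apply (is_derive_ext (fun s => cy (q s) - cy o)); [reflexivity|]. eapply is_derive_eq.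
  + apply (is_derive_minus_R (fun s => cy (q s)) (fun _ => cy o));
    [exact H2 | apply is_derive_const_R].
  + cbv beta. ring.
- apply (is_derive_ext (fun s => cz (q s) - cz o)); [reflexivity|]. eapply is_derive_eq.
  + apply (is_derive_minus_R (fun s => cz (q s)) (fun _ => cz o));
    [exact H3 | apply is_derive_const_R].
  + cbv beta. ring.
Qed.

Lemma is_derive_uniq (f : R -> R) (x l1 l2 : R) : is_derive f x l1 -> is_derive f x l2 ->
  l1 = l2.
Proof. intros H1 H2. apply is_derive_unique in H1, H2. congruence. Qed.

Lemma is_derive_radial_form d (p q : R -> R3) t p1 q1 :
  is_derive3 p t p1 -> is_derive3 q t q1 ->
  is_derive (fun s => radial_form d (p s) (q s)) t (radial_form d p1 (q t) + radial_form d (p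
    t) q1).
Proof.
intros H1 H2. unfold radial_form.
pose proof (is_derive_dot p q t p1 q1 H1 H2) as D1.
pose proof (is_derive_dot p (fun _ => d) t p1 _ H1 (is_derive3_const d t)) as D2.
pose proof (is_derive_dot q (fun _ => d) t q1 _ H2 (is_derive3_const d t)) as D3.
pose proof (is_derive_mult_R _ _ t _ _ D2 D3) as D4.
eapply is_derive_eq.
- exact (is_derive_minus_R _ _ t _ _ D1 D4).
- assert (E : forall v, dot v (0,0,0) = 0) by (intros v; coords; ring).
  rewrite !E. cbv beta. ring.
Qed.

Lemma is_dirD3 {V : NormedModule R_AbsRing} (U : V -> Prop) k (X : V -> R3) (u v : V) :
  Ck3 (S k) U X -> U u -> is_derive3 (fun t => X (plus u (scal t v))) 0 (dirD3 v X u) /\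
    Ck3 k U (dirD3 v X).
Proof.
intros (H1 & H2 & H3) Hu.
destruct (H1 v) as [D1 K1], (H2 v) as [D2 K2], (H3 v) as [D3 K3].
split.
- split; [|split].
  + exact (dirD_correct (fun q => cx (X q)) u v (D1 u Hu)).
  + exact (dirD_correct (fun q => cy (X q)) u v (D2 u Hu)).
  + exact (dirD_correct (fun q => cz (X q)) u v (D3 u Hu)).
- split; [|split]; assumption.
Qed.

(** For a 2 by 2 matrix the trace of the square is [(tr A) ^ 2 - 2 det A]; trace and determinant are
    easier to evaluate here than the four entries. *)
Lemma sqnorm_trace_det E F G e f g D :
  D = E * G - F * F -> D <> 0 ->
  let a11 := (G * e - F * f) / D in
  let a12 := (G * f - F * g) / D in
  let a21 := (E * f - F * e) / D in
  let a22 := (E * g - F * f) / D in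
  a11 * a11 + a12 * a21 + (a21 * a12 + a22 * a22) =
  ((G * e - 2 * F * f + E * g) / D) ^ 2 - 2 * ((e * g - f * f) / D).
Proof. intros HD H0. simpl.
  replace (e * g - f * f) with ((e * g - f * f) * D / D) by (now field). rewrite HD. field.
  now rewrite <- HD. Qed.

Lemma dot_scal_l (c : R) (v w : R3) : dot (scal c v) w = c * dot v w.
Proof. coords; ring. Qed.

Lemma cross_sq (a b : R3) : dot (cross a b) (cross a b) = dot a a * dot b b - dot a b * dot a b.
Proof. coords; ring. Qed.

Lemma dot_pos (v : R3) : v <> (0, 0, 0) -> 0 < dot v v.
Proof.
intros H. destruct (dot_ge_0 v) as [P|P]; trivial. exfalso. apply H.
assert (cx v = 0 /\ cy v = 0 /\ cz v = 0) as (E1 & E2 & E3) by (unfold dot in P; repeat split;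
  nra).
now apply R3_eq.
Qed.

(** The part [n] of [p] orthogonal to the axis has length [r] and is orthogonal to [a] and [b], so
    the unit normal is [n / r] up to sign. The second fundamental form is then [radial_form] on
    tangent vectors divided by [r], up to sign, and the eigenvalues of [radial_form] relative to the
    metric are 1 and [1 - m]. *)
Lemma tube_algebra (d p : R3) (r m : R) (X : R2 -> R3) (u : R2) (a := dirD3 (1,
  0) X u) (b := dirD3 (0, 1) X u)
  (e := dirD3 (1, 0) (dirD3 (1, 0) X) u) (f := dirD3 (1, 0) (dirD3 (0, 1) X) u)
  (g := dirD3 (0, 1) (dirD3 (0, 1) X) u) :
  0 < r -> m = dot d d -> (m = 1 \/ d = (0, 0, 0)) -> radial_form d p p = r * r ->
  radial_form d p a = 0 -> radial_form d p b = 0 ->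
  radial_form d p e = - radial_form d a a -> radial_form d p f = - radial_form d a b ->
    radial_form d p g = - radial_form d b b ->
  cross a b <> (0, 0, 0) ->
  sqnorm_A X u = (2 - m) / (r * r).
Proof.
intros Hr Em Hm Hp Ha Hb He Hf Hg Hab.
set (n := minus p (scal (dot p d) d)).
assert (Qn : forall w, radial_form d p w = dot n w) by (intros w; unfold n; coords; ring).
assert (nd : dot n d = 0).
{ rewrite <- Qn. unfold radial_form. rewrite <- Em.
  destruct Hm as [-> | ->]; [ring | coords; ring]. }
assert (nn : dot n n = r * r).
{ transitivity (dot n p - dot p d * dot n d); [unfold n; coords; ring|]. rewrite nd, <- Qn, Hp.
  ring. }
rewrite Qn in Ha, Hb, He, Hf, Hg.
unfold sqnorm_A, first_ff, second_ff, unit_normal. fold a b e f g.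
set (nu := cross a b) in *.
set (D := dot a a * dot b b - dot a b * dot a b).
assert (DE : dot nu nu = D) by apply cross_sq.
assert (D0 : 0 < D) by (rewrite <- DE; now apply dot_pos).
set (mu := dot n nu).
(* Both [n] and [nu] are orthogonal to [a] and [b], so they are parallel, with ratio [mu / D]. *)
assert (par : forall w, D * dot n w = mu * dot nu w).
{ intros w. unfold mu.
  transitivity (dot n nu * dot nu w + (dot n b * dot a (cross w nu) - dot n a * dot b (cross w
    nu))).
  - unfold D, nu. clear. coords. ring.
  - rewrite Ha, Hb. ring. }
assert (mu2 : mu * mu = D * (r * r)).
{ rewrite <- nn, par. unfold mu. f_equal. coords. ring. }
assert (mu0 : mu <> 0) by (intros E; rewrite E in mu2;
  assert (0 < D * (r * r)) by (apply Rmult_lt_0_compat; nra); lra).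
assert (nud : dot nu d = 0).
{ apply Rmult_eq_reg_l with mu; trivial. rewrite <- par, nd. ring. }
(* By [nud] the vector [d] is tangent to the surface; the inverse of the Gram matrix expresses its
   squared length [m] through its products with [a] and [b]. *)
assert (gram : m * D = dot b b * (dot a d * dot a d) - 2 * dot a b * (dot a d * dot b d) + dot
  a a * (dot b d * dot b d)).
{ transitivity (m * D - dot nu d * dot nu d); [rewrite nud; ring|]. rewrite Em. unfold D, nu.
  clear. coords. ring. }
assert (sD : 0 < sqrt D) by now apply sqrt_lt_R0.
assert (sD2 : sqrt D * sqrt D = D) by (apply sqrt_sqrt; lra).
assert (ff : forall w q, dot n w = - q -> dot (scal (/ enorm nu) nu) w = - (sqrt D / mu * q)).
{ intros w q Hw. rewrite dot_scal_l. unfold enorm. rewrite DE.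
  assert (E : dot nu w = - (D * q / mu)).
  { apply Rmult_eq_reg_l with mu; trivial. rewrite <- par, Hw. field. trivial. }
  rewrite E. rewrite <- sD2 at 2. field. lra. }
rewrite (ff _ _ He), (ff _ _ Hf), (ff _ _ Hg).
change (dot (dirD3 (1, 0) X u) (dirD3 (1, 0) X u)) with (dot a a).
change (dot (dirD3 (1, 0) X u) (dirD3 (0, 1) X u)) with (dot a b).
change (dot (dirD3 (0, 1) X u) (dirD3 (0, 1) X u)) with (dot b b).
fold D.
rewrite (sqnorm_trace_det (dot a a) (dot a b) (dot b b) _ _ _ D eq_refl) by lra.
set (t := sqrt D / mu).
assert (t2 : t * t = / (r * r)).
{ unfold t. transitivity (sqrt D * sqrt D / (mu * mu)); [now field|]. rewrite sD2, mu2. field.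
  lra. }
unfold radial_form.
replace ((dot b b * - (t * (dot a a - dot a d * dot a d)) - 2 * dot a b * - (t * (dot a b - dot
  a d * dot b d)) +
   dot a a * - (t * (dot b b - dot b d * dot b d))) / D) with (- t * (2 - m)).
2:{ replace m with (m * D / D) by (field; lra). rewrite gram. unfold D. field. fold D. lra. }
match goal with |- _ - 2 * (?x / D) = _ => replace (x / D) with (t * t * (1 - m)) end.
2:{ replace m with (m * D / D) by (field; lra). rewrite gram. unfold D. field. fold D. lra. }
transitivity (t * t * ((2 - m) * (2 - m) - 2 * (1 - m))); [ring|]. rewrite t2.
replace ((2 - m) * (2 - m) - 2 * (1 - m)) with (2 - m). { unfold Rdiv. ring. }
(* As [m] is 0 or 1, idempotence turns [1 + (1 - m) ^ 2] into [2 - m]. *)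
assert (m * m = m) by (rewrite Em in Hm |- *; destruct Hm as [-> | ->]; [ring | coords; ring]).
  lra.
Qed.

(** The equation of the tube is differentiated along the patch: once for [T1], which makes the
    radius normal to tangent vectors, and once more for [T2], which expresses the normal part of the
    second derivatives by the first ones. *)
Lemma tube_sqnorm_A (o d : R3) (r m : R) :
  0 < r -> m = dot d d -> (m = 1 \/ d = (0, 0, 0)) ->
  constant_sqnorm_A (tube o d r) ((2 - m) / (r * r)).
Proof.
intros Hr Em Hm U X (HU & HX & Hreg & HS) u Hu.
assert (T1 : forall w q, U q -> radial_form d (minus (X q) o) (dirD3 w X q) = 0).
{ intros w q Hq. destruct (is_dirD3 U 1 X q w HX Hq) as [D _].
  pose proof (is_derive3_minus _ _ _ o D) as D'.
  pose proof (is_derive_radial_form d _ _ _ _ _ D' D') as DQ. cbv beta in DQ.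
  rewrite line_0 in DQ.
  assert (Z : is_derive (fun s : R => radial_form d (minus (X (plus q (scal s w))) o) (minus (X
    (plus q (scal s w))) o)) 0 0).
  { apply is_derive_ext_loc with (fun _ => r * r).
    - apply filter_imp with (2 := line_locally U q w 0 HU (eq_ind_r U Hq (line_0 q w))).
      intros t Ht. symmetry. exact (HS _ Ht).
    - apply is_derive_const_R. }
  pose proof (is_derive_uniq _ _ _ _ Z DQ) as E.
  assert (Sy : forall a b, radial_form d a b = radial_form d b a) by (intros a b; coords; ring).
  rewrite (Sy (dirD3 w X q)) in E. lra. }
assert (T2 : forall v w, radial_form d (minus (X u) o) (dirD3 v (dirD3 w X) u) = - radial_form
  d (dirD3 v X u) (dirD3 w X u)).
{ intros v w. destruct (is_dirD3 U 1 X u v HX Hu) as [D _].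
  destruct (is_dirD3 U 1 X u w HX Hu) as [_ HX1].
  destruct (is_dirD3 U 0 _ u v HX1 Hu) as [D1 _].
  pose proof (is_derive3_minus _ _ _ o D) as D'.
  pose proof (is_derive_radial_form d _ _ _ _ _ D' D1) as DQ. cbv beta in DQ.
  rewrite line_0 in DQ.
  assert (Z : is_derive (fun s : R => radial_form d (minus (X (plus u (scal s v))) o) (dirD3 w
    X (plus u (scal s v)))) 0 0).
  { apply is_derive_ext_loc with (fun _ => 0).
    - apply filter_imp with (2 := line_locally U u v 0 HU (eq_ind_r U Hu (line_0 u v))).
      intros t Ht. symmetry. exact (T1 w _ Ht).
    - apply is_derive_const_R. }
  pose proof (is_derive_uniq _ _ _ _ Z DQ) as E. lra. }
assert (S0 := HS u Hu). unfold tube in S0. assert (R0 := Hreg u Hu).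
pose proof (T1 (1, 0) u Hu) as N1. pose proof (T1 (0, 1) u Hu) as N2.
pose proof (T2 (1, 0) (1, 0)) as M11. pose proof (T2 (1, 0) (0, 1)) as M12.
  pose proof (T2 (0, 1) (0, 1)) as M22.
apply tube_algebra with (5 := N1) (6 := N2) (7 := M11) (8 := M12) (9 := M22); assumption.
Qed.

(** * Short paths on a tube and its completeness *)

Lemma is_derive3_comp (q : R -> R3) (v : R -> R) t l v' :
  is_derive3 q (v t) l -> is_derive v t v' -> is_derive3 (fun s => q (v s)) t (scal v' l).
Proof.
intros (H1 & H2 & H3) H. split; [|split].
- exact (is_derive_comp_R (fun s => cx (q s)) v t _ _ H1 H).
- exact (is_derive_comp_R (fun s => cy (q s)) v t _ _ H2 H).
- exact (is_derive_comp_R (fun s => cz (q s)) v t _ _ H3 H).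
Qed.

Lemma continuous3_comp_scal (q : R -> R3) (v v' : R -> R) t :
  continuous3 q (v t) -> continuous v t -> continuous v' t ->
  continuous3 (fun s => scal (v' s) (q (v s))) t.
Proof.
intros (H1 & H2 & H3) Hv Hv'. split; [|split].
- apply (continuous_mult_R v' (fun s => cx (q (v s)))); trivial.
  now apply (continuous_comp v (fun s => cx (q s))).
- apply (continuous_mult_R v' (fun s => cy (q (v s)))); trivial.
  now apply (continuous_comp v (fun s => cy (q s))).
- apply (continuous_mult_R v' (fun s => cz (q (v s)))); trivial.
  now apply (continuous_comp v (fun s => cz (q s))).
Qed.

Lemma enorm_scal (c : R) (p : R3) : enorm (scal c p) = Rabs c * enorm p.
Proof.
unfold enorm. replace (dot (scal c p) (scal c p)) with ((c * c) * dot p p) by (coords; ring).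
rewrite sqrt_mult_alt by nra. now rewrite <- sqrt_Rsqr_abs.
Qed.

(** The three coordinates of the curve [ga] in [tube_path] share this shape, in which the polynomial
    under the root is the squared distance of a point of a segment from the axis or centre. *)
Lemma is_derive_proj (o1 A0 A1 d1 r q0 q1 q2 n0 n1 s : R) :
  0 < q0 + 2 * s * q1 + s * s * q2 ->
  is_derive (fun s => o1 + ((A0 + s * A1) * d1 + r / sqrt (q0 + 2 * s * q1 + s * s * q2) * (n0
    + s * n1))) s
   (A1 * d1 + (r / sqrt (q0 + 2 * s * q1 + s * s * q2) * n1 +
     (- r * (q1 + s * q2) / ((q0 + 2 * s * q1 + s * s * q2) * sqrt (q0 + 2 * s * q1 + s * s *
       q2))) * (n0 + s * n1))).
Proof.
intros H. assert (S0 := sqrt_lt_R0 _ H). auto_derive; [split; trivial; split; [lra | trivial]|].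
assert (E := sqrt_sqrt _ (Rlt_le _ _ H)).
set (w := sqrt (q0 + 2 * s * q1 + s * s * q2)) in *. rewrite <- E. field. lra.
Qed.

Lemma continuous_proj (o1 A0 A1 d1 r q0 q1 q2 n0 n1 s : R) :
  0 < q0 + 2 * s * q1 + s * s * q2 ->
  continuous (fun s => A1 * d1 + (r / sqrt (q0 + 2 * s * q1 + s * s * q2) * n1 +
     (- r * (q1 + s * q2) / ((q0 + 2 * s * q1 + s * s * q2) * sqrt (q0 + 2 * s * q1 + s * s *
       q2))) * (n0 + s * n1))) s.
Proof.
intros H. assert (S0 := sqrt_lt_R0 _ H).
apply (ex_derive_continuous (K := R_AbsRing) (V := R_NormedModule)).
assert ((q0 + 2 * s * q1 + s * s * q2) * sqrt (q0 + 2 * s * q1 + s * s * q2) <> 0) by (apply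
  Rmult_integral_contrapositive_currified; lra).
auto_derive. repeat split; trivial; lra.
Qed.

Definition nproj (d v : R3) : R3 := minus v (scal (dot v d) d).

Lemma radial_form_bounds d v : dot d d = 1 \/ d = (0, 0,
  0) -> 0 <= radial_form d v v <= dot v v.
Proof.
intros [H | ->].
- split; [|unfold radial_form; pose proof (Rle_0_sqr (dot v d)); unfold Rsqr in *; lra].
  replace (radial_form d v v) with (dot (cross v d) (cross v d)); [apply dot_ge_0|].
  rewrite cross_sq, H. unfold radial_form. ring.
- replace (radial_form (0, 0, 0) v v) with (dot v v) by (coords; ring).
  split; [apply dot_ge_0 | lra].
Qed.

Lemma dot_nproj_d d v : dot d d = 1 \/ d = (0, 0, 0) -> dot (nproj d v) d = 0.
Proof.
intros Hd. transitivity (dot v d * (1 - dot d d)); [unfold nproj; coords; ring|].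
destruct Hd as [-> | ->]; [ring | coords; ring].
Qed.

Lemma dot_nproj d v w : dot (nproj d v) w = radial_form d v w.
Proof. unfold nproj. coords. ring. Qed.

Lemma dot_nproj_nproj d v w : dot d d = 1 \/ d = (0, 0,
  0) -> dot (nproj d v) (nproj d w) = radial_form d v w.
Proof.
intros Hd. transitivity (dot (nproj d v) w - dot w d * dot (nproj d v) d); [unfold nproj;
  coords; ring|].
rewrite (dot_nproj_d d v Hd), dot_nproj. ring.
Qed.

(** The segment from [a] to [p] is pushed radially onto the tube. It stays within [r / 4] of [p],
    hence at least [r / 2] away from the axis or centre, so that the projection at most doubles its
    speed. *)
Lemma tube_path (o d : R3) (r : R) (p a : R3) : 0 < r -> dot d d = 1 \/ d = (0, 0, 0) ->
  tube o d r p -> tube o d r a -> 4 * enorm (minus p a) <= r ->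
  exists gam, C1_path_in (tube o d r) a p gam /\ path_length gam <= 2 * enorm (minus p a).
Proof.
intros Hr Hd Hp Ha Hpa.
set (del := minus p a) in *. set (v0 := minus a o). set (v1 := minus p o).
set (q0 := radial_form d v0 v0). set (q1 := radial_form d v0 del).
  set (q2 := radial_form d del del).
set (rad := fun s => q0 + 2 * s * q1 + s * s * q2).
(* Expansion around the end [p] of the segment, that is around [s = 1], where the squared radius is
   exactly [r * r]. *)
assert (Erad : forall s, rad s = r * r - 2 * (1 - s) * dot (nproj d v1) del + (1 - s) * (1 - s)
  * q2).
{ intros s. rewrite <- Hp. unfold rad, q0, q1, q2, v0, v1, del, nproj. coords. ring. }
assert (CS : dot (nproj d v1) del <= r * enorm del).
{ apply Rle_trans with (1 := cauchy_schwarz _ _). apply Rmult_le_compat_r; [apply sqrt_pos|].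
  unfold enorm. rewrite (dot_nproj_nproj d _ _ Hd). unfold v1. rewrite Hp.
    rewrite sqrt_square; lra. }
assert (Pq2 := radial_form_bounds d del Hd). fold q2 in Pq2.
assert (Prad : forall s, 0 <= s <= 1 -> r * r / 4 <= rad s).
{ intros s Hs. rewrite Erad.
  assert (0 <= (1 - s) * (1 - s) * q2) by (apply Rmult_le_pos; [nra | lra]).
  assert (r * enorm del <= r * (r / 4)) by (apply Rmult_le_compat_l; lra).
  assert ((1 - s) * dot (nproj d v1) del <= (1 - s) * (r * (r / 4))) by (apply
    Rmult_le_compat_l; lra).
  assert ((1 - s) * (r * (r / 4)) <= 1 * (r * (r / 4))) by (apply Rmult_le_compat_r; nra).
  nra. }
assert (Prad0 : forall s, 0 <= s <= 1 -> 0 < rad s) by (intros s Hs; specialize (Prad s Hs);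
  nra).
set (A0 := dot v0 d). set (A1 := dot del d).
set (n0 := nproj d v0). set (n1 := nproj d del).
set (ga := fun s => plus o (plus (scal (A0 + s * A1) d) (scal (r / sqrt (rad s)) (plus n0 (scal
  s n1))))).
set (g1 := fun s => plus (scal A1 d) (plus (scal (r / sqrt (rad s)) n1)
   (scal (- r * (q1 + s * q2) / (rad s * sqrt (rad s))) (plus n0 (scal s n1))))).
assert (D : forall s, 0 <= s <= 1 -> is_derive3 ga s (g1 s)).
{ intros s Hs. specialize (Prad0 s Hs). split; [|split].
  - exact (is_derive_proj (cx o) A0 A1 (cx d) r q0 q1 q2 (cx n0) (cx n1) s Prad0).
  - exact (is_derive_proj (cy o) A0 A1 (cy d) r q0 q1 q2 (cy n0) (cy n1) s Prad0).
  - exact (is_derive_proj (cz o) A0 A1 (cz d) r q0 q1 q2 (cz n0) (cz n1) s Prad0). }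
assert (C : forall s, 0 <= s <= 1 -> continuous3 g1 s).
{ intros s Hs. specialize (Prad0 s Hs). split; [|split].
  - exact (continuous_proj (cx o) A0 A1 (cx d) r q0 q1 q2 (cx n0) (cx n1) s Prad0).
  - exact (continuous_proj (cy o) A0 A1 (cy d) r q0 q1 q2 (cy n0) (cy n1) s Prad0).
  - exact (continuous_proj (cz o) A0 A1 (cz d) r q0 q1 q2 (cz n0) (cz n1) s Prad0). }
assert (B : forall s, 0 <= s <= 1 -> enorm (g1 s) <= 2 * enorm del).
{ intros s Hs. unfold enorm. replace 2 with (sqrt (2 * 2)) by (apply sqrt_square; lra).
  rewrite <- sqrt_mult_alt by lra. apply sqrt_le_1_alt.
  pose proof (Prad s Hs) as P1. pose proof (Prad0 s Hs) as P0.
  set (c1 := r / sqrt (rad s)). set (c2 := - r * (q1 + s * q2) / (rad s * sqrt (rad s))).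
  assert (E : dot (g1 s) (g1 s) = A1 * A1 * dot d d + c1 * c1 * q2 + 2 * c1 * c2 * (q1 + s *
    q2) + c2 * c2 * rad s).
  { transitivity (A1 * A1 * dot d d + c1 * c1 * dot n1 n1 + 2 * c1 * c2 * (dot n0 n1 + s * dot
    n1 n1)
      + c2 * c2 * (dot n0 n0 + 2 * s * dot n0 n1 + s * s * dot n1 n1)
      + 2 * A1 * c1 * dot n1 d + 2 * A1 * c2 * (dot n0 d + s * dot n1 d)).
    - unfold g1. fold c1 c2. clearbody c1 c2 n0 n1. coords. ring.
    - unfold n0, n1. rewrite !(dot_nproj_nproj d _ _ Hd), !(dot_nproj_d d _ Hd). fold q0 q1 q2.
      unfold rad. ring. }
  rewrite E. assert (S0 := sqrt_lt_R0 _ P0).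
  (* The squared speed is the axial part plus [r * r / rad s] times the squared normal part of [del]
     without its radial component; forgetting that subtraction gives the bound. *)
  replace (A1 * A1 * dot d d + c1 * c1 * q2 + 2 * c1 * c2 * (q1 + s * q2) + c2 * c2 * rad s)
   with (A1 * A1 * dot d d + r * r / rad s * (q2 - (q1 + s * q2) * (q1 + s * q2) / rad s)).
  2:{ unfold c1, c2. assert (Ew := sqrt_sqrt _ (Rlt_le _ _ P0)). set (w := sqrt (rad s)) in *.
    rewrite <- Ew. field. lra. }
  assert (H1 : A1 * A1 * dot d d + q2 = dot del del).
  { unfold q2, radial_form. fold A1. destruct Hd as [Hd1 | Hd0]; [rewrite Hd1; ring|].
    unfold A1. rewrite Hd0. unfold dot, cx, cy, cz; simpl. ring. }
  assert (H2 : r * r / rad s <= 4).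
  { apply Rmult_le_reg_r with (rad s); trivial. unfold Rdiv. rewrite Rmult_assoc, Rinv_l; lra. }
  assert (H3 : 0 <= (q1 + s * q2) * (q1 + s * q2) / rad s).
  { apply Rmult_le_pos; [apply Rle_0_sqr|]. left. now apply Rinv_0_lt_compat. }
  assert (H4 : 0 <= A1 * A1 * dot d d) by (apply Rmult_le_pos;
    [apply Rle_0_sqr | apply dot_ge_0]).
  assert (H5 : 0 <= r * r / rad s) by (apply Rmult_le_pos; [nra | left;
    now apply Rinv_0_lt_compat]).
  assert (H6 : r * r / rad s * (q2 - (q1 + s * q2) * (q1 + s * q2) / rad s) <= r * r / rad s *
    q2) by (apply Rmult_le_compat_l; lra).
  assert (H7 : r * r / rad s * q2 <= 4 * q2) by (apply Rmult_le_compat_r; lra).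
  lra. }
assert (Dt : forall t, is_derive3 (fun t => ga (smoothstep t)) t (scal (smoothstep' t) (g1
  (smoothstep t)))).
{ intros t. apply is_derive3_comp; [apply D, smoothstep_bound | apply is_derive_smoothstep]. }
assert (Ct : forall t, continuous3 (fun t => scal (smoothstep' t) (g1 (smoothstep t))) t).
{ intros t. apply continuous3_comp_scal;
  [apply C, smoothstep_bound | | apply continuous_smoothstep'].
  apply (ex_derive_continuous smoothstep). eexists; apply is_derive_smoothstep. }
exists (fun t => ga (smoothstep t)). split.
- split; [|split; [|split]].
  + apply Ck3_1_path with (fun t => scal (smoothstep' t) (g1 (smoothstep t))); assumption.
  + intros t _. set (s := smoothstep t). assert (P0 := Prad0 s (smoothstep_bound t)).
    assert (S0 := sqrt_lt_R0 _ P0).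
    unfold tube.
    transitivity (r / sqrt (rad s) * (r / sqrt (rad s)) * (dot n0 n0 + 2 * s * dot n0 n1 + s *
      s * dot n1 n1)).
    2:{ unfold n0, n1. rewrite !(dot_nproj_nproj d _ _ Hd). fold q0 q1 q2.
      change (q0 + 2 * s * q1 + s * s * q2) with (rad s).
        assert (Ew := sqrt_sqrt _ (Rlt_le _ _ P0)). set (w := sqrt (rad s)) in *.
          rewrite <- Ew. field. lra. }
    set (c := r / sqrt (rad s)). set (b := A0 + s * A1).
    assert (E : dot (minus (ga s) o) d = b * dot d d).
    { transitivity (b * dot d d + c * (dot n0 d + s * dot n1 d)).
      - unfold ga. fold c b. clearbody c b n0 n1. coords. ring.
      - unfold n0, n1. rewrite !(dot_nproj_d d _ Hd). ring. }
    unfold radial_form. rewrite E.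
    transitivity (b * b * dot d d * (1 - dot d d) + c * c * (dot n0 n0 + 2 * s * dot n0 n1 + s
      * s * dot n1 n1) + 2 * b * c * (dot n0 d + s * dot n1 d)).
    { unfold ga. fold c b. clearbody c b n0 n1. coords. ring. }
    unfold n0, n1. rewrite !(dot_nproj_d d _ Hd).
    destruct Hd as [Hd1 | Hd0]; [rewrite Hd1; ring|]. rewrite Hd0.
      replace (dot (0,0,0) (0,0,0)) with 0 by (coords; ring). ring.
  + rewrite smoothstep_0. unfold ga.
    replace (rad 0) with (r * r) by (unfold rad, q0, v0; rewrite Ha; ring).
    rewrite sqrt_square by lra. unfold Rdiv. rewrite Rinv_r by lra.
    apply R3_eq; unfold n0, n1, nproj, A0, A1, v0; coords; ring.
  + rewrite smoothstep_1. unfold ga. replace (rad 1) with (r * r) by (rewrite Erad; ring).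
    rewrite sqrt_square by lra. unfold Rdiv. rewrite Rinv_r by lra.
    apply R3_eq; unfold n0, n1, nproj, A0, A1, v0, del; coords; ring.
- replace (2 * enorm del) with (2 * enorm del * smoothstep 1 - 2 * enorm del * smoothstep 0) by
  (rewrite smoothstep_0, smoothstep_1; ring).
  apply path_length_le with (g1 := fun t => scal (smoothstep' t) (g1 (smoothstep t))) (G := fun
    t => 2 * enorm del * smoothstep t) (Gd := fun t => 2 * enorm del * smoothstep' t);
    intros t Ht; auto.
  + apply (is_derive_scal smoothstep t (2 * enorm del)). apply is_derive_smoothstep.
  + apply (continuous_mult_R (fun _ => 2 * enorm del) smoothstep');
    [apply continuous_const | apply continuous_smoothstep'].
  + rewrite enorm_scal, Rabs_pos_eq by now apply smoothstep'_pos. rewrite Rmult_comm.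
    apply Rmult_le_compat_r; [now apply smoothstep'_pos|]. apply B, smoothstep_bound.
Qed.

(** An intrinsic Cauchy sequence converges in space and the tube is closed; [tube_path] turns
    Euclidean closeness to the limit back into intrinsic closeness. *)
Lemma tube_complete (o d : R3) (r : R) : 0 < r -> dot d d = 1 \/ d = (0, 0, 0) ->
  complete_surface (tube o d r).
Proof.
intros Hr Hd a Ha Hc. destruct (intrinsic_cauchy_lim _ _ Hc) as [p Hp].
assert (Tp : tube o d r p).
{ assert (L : is_lim_seq (fun n => radial_form d (minus (a n) o) (minus (a n) o)) (radial_form
  d (minus p o) (minus p o))).
  { destruct Hp as (P1 & P2 & P3). unfold radial_form, dot.
    assert (M : forall (u : nat -> R) (l c : R),
      is_lim_seq u l -> is_lim_seq (fun n => u n - c) (l - c)).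
    { intros u l c Hu. apply is_lim_seq_minus'; trivial. apply is_lim_seq_const. }
    pose proof (M _ _ (cx o) P1) as L1. pose proof (M _ _ (cy o) P2) as L2.
      pose proof (M _ _ (cz o) P3) as L3.
    assert (K : forall (u : nat -> R) (l c : R),
      is_lim_seq u l -> is_lim_seq (fun n => u n * c) (l * c)).
    { intros u l c Hu. apply is_lim_seq_mult'; trivial. apply is_lim_seq_const. }
    assert (Ld : is_lim_seq (fun n => cx (minus (a n) o) * cx d + cy (minus (a n) o) * cy d +
      cz (minus (a n) o) * cz d)
       (cx (minus p o) * cx d + cy (minus p o) * cy d + cz (minus p o) * cz d)).
    { apply is_lim_seq_plus'; [apply is_lim_seq_plus'|]; apply K; assumption. }
    apply is_lim_seq_minus'; [|now apply is_lim_seq_mult'].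
    apply is_lim_seq_plus'; [apply is_lim_seq_plus'|]; now apply is_lim_seq_mult'. }
  assert (L' : is_lim_seq (fun n => radial_form d (minus (a n) o) (minus (a n) o)) (r * r)).
  { apply is_lim_seq_ext with (fun _ => r * r). { intros n. symmetry. apply Ha.
    } apply is_lim_seq_const. }
  apply is_lim_seq_unique in L. apply is_lim_seq_unique in L'. unfold tube. congruence. }
exists p. split; trivial. intros eps.
(* [tube_path] needs a distance of at most [r / 4] and doubles it, so [eps / 4] leaves room below
   [eps]. *)
assert (He : 0 < Rmin (r / 4) (eps / 4)) by (apply Rmin_pos; destruct eps; simpl; lra).
pose proof (proj1 (lim3_enorm a p) Hp (mkposreal _ He)) as [N HN]. exists N. intros n Hn.
specialize (HN n Hn). simpl in HN. pose proof (Rmin_l (r / 4) (eps / 4)).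
  pose proof (Rmin_r (r / 4) (eps / 4)).
destruct (tube_path o d r p (a n) Hr Hd Tp (Ha n)) as (gam & G & L); [lra|].
apply intrinsic_dist_lt with gam; trivial. destruct eps; simpl in *; lra.
Qed.

(** * Orthonormal frames, and the sphere and the cylinder as rotational surfaces *)

Definition orthonormal (e1 e2 e3 : R3) : Prop :=
  dot e1 e1 = 1 /\ dot e2 e2 = 1 /\ dot e3 e3 = 1 /\
  dot e1 e2 = 0 /\ dot e1 e3 = 0 /\ dot e2 e3 = 0.

Definition frame (e1 e2 e3 p : R3) : R3 :=
  plus (scal (cx p) e1) (plus (scal (cy p) e2) (scal (cz p) e3)).

Lemma dot_frame e1 e2 e3 p q : orthonormal e1 e2 e3 ->
  dot (frame e1 e2 e3 p) (frame e1 e2 e3 q) = dot p q.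
Proof.
intros (H1 & H2 & H3 & H4 & H5 & H6).
transitivity (cx p * cx q * dot e1 e1 + cy p * cy q * dot e2 e2 + cz p * cz q * dot e3 e3 +
 (cx p * cy q + cy p * cx q) * dot e1 e2 + (cx p * cz q + cz p * cx q) * dot e1 e3 + (cy p * cz
   q + cz p * cy q) * dot e2 e3).
- unfold frame. coords. ring.
- rewrite H1, H2, H3, H4, H5, H6. unfold dot. ring.
Qed.

(** The squared determinant is the Gram determinant, here that of the identity matrix. *)
Lemma det_frame_sq e1 e2 e3 : orthonormal e1 e2 e3 ->
  dot (cross e1 e2) e3 * dot (cross e1 e2) e3 = 1.
Proof.
intros (H1 & H2 & H3 & H4 & H5 & H6).
transitivity (dot e1 e1 * dot e2 e2 * dot e3 e3 + 2 * dot e1 e2 * dot e1 e3 * dot e2 e3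
 - dot e1 e1 * (dot e2 e3 * dot e2 e3) - dot e2 e2 * (dot e1 e3 * dot e1 e3) - dot e3 e3 * (dot
   e1 e2 * dot e1 e2)).
- coords. ring.
- rewrite H1, H2, H3, H4, H5, H6. ring.
Qed.

Lemma frame_inv e1 e2 e3 v : orthonormal e1 e2 e3 ->
  frame e1 e2 e3 (dot v e1, dot v e2, dot v e3) = v.
Proof.
intros H. pose proof (det_frame_sq _ _ _ H) as HD. set (D := dot (cross e1 e2) e3) in *.
assert (HD0 : D <> 0) by nra.
destruct H as (H1 & H2 & H3 & H4 & H5 & H6).
set (w := minus v (frame e1 e2 e3 (dot v e1, dot v e2, dot v e3))).
assert (W1 : dot w e1 = 0).
{ transitivity (dot v e1 * (1 - dot e1 e1) - dot v e2 * dot e1 e2 - dot v e3 * dot e1 e3).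
  - unfold w, frame. coords. ring.
  - rewrite H1, H4, H5. ring. }
assert (W2 : dot w e2 = 0).
{ transitivity (dot v e2 * (1 - dot e2 e2) - dot v e1 * dot e1 e2 - dot v e3 * dot e2 e3).
  - unfold w, frame. coords. ring.
  - rewrite H2, H4, H6. ring. }
assert (W3 : dot w e3 = 0).
{ transitivity (dot v e3 * (1 - dot e3 e3) - dot v e1 * dot e1 e3 - dot v e2 * dot e2 e3).
  - unfold w, frame. coords. ring.
  - rewrite H3, H5, H6. ring. }
(* Cramer's rule: the determinant times [w] is a combination of the products of [w] with the frame,
   all of which vanish. *)
assert (W : scal D w = plus (scal (dot w e1) (cross e2 e3)) (plus (scal (dot w e2) (cross e3
  e1)) (scal (dot w e3) (cross e1 e2)))).
{ unfold D. clearbody w. apply R3_eq; coords; ring. }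
rewrite W1, W2, W3 in W.
assert (Wx := f_equal cx W). assert (Wy := f_equal cy W). assert (Wz := f_equal cz W).
assert (Ex : D * cx w = 0) by (change (D * cx w) with (cx (scal D w)); rewrite Wx; coords;
  ring).
assert (Ey : D * cy w = 0) by (change (D * cy w) with (cy (scal D w)); rewrite Wy; coords;
  ring).
assert (Ez : D * cz w = 0) by (change (D * cz w) with (cz (scal D w)); rewrite Wz; coords;
  ring).
apply Rmult_integral in Ex, Ey, Ez.
apply R3_eq; [destruct Ex as [E|E] | destruct Ey as [E|E] | destruct Ez as [E|E]];
  try contradiction;
 unfold w in E; rewrite ?cx_minus, ?cy_minus, ?cz_minus in E; lra.
Qed.

Lemma angle_exists u v : u * u + v * v = 1 -> exists th,
  - PI <= th <= PI /\ u = cos th /\ v = sin th.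
Proof.
intros H. assert (Hu : -1 <= u <= 1) by nra. pose proof (acos_bound u) as Hb.
assert (Hc := cos_acos u Hu). assert (Hs := sin_acos u Hu).
assert (E : sqrt (1 - Rsqr u) = Rabs v) by (rewrite <- sqrt_Rsqr_abs; f_equal; unfold Rsqr;
  lra).
rewrite E in Hs.
destruct (Rle_lt_dec 0 v) as [Hv | Hv].
- exists (acos u). rewrite Rabs_pos_eq in Hs by trivial. repeat split; lra.
- exists (- acos u). rewrite Rabs_left in Hs by trivial. rewrite cos_neg, sin_neg.
  repeat split; lra.
Qed.

Lemma polar_exists y z : (y <> 0 \/ z <> 0) ->
  exists rho th, 0 < rho /\ rho * rho = y * y + z * z /\ y = rho * sin th /\ z = rho * cos th.
Proof.
intros H. assert (P : 0 < y * y + z * z) by (destruct H; nra).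
pose proof (sqrt_lt_R0 _ P) as S0. pose proof (sqrt_sqrt _ (Rlt_le _ _ P)) as S1.
set (rho := sqrt _) in *.
destruct (angle_exists (z / rho) (y / rho)) as (th & _ & H1 & H2).
- replace (z / rho * (z / rho) + y / rho * (y / rho)) with ((y * y + z * z) / (rho * rho)) by
  (field; lra).
  rewrite S1. field. lra.
- exists rho, th. rewrite <- H1, <- H2. repeat split; trivial; field; lra.
Qed.

Lemma round_sphere_tube S : round_sphere S <-> exists o r, 0 < r /\ forall p,
  S p <-> tube o (0, 0, 0) r p.
Proof.
assert (E : forall o r p, 0 < r -> (tube o (0, 0, 0) r p <-> enorm (minus p o) = r)).
{ intros o r p Hr. unfold tube.
  replace (radial_form (0, 0, 0) (minus p o) (minus p o)) with (enorm (minus p o) * enorm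
  (minus p o)).
  - pose proof (sqrt_pos (dot (minus p o) (minus p o))). fold (enorm (minus p o)) in H.
    split; nra.
  - rewrite enorm_sq. coords. ring. }
split; intros (o & r & Hr & H); exists o, r; (split; [trivial|]); intros p;
  rewrite (H p), (E o r p Hr); tauto.
Qed.

Lemma circular_cylinder_tube S : circular_cylinder S <->
  exists o d r, 0 < r /\ dot d d = 1 /\ forall p, S p <-> tube o d r p.
Proof.
assert (E1 : forall d, enorm d = 1 <-> dot d d = 1).
{ intros d. rewrite <- enorm_sq. pose proof (sqrt_pos (dot d d)). fold (enorm d) in H.
  split; nra. }
assert (E : forall o d r p, 0 < r -> dot d d = 1 -> (tube o d r p <->
  enorm (cross (minus p o) d) = r)).
{ intros o d r p Hr Hd. unfold tube.
  replace (radial_form d (minus p o) (minus p o)) with (enorm (cross (minus p o) d) * enorm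
  (cross (minus p o) d)).
  - pose proof (sqrt_pos (dot (cross (minus p o) d) (cross (minus p o) d))).
    fold (enorm (cross (minus p o) d)) in H. split; nra.
  - rewrite enorm_sq, cross_sq, Hd. unfold radial_form. ring. }
split; intros (o & d & r & Hr & Hd & H); exists o, d, r; rewrite E1 in *; (split; [trivial|]);
  (split; [trivial|]); intros p; rewrite (H p), (E o d r p Hr Hd); tauto.
Qed.

Lemma sphere_rotational o r : 0 < r -> rotational (tube o (0, 0, 0) r).
Proof.
intros Hr.
exists (fun p => plus o p), (fun t => - (PI / 2) < t < PI / 2), (fun t => r * sin t),
  (fun t => r * cos t).
split; [|split].
- exists o, (1, 0, 0), (0, 1, 0), (0, 0, 1). repeat split; try (coords; ring).
  intros p. apply R3_eq; coords; ring.
- assert (O : open (fun t : R => - (PI / 2) < t < PI / 2)) by (apply open_and;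
  [apply open_gt | apply open_lt]).
  assert (C : forall U : R -> Prop, open U -> forall k f,
    Cks k (U : R_NormedModule -> Prop) f ->
     Ck k (U : R_NormedModule -> Prop) (fun t : R => r * f t)).
  { intros U HU k f Hf. apply Cks_Ck.
    apply (Cks_mult (V := R_NormedModule) k U (fun _ => r) f); trivial.
    apply (Cks_const (V := R_NormedModule)). }
  pose proof PI_RGT_0.
  split; [|split; [|split; [|split; [|split; [|split]]]]].
  + exact O.
  + exists 0. lra.
  + intros; lra.
  + apply C; trivial. apply Cks_sin.
  + apply C; trivial. apply Cks_cos.
  + intros t Ht. apply Rmult_lt_0_compat; trivial. now apply cos_gt_0.
  + intros t Ht. left.
    replace (Derive (fun t => r * sin t) t) with (r * cos t).
    * assert (0 < cos t) by now apply cos_gt_0. nra.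
    * symmetry. apply is_derive_unique. auto_derive; trivial. ring.
- intros p Hp. unfold tube.
  replace (radial_form (0, 0, 0) (minus (plus o p) o) (minus (plus o p) o)) with (cx p * cx p +
    cy p * cy p + cz p * cz p) by (coords; ring).
  split.
  + intros H. destruct (polar_exists _ _ Hp) as (rho & th & H0 & H1 & H2 & H3).
    (* Being off the axis keeps the point away from the poles, so that [asin] falls into the open
       interval of parameters. *)
    assert (Hb : -1 < cx p / r < 1).
    { split; [apply Rmult_lt_reg_r with r | apply Rmult_lt_reg_r with r]; trivial;
      unfold Rdiv; rewrite Rmult_assoc, Rinv_l by lra; nra. }
    exists (asin (cx p / r)), th. split; [now apply asin_bound_lt|].
    rewrite sin_asin, cos_asin by lra.
    replace (r * sqrt (1 - Rsqr (cx p / r))) with rho.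
    * apply R3_eq; [change (cx p = r * (cx p / r)); field; lra | exact H2 | exact H3].
    * rewrite <- (sqrt_square rho), <- (sqrt_square r) at 1 by lra.
      rewrite <- sqrt_mult_alt by nra. f_equal. rewrite H1. unfold Rsqr. field_simplify; lra.
  + intros (t & th & Ht & ->). unfold cx, cy, cz; simpl.
    pose proof (sin2_cos2 t) as E1. pose proof (sin2_cos2 th) as E2. unfold Rsqr in *.
    transitivity (r * r * (sin t * sin t + cos t * cos t * (sin th * sin th + cos th * cos
      th))); [ring|].
    rewrite E2, Rmult_1_r, E1. ring.
Qed.

Lemma orthonormal_complete d : dot d d = 1 -> exists e2 e3, orthonormal d e2 e3.
Proof.
intros Hd.
assert (H : exists e2, dot e2 e2 = 1 /\ dot d e2 = 0).
(* If [d] is vertical a coordinate axis is orthogonal to it; otherwise the normalized quarter turn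
   of its horizontal part is. *)
{ destruct (Req_dec (cx d * cx d + cy d * cy d) 0) as [H0 | H0].
  - exists (1, 0, 0). split; [coords; ring|]. assert (cx d = 0) by nra. unfold dot. rewrite H.
    coords. ring.
  - assert (P : 0 < cx d * cx d + cy d * cy d) by nra.
    pose proof (sqrt_lt_R0 _ P) as S0. pose proof (sqrt_sqrt _ (Rlt_le _ _ P)) as S1.
      set (n := sqrt _) in *.
    exists (- cy d / n, cx d / n, 0). split.
    + transitivity ((cx d * cx d + cy d * cy d) / (n * n)); [coords; field; lra|]. rewrite S1.
      field. lra.
    + coords. field. lra. }
destruct H as (e2 & H1 & H2). exists e2, (cross d e2). repeat split; trivial.
- rewrite cross_sq, Hd, H1, H2. ring.
- coords. ring.
- coords. ring.
Qed.

Lemma cylinder_rotational o d r : 0 < r -> dot d d = 1 -> rotational (tube o d r).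
Proof.
intros Hr Hd. destruct (orthonormal_complete d Hd) as (e2 & e3 & HO).
exists (fun p => plus o (frame d e2 e3 p)), (fun t => True), (fun t => t), (fun t => r).
split; [|split].
- exists o, d, e2, e3. destruct HO as (H1 & H2 & H3 & H4 & H5 & H6). repeat split; trivial.
- split; [|split; [|split; [|split; [|split; [|split]]]]].
  + apply open_true.
  + now exists 0.
  + trivial.
  + apply Cks_Ck. apply Cks_id.
  + apply Cks_Ck. apply (Cks_const (V := R_NormedModule)).
  + trivial.
  + intros t _. left. rewrite Derive_id. lra.
- intros p Hp. unfold tube.
  replace (radial_form d (minus (plus o (frame d e2 e3 p)) o) (minus (plus o (frame d e2 e3 p))
    o)) with (cy p * cy p + cz p * cz p).
  2:{ replace (minus (plus o (frame d e2 e3 p)) o) with (frame d e2 e3 p) by (generalize (frame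
    d e2 e3 p); intros; apply R3_eq; coords; ring).
      unfold radial_form. rewrite (dot_frame _ _ _ p p HO).
      replace (dot (frame d e2 e3 p) d) with (cx p); [unfold dot; ring|].
      rewrite <- (Rmult_1_r (cx p)), <- Hd. destruct HO as (H1 & H2 & H3 & H4 & H5 & H6).
      transitivity (cx p * dot d d + cy p * dot d e2 + cz p * dot d e3); [rewrite H4, H5;
        ring|].
      unfold frame. coords. ring. }
  split.
  + intros H. destruct (polar_exists _ _ Hp) as (rho & th & H0 & H1 & H2 & H3).
    exists (cx p), th. split; trivial. replace r with rho by nra.
    apply R3_eq; [reflexivity | exact H2 | exact H3].
  + intros (t & th & _ & ->). unfold cx, cy, cz; simpl.
    pose proof (sin2_cos2 th) as E2. unfold Rsqr in *.
    transitivity (r * r * (sin th * sin th + cos th * cos th)); [ring|]. rewrite E2. ring.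
Qed.

Lemma constant_sqnorm_sphere_cylinder (S : R3 -> Prop) :
  round_sphere S \/ circular_cylinder S ->
  embedded_C2_surface S /\ rotational S /\ complete_surface S /\
  exists c : R, 0 < c /\ constant_sqnorm_A S c.
Proof.
assert (K : forall o d r, 0 < r -> (dot d d = 1 \/ d = (0, 0, 0)) -> rotational (tube o d r) ->
   (forall p, S p <-> tube o d r p) ->
   embedded_C2_surface S /\ rotational S /\ complete_surface S /\
   exists c : R, 0 < c /\ constant_sqnorm_A S c).
{ intros o d r Hr Hd Hrot HS.
  (* Turning the pointwise equivalence into an equality of sets transfers all four properties at
     once. *)
  replace S with (tube o d r).
  2:{ apply functional_extensionality. intros p.
    apply PropExtensionality.propositional_extensionality. symmetry. apply HS. }
  split; [now apply tube_embedded|]. split; trivial. split; [now apply tube_complete|].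
  exists ((2 - dot d d) / (r * r)). split.
  - apply Rmult_lt_0_compat; [|apply Rinv_0_lt_compat; nra].
    destruct Hd as [-> | ->]; [lra | unfold dot, cx, cy, cz; simpl; lra].
  - apply tube_sqnorm_A; trivial. }
intros [H | H].
- apply round_sphere_tube in H. destruct H as (o & r & Hr & H).
  apply K with o (0, 0, 0) r; auto. now apply sphere_rotational.
- apply circular_cylinder_tube in H. destruct H as (o & d & r & Hr & Hd & H).
  apply K with o d r; auto. now apply cylinder_rotational.
Qed.

(** * The chain rule in space *)

Lemma dirD_increment {V : NormedModule R_AbsRing} (U : V -> Prop) (F : V ->
  R) (q e : V) (D eps h : R) :
  Ck 1 U F ->
  (forall s, Rabs s <= Rabs h -> U (plus q (scal s e)) /\
    Rabs (dirD e F (plus q (scal s e)) - D) <= eps) ->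
  Rabs (F (plus q (scal h e)) - F q - h * D) <= eps * Rabs h.
Proof.
intros HF H.
assert (Hd : forall s, Rabs s <= Rabs h ->
  is_derive (fun t : R => F (plus q (scal t e))) s (dirD e F (plus q (scal s e)))).
{ intros s Hs. apply ex_derive_line. apply (HF e). now apply H. }
assert (B : forall x, Rmin 0 h <= x <= Rmax 0 h -> Rabs x <= Rabs h).
{ intros x Hx. unfold Rmin, Rmax in Hx. unfold Rabs.
  destruct (Rle_dec 0 h), (Rcase_abs x), (Rcase_abs h); lra. }
destruct (MVT_gen (fun t : R => F (plus q (scal t e))) 0 h (fun s => dirD e F (plus q (scal s
  e)))) as (c & Hc & E).
- intros x Hx. apply Hd. apply B. lra.
- intros x Hx. apply continuity_pt_filterlim.
  apply (ex_derive_continuous (fun t : R => F (plus q (scal t e)))). eexists. apply Hd.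
    now apply B.
- rewrite line_0 in E. rewrite E.
  replace (dirD e F (plus q (scal c e)) * (h - 0) - h * D) with ((dirD e F (plus q (scal c e))
    - D) * h) by ring.
  rewrite Rabs_mult. apply Rmult_le_compat_r; [apply Rabs_pos|]. apply H. now apply B.
Qed.

Lemma locally_box (p : R3) (P : R3 -> Prop) : locally p P -> exists d, 0 < d /\
  forall q : R3, Rabs (cx q - cx p) < d -> Rabs (cy q - cy p) < d -> Rabs (cz q - cz p) < d ->
    P q.
Proof.
intros [d Hd]. exists d. split; [apply cond_pos|]. intros q H1 H2 H3. apply Hd.
split; [split|]; assumption.
Qed.

Definition pd1 (F : R3 -> R) : R3 -> R := dirD ((1, 0,
  0) : prod_NormedModule R_AbsRing (prod_NormedModule R_AbsRing R_NormedModule R_NormedModule)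
  R_NormedModule) F.
Definition pd2 (F : R3 -> R) : R3 -> R := dirD ((0, 1,
  0) : prod_NormedModule R_AbsRing (prod_NormedModule R_AbsRing R_NormedModule R_NormedModule)
  R_NormedModule) F.
Definition pd3 (F : R3 -> R) : R3 -> R := dirD ((0, 0,
  1) : prod_NormedModule R_AbsRing (prod_NormedModule R_AbsRing R_NormedModule R_NormedModule)
  R_NormedModule) F.

(** [Ck 1] speaks of one direction at a time. Total differentiability comes from continuity of the
    partial derivatives: the increment is split into three moves parallel to the axes, the third
    coordinate first, each estimated by [dirD_increment]. *)
Lemma C1_estimate (U : R3 -> Prop) (F : R3 -> R) (p : R3) (eps : R) :
  open U -> Ck 1 U F -> U p -> 0 < eps ->
  exists d, 0 < d /\ forall v : R3, Rabs (cx v) < d -> Rabs (cy v) < d -> Rabs (cz v) < d ->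
   Rabs (F (plus p v) - F p - (cx v * pd1 F p + cy v * pd2 F p + cz v * pd3 F p)) <=
   eps * (Rabs (cx v) + Rabs (cy v) + Rabs (cz v)).
Proof.
intros HU HF Hp He.
assert (C : forall e, locally p (fun q => U q /\ Rabs (dirD e F q - dirD e F p) <= eps)).
{ intros e. apply filter_and; [now apply HU|].
  destruct (HF e) as [_ K]. specialize (K p Hp).
  apply (K (fun y => Rabs (y - dirD e F p) <= eps)).
  exists (mkposreal _ He). intros y Hy. now left. }
destruct (locally_box _ _ (filter_and _ _ (C (1,0,0)) (filter_and _ _ (C (0,1,0)) (C
  (0,0,1))))) as (d & Hd & B).
exists d. split; trivial. intros v H1 H2 H3.
set (q1 := plus p (0, cy v, cz v)). set (q2 := plus p (0, 0, cz v)).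
assert (E1 : plus p v = plus q1 (scal (cx v) (1,0,0))) by (unfold q1; apply R3_eq; coords;
  ring).
assert (E2 : q1 = plus q2 (scal (cy v) (0,1,0))) by (unfold q1, q2; apply R3_eq; coords; ring).
assert (E3 : q2 = plus p (scal (cz v) (0,0,1))) by (unfold q2; apply R3_eq; coords; ring).
assert (I1 : Rabs (F (plus q1 (scal (cx v) (1,0,0))) - F q1 - cx v * pd1 F p) <= eps * Rabs (cx
  v)).
{ apply dirD_increment with U; trivial. intros s Hs.
  destruct (B (plus q1 (scal s (1,0,0)))) as [K _]; [| | |exact K].
  - replace (cx (plus q1 (scal s (1,0,0))) - cx p) with s by (unfold q1; coords; ring). lra.
  - replace (cy (plus q1 (scal s (1,0,0))) - cy p) with (cy v) by (unfold q1; coords; ring).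
    lra.
  - replace (cz (plus q1 (scal s (1,0,0))) - cz p) with (cz v) by (unfold q1; coords; ring).
    lra. }
assert (I2 : Rabs (F (plus q2 (scal (cy v) (0,1,0))) - F q2 - cy v * pd2 F p) <= eps * Rabs (cy
  v)).
{ apply dirD_increment with U; trivial. intros s Hs.
  destruct (B (plus q2 (scal s (0,1,0)))) as (_ & K & _); [| | |exact K].
  - replace (cx (plus q2 (scal s (0,1,0))) - cx p) with 0 by (unfold q2; coords; ring).
    rewrite Rabs_R0; lra.
  - replace (cy (plus q2 (scal s (0,1,0))) - cy p) with s by (unfold q2; coords; ring). lra.
  - replace (cz (plus q2 (scal s (0,1,0))) - cz p) with (cz v) by (unfold q2; coords; ring).
    lra. }
assert (I3 : Rabs (F (plus p (scal (cz v) (0,0,1))) - F p - cz v * pd3 F p) <= eps * Rabs (cz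
  v)).
{ apply dirD_increment with U; trivial. intros s Hs.
  destruct (B (plus p (scal s (0,0,1)))) as (_ & _ & K); [| | |exact K].
  - replace (cx (plus p (scal s (0,0,1))) - cx p) with 0 by (coords; ring).
    rewrite Rabs_R0; lra.
  - replace (cy (plus p (scal s (0,0,1))) - cy p) with 0 by (coords; ring).
    rewrite Rabs_R0; lra.
  - replace (cz (plus p (scal s (0,0,1))) - cz p) with s by (coords; ring). lra. }
rewrite <- E1 in I1. rewrite <- E2 in I2. rewrite <- E3 in I3.
replace (F (plus p v) - F p - (cx v * pd1 F p + cy v * pd2 F p + cz v * pd3 F p)) with
 ((F (plus p v) - F q1 - cx v * pd1 F p) + (F q1 - F q2 - cy v * pd2 F p) + (F q2 - F p - cz v
   * pd3 F p)) by ring.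
eapply Rle_trans; [apply Rabs_triang|].
  eapply Rle_trans; [apply Rplus_le_compat_r, Rabs_triang|]. lra.
Qed.

(** Free of quotients, this form of differentiability includes [h = 0], which suits compositions in
    which an increment may vanish. *)
Lemma is_derive_bound (f : R -> R) t l : is_derive f t l -> forall eps, 0 < eps ->
  exists d, 0 < d /\ forall h, Rabs h < d -> Rabs (f (t + h) - f t - h * l) <= eps * Rabs h.
Proof.
intros H eps He. apply is_derive_Reals in H. destruct (H eps He) as [d Hd].
exists d. split; [apply cond_pos|]. intros h Hh.
destruct (Req_dec h 0) as [-> | h0].
- rewrite Rplus_0_r, Rabs_R0. replace (f t - f t - 0 * l) with 0 by ring. rewrite Rabs_R0. lra.
- specialize (Hd h h0 Hh).
  replace (f (t + h) - f t - h * l) with (((f (t + h) - f t) / h - l) * h) by (field; trivial).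
  rewrite Rabs_mult. apply Rmult_le_compat_r; [apply Rabs_pos | lra].
Qed.

Lemma is_derive_of_bound (f : R -> R) t l :
  (forall eps, 0 < eps -> exists d, 0 < d /\ forall h,
    Rabs h < d -> Rabs (f (t + h) - f t - h * l) <= eps * Rabs h) ->
  is_derive f t l.
Proof.
intros H. apply is_derive_Reals. intros eps He. destruct (H (eps / 2)) as (d & Hd & K); [lra|].
exists (mkposreal d Hd). intros h h0 Hh. specialize (K h Hh).
replace ((f (t + h) - f t) / h - l) with ((f (t + h) - f t - h * l) / h) by (field; trivial).
unfold Rdiv. rewrite Rabs_mult, Rabs_inv.
assert (0 < Rabs h) by now apply Rabs_pos_lt.
apply Rmult_lt_reg_r with (Rabs h); trivial. rewrite Rmult_assoc, Rinv_l by lra. nra.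
Qed.

Lemma chain_rule (U : R3 -> Prop) (F : R3 -> R) (q : R -> R3) t l :
  open U -> Ck 1 U F -> U (q t) -> is_derive3 q t l ->
  is_derive (fun s => F (q s)) t (cx l * pd1 F (q t) + cy l * pd2 F (q t) + cz l * pd3 F (q t)).
Proof.
intros HU HF Hq (H1 & H2 & H3).
apply is_derive_of_bound. intros eps He.
(* The increments of the curve are at most [M * Rabs h], with 3 for the error terms as [e <= 1]; [N]
   bounds the gradient that multiplies those errors. Each of the two contributions gets half of
   [eps]. *)
set (M := Rabs (cx l) + Rabs (cy l) + Rabs (cz l) + 3).
set (N := Rabs (pd1 F (q t)) + Rabs (pd2 F (q t)) + Rabs (pd3 F (q t)) + 1).
assert (HM : 3 <= M) by (unfold M; pose proof (Rabs_pos (cx l)); pose proof (Rabs_pos (cy l));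
  pose proof (Rabs_pos (cz l)); lra).
assert (HN : 1 <= N) by (unfold N; pose proof (Rabs_pos (pd1 F (q t)));
  pose proof (Rabs_pos (pd2 F (q t))); pose proof (Rabs_pos (pd3 F (q t))); lra).
destruct (C1_estimate U F (q t) (eps / (2 * M)) HU HF Hq) as (d & Hd & B).
{ apply Rdiv_lt_0_compat; lra. }
set (e := Rmin 1 (eps / (2 * N))).
assert (Pe : 0 < e) by (apply Rmin_pos; [lra | apply Rdiv_lt_0_compat; lra]).
assert (e1 : e <= 1) by apply Rmin_l.
assert (e2 : e * N <= eps / 2).
{ apply Rle_trans with (eps / (2 * N) * N); [apply Rmult_le_compat_r;
  [lra | apply Rmin_r] | right; field; lra]. }
destruct (is_derive_bound _ _ _ H1 e Pe) as (a1 & P1 & K1).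
destruct (is_derive_bound _ _ _ H2 e Pe) as (a2 & P2 & K2).
destruct (is_derive_bound _ _ _ H3 e Pe) as (a3 & P3 & K3).
set (a4 := d / M). assert (P4 : 0 < a4) by (apply Rdiv_lt_0_compat; lra).
exists (Rmin (Rmin a1 a2) (Rmin a3 a4)). split; [repeat apply Rmin_pos; trivial|].
intros h Hh.
assert (Rabs h < a1 /\ Rabs h < a2 /\ Rabs h < a3 /\ Rabs h < a4) as (L1 & L2 & L3 & L4).
{ pose proof (Rmin_l (Rmin a1 a2) (Rmin a3 a4)); pose proof (Rmin_r (Rmin a1 a2) (Rmin a3 a4)).
  pose proof (Rmin_l a1 a2); pose proof (Rmin_r a1 a2); pose proof (Rmin_l a3 a4);
    pose proof (Rmin_r a3 a4). lra. }
specialize (K1 h L1). specialize (K2 h L2). specialize (K3 h L3).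
assert (Ph := Rabs_pos h).
set (v := minus (q (t + h)) (q t)).
assert (Ev : q (t + h) = plus (q t) v) by (unfold v; apply R3_eq; coords; ring).
assert (S : forall c lc : R, Rabs (c - h * lc) <= e * Rabs h ->
  Rabs c <= (Rabs lc + 1) * Rabs h).
{ intros c lc H. replace c with ((c - h * lc) + h * lc) by ring.
  eapply Rle_trans; [apply Rabs_triang|]. rewrite Rabs_mult. nra. }
change (Rabs (cx v - h * cx l) <= e * Rabs h) in K1.
change (Rabs (cy v - h * cy l) <= e * Rabs h) in K2.
change (Rabs (cz v - h * cz l) <= e * Rabs h) in K3.
pose proof (S _ _ K1) as S1. pose proof (S _ _ K2) as S2. pose proof (S _ _ K3) as S3.
assert (hM : Rabs h * M < d).
{ apply Rlt_le_trans with (a4 * M); [apply Rmult_lt_compat_r; lra | right; unfold a4; field;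
  lra]. }
assert (Pa := Rabs_pos (cx l)); assert (Pb := Rabs_pos (cy l)); assert (Pc := Rabs_pos (cz l)).
assert (Bv := B v). unfold M in hM.
assert (Rabs (cx v) < d) by nra. assert (Rabs (cy v) < d) by nra.
  assert (Rabs (cz v) < d) by nra.
specialize (Bv ltac:(assumption) ltac:(assumption) ltac:(assumption)).
rewrite Ev.
set (g1 := pd1 F (q t)) in *. set (g2 := pd2 F (q t)) in *. set (g3 := pd3 F (q t)) in *.
replace (F (plus (q t) v) - F (q t) - h * (cx l * g1 + cy l * g2 + cz l * g3)) with
 ((F (plus (q t) v) - F (q t) - (cx v * g1 + cy v * g2 + cz v * g3)) +
  ((cx v - h * cx l) * g1 + (cy v - h * cy l) * g2 + (cz v - h * cz l) * g3)) by ring.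
eapply Rle_trans; [apply Rabs_triang|].
assert (X1 : eps / (2 * M) * (Rabs (cx v) + Rabs (cy v) + Rabs (cz v)) <= eps / 2 * Rabs h).
{ apply Rle_trans with (eps / (2 * M) * (M * Rabs h)).
  - apply Rmult_le_compat_l; [left; apply Rdiv_lt_0_compat; lra|]. unfold M. lra.
  - right. field. lra. }
assert (X2 : Rabs ((cx v - h * cx l) * g1 + (cy v - h * cy l) * g2 + (cz v - h * cz l) * g3) <=
  e * N * Rabs h).
{ eapply Rle_trans; [apply Rabs_triang|].
  eapply Rle_trans; [apply Rplus_le_compat_r, Rabs_triang|].
  rewrite !Rabs_mult. unfold N.
  assert (Rabs (cx v - h * cx l) * Rabs g1 <= e * Rabs h * Rabs g1) by (apply
    Rmult_le_compat_r; [apply Rabs_pos | trivial]).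
  assert (Rabs (cy v - h * cy l) * Rabs g2 <= e * Rabs h * Rabs g2) by (apply
    Rmult_le_compat_r; [apply Rabs_pos | trivial]).
  assert (Rabs (cz v - h * cz l) * Rabs g3 <= e * Rabs h * Rabs g3) by (apply
    Rmult_le_compat_r; [apply Rabs_pos | trivial]).
  nra. }
assert (e * N * Rabs h <= eps / 2 * Rabs h) by (apply Rmult_le_compat_r; trivial).
lra.
Qed.

Lemma C1_continuous (U : R3 -> Prop) (F : R3 -> R) (p : R3) :
  open U -> Ck 1 U F -> U p -> continuous F p.
Proof.
intros HU HF Hp. apply (filterlim_locally F). intros eps.
destruct (C1_estimate U F p 1 HU HF Hp Rlt_0_1) as (d & Hd & B).
set (N := Rabs (pd1 F p) + Rabs (pd2 F p) + Rabs (pd3 F p) + 3).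
pose proof (Rabs_pos (pd1 F p)) as Q1. pose proof (Rabs_pos (pd2 F p)) as Q2.
  pose proof (Rabs_pos (pd3 F p)) as Q3.
assert (HN : 0 < N) by (unfold N; lra).
assert (He : 0 < Rmin d (eps / N)) by (apply Rmin_pos; [trivial | apply Rdiv_lt_0_compat;
  [apply cond_pos | trivial]]).
exists (mkposreal _ He). intros q [[H1 H2] H3].
change (Rabs (cx q - cx p) < Rmin d (eps / N)) in H1.
change (Rabs (cy q - cy p) < Rmin d (eps / N)) in H2.
change (Rabs (cz q - cz p) < Rmin d (eps / N)) in H3.
pose proof (Rmin_l d (eps / N)) as M1. pose proof (Rmin_r d (eps / N)) as M2.
set (v := minus q p). assert (Ev : q = plus p v) by (unfold v; apply R3_eq; coords; ring).
change (Rabs (cx v) < Rmin d (eps / N)) in H1.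
change (Rabs (cy v) < Rmin d (eps / N)) in H2.
change (Rabs (cz v) < Rmin d (eps / N)) in H3.
assert (Bv := B v ltac:(lra) ltac:(lra) ltac:(lra)).
change (Rabs (F q - F p) < eps). rewrite Ev.
replace (F (plus p v) - F p) with ((F (plus p v) - F p - (cx v * pd1 F p + cy v * pd2 F p + cz
  v * pd3 F p)) + (cx v * pd1 F p + cy v * pd2 F p + cz v * pd3 F p)) by ring.
eapply Rle_lt_trans; [apply Rabs_triang|].
assert (X : Rabs (cx v * pd1 F p + cy v * pd2 F p + cz v * pd3 F p) <= Rabs (cx v) * Rabs (pd1
  F p) + Rabs (cy v) * Rabs (pd2 F p) + Rabs (cz v) * Rabs (pd3 F p)).
{ eapply Rle_trans; [apply Rabs_triang|].
  eapply Rle_trans; [apply Rplus_le_compat_r, Rabs_triang|].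
  rewrite !Rabs_mult. lra. }
assert (Y : forall a b, a < Rmin d (eps / N) -> 0 <= b ->
  a * (b + 1) < eps / N * (b + 1)) by (intros; apply Rmult_lt_compat_r; lra).
pose proof (Y _ _ H1 Q1). pose proof (Y _ _ H2 Q2). pose proof (Y _ _ H3 Q3).
assert (eps / N * N = eps) by (field; lra). unfold N in H5 at 2. lra.
Qed.

(** The first derivatives of [F] are of class C^1 and hence continuous by [C1_continuous]; the
    definition of [Ck 2] does not contain this. *)
Lemma C2_C1 (U : R3 -> Prop) (F : R3 -> R) : open U -> Ck 2 U F -> Ck 1 U F.
Proof.
intros HU HF v. destruct (HF v) as [H1 H2]. split; trivial.
intros p Hp. now apply C1_continuous with U.
Qed.

(** * The profile equation *)

(* [rho] is the speed, [(w, u)] the unit tangent and [b] the derivative of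
   minus the tangent angle, so that the principal curvatures are [b / rho] and
   [w / z] up to a common sign. *)
Definition unit_tangent_data (J : R -> Prop) (x z rho w u b : R -> R) : Prop :=
  forall t, J t ->
    (0 < z t /\ 0 < rho t /\ w t * w t + u t * u t = 1) /\
    (is_derive x t (rho t * w t) /\ is_derive z t (rho t * u t)) /\
    (is_derive w t (b t * u t) /\ is_derive u t (- (b t * w t))) /\
    (continuous b t /\ continuous rho t).

Definition profile_of (S : R3 -> Prop) (o e1 e2 e3 : R3) (J : R -> Prop) (x z : R ->
  R) : Prop :=
  orthonormal e1 e2 e3 /\ profile_curve J x z /\
  forall p : R3, (cy p <> 0 \/ cz p <> 0) ->
      (S (plus o (frame e1 e2 e3 p)) <->
       exists t th : R, J t /\ p = (x t, z t * sin th, z t * cos th)).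

Lemma Ck2_R (J : R -> Prop) (f : R -> R) : Ck 2 (J : R_NormedModule -> Prop) f ->
  forall t, J t -> is_derive f t (Derive f t) /\ is_derive (Derive f) t (Derive (Derive f) t)
   /\ continuous (Derive (Derive f)) t.
Proof.
intros H t Ht. destruct (H 1) as [D1 H1]. destruct (H1 1) as [D2 H2]. simpl in H2.
assert (E : dirD (1 : R_NormedModule) f = Derive f) by (apply functional_extensionality;
  intros; apply dirD_R_1).
rewrite E in D2, H2.
assert (E2 : dirD (1 : R_NormedModule) (Derive f) = Derive (Derive f)) by (apply
  functional_extensionality; intros; apply dirD_R_1).
split; [|split].
- apply Derive_correct. apply ex_derive_dirD_R. now apply D1.
- apply Derive_correct. apply ex_derive_dirD_R. now apply D2.
- rewrite <- E2. apply H2. exact Ht.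
Qed.

(** The identities in the second part let [profile_sqnorm] trade the derivatives of [x] and [z] for
    [rho], [w], [u] and [b]; the last of them is the numerator of the curvature of a plane curve. *)
Lemma profile_unit_tangent (J : R -> Prop) (x z : R -> R) : profile_curve J x z ->
  exists rho w u b, unit_tangent_data J x z rho w u b /\
   forall t, J t -> rho t * rho t = Derive x t * Derive x t + Derive z t * Derive z t /\
     Derive x t = rho t * w t /\ Derive z t = rho t * u t /\
     Derive z t * Derive (Derive x) t - Derive x t * Derive (Derive z) t = b t * (rho t * rho
       t).
Proof.
intros (HJ & _ & _ & Hx & Hz & Pz & Hreg).
set (x1 := Derive x) in *. set (z1 := Derive z) in *.
set (x2 := Derive x1). set (z2 := Derive z1).
set (rho := fun t => sqrt (x1 t * x1 t + z1 t * z1 t)).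
exists rho, (fun t => x1 t / rho t), (fun t => z1 t / rho t),
  (fun t => (z1 t * x2 t - x1 t * z2 t) / (x1 t * x1 t + z1 t * z1 t)).
assert (K : forall t, J t -> 0 < x1 t * x1 t + z1 t * z1 t) by (intros t Ht;
  destruct (Hreg t Ht); nra).
assert (R0 : forall t, J t -> 0 < rho t) by (intros t Ht; apply sqrt_lt_R0; auto).
assert (R2 : forall t, J t -> rho t * rho t = x1 t * x1 t + z1 t * z1 t) by (intros t Ht;
  apply sqrt_sqrt; left; auto).
split.
- intros t Ht. specialize (K t Ht). specialize (R0 t Ht). specialize (R2 t Ht).
  destruct (Ck2_R J x Hx t Ht) as (Dx1 & Dx2 & Cx2).
    destruct (Ck2_R J z Hz t Ht) as (Dz1 & Dz2 & Cz2).
  fold x1 in Dx1, Dx2, Cx2. fold x2 in Dx2, Cx2. fold z1 in Dz1, Dz2, Cz2. fold z2 in Dz2, Cz2.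
  assert (Drho : is_derive rho t ((x1 t * x2 t + z1 t * z2 t) / rho t)).
  { unfold rho at 1. eapply is_derive_eq.
    - apply (is_derive_comp_R sqrt (fun t => x1 t * x1 t + z1 t * z1 t)).
      + apply is_derive_Reals. apply derivable_pt_lim_sqrt. exact K.
      + apply is_derive_plus_R; apply is_derive_mult_R; eassumption.
    - cbv beta. fold (rho t). field. lra. }
  assert (Ddiv : forall f df, is_derive f t df ->
    is_derive (fun t => f t / rho t) t ((df * rho t - f t * ((x1 t * x2 t + z1 t * z2 t) / rho
    t)) / (rho t * rho t))).
  { intros f df Hf. eapply is_derive_eq.
    - apply (is_derive_div f rho); try eassumption. lra.
    - field. lra. }
  split; [|split; [|split]].
  + split; [auto|]. split; [trivial|].
    replace (x1 t / rho t * (x1 t / rho t) + z1 t / rho t * (z1 t / rho t)) with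
     ((x1 t * x1 t + z1 t * z1 t) / (rho t * rho t)) by (field; lra). rewrite R2. field. lra.
  + split; [replace (rho t * (x1 t / rho t)) with (x1 t) by (field; lra); trivial|
            replace (rho t * (z1 t / rho t)) with (z1 t) by (field; lra); trivial].
  + split.
    * apply is_derive_eq with (1 := Ddiv _ _ Dx2). rewrite <- R2.
      apply Rmult_eq_reg_r with (rho t * rho t * rho t); [|nra]. field_simplify; [|lra|lra].
      replace (rho t ^ 2) with (x1 t * x1 t + z1 t * z1 t) by (rewrite <- R2; ring). ring.
    * apply is_derive_eq with (1 := Ddiv _ _ Dz2). rewrite <- R2.
      apply Rmult_eq_reg_r with (rho t * rho t * rho t); [|nra]. field_simplify; [|lra|lra].
      replace (rho t ^ 2) with (x1 t * x1 t + z1 t * z1 t) by (rewrite <- R2; ring). ring.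
  + assert (Cx1 : continuous x1 t) by (exact (is_derive_continuous _ _ _ Dx2)).
    assert (Cz1 : continuous z1 t) by (exact (is_derive_continuous _ _ _ Dz2)).
    split.
    * apply (continuous_mult_R (fun t => z1 t * x2 t - x1 t * z2 t) (fun t => / (x1 t * x1 t +
      z1 t * z1 t))).
      -- apply continuous_minus_R; now apply continuous_mult_R.
      -- apply (continuous_comp (fun t => x1 t * x1 t + z1 t * z1 t) Rinv).
         ++ apply continuous_plus_R; now apply continuous_mult_R.
         ++ apply continuous_Rinv. lra.
    * apply (ex_derive_continuous rho). eexists; exact Drho.
- intros t Ht. specialize (K t Ht). specialize (R0 t Ht). specialize (R2 t Ht). cbv beta.
  repeat split; trivial; try (field; lra). rewrite R2. field. lra.
Qed.

Lemma is_derive3_frame (o e1 e2 e3 : R3) (q : R -> R3) t l : is_derive3 q t l ->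
  is_derive3 (fun s => plus o (frame e1 e2 e3 (q s))) t (frame e1 e2 e3 l).
Proof.
intros (H1 & H2 & H3).
assert (K : forall a b c d : R,
  is_derive (fun s => d + (cx (q s) * a + (cy (q s) * b + cz (q s) * c))) t (cx l * a + (cy l *
  b + cz l * c))).
{ intros a b c d. eapply is_derive_eq.
  - apply is_derive_plus_R; [apply is_derive_const_R|].
    apply is_derive_plus_R; [|apply is_derive_plus_R];
    (apply is_derive_mult_R; [eassumption | apply is_derive_const_R]).
  - cbv beta. ring. }
split; [|split].
- exact (K (cx e1) (cx e2) (cx e3) (cx o)).
- exact (K (cy e1) (cy e2) (cy e3) (cy o)).
- exact (K (cz e1) (cz e2) (cz e3) (cz o)).
Qed.

Lemma continuous3_frame (o e1 e2 e3 : R3) (q : R -> R3) t : continuous3 q t ->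
  continuous3 (fun s => plus o (frame e1 e2 e3 (q s))) t.
Proof.
intros (H1 & H2 & H3).
assert (K : forall a b c d : R,
  continuous (fun s => d + (cx (q s) * a + (cy (q s) * b + cz (q s) * c))) t).
{ intros a b c d.
  apply continuous_plus_R; [apply continuous_const|].
  apply continuous_plus_R; [|apply continuous_plus_R];
    (apply continuous_mult_R; [assumption | apply continuous_const]). }
split; [|split].
- exact (K (cx e1) (cx e2) (cx e3) (cx o)).
- exact (K (cy e1) (cy e2) (cy e3) (cy o)).
- exact (K (cz e1) (cz e2) (cz e3) (cz o)).
Qed.

Lemma dirD3_line {V : NormedModule R_AbsRing} (v : V) (X : V -> R3) (p : V) (l : R3) :
  is_derive3 (fun t => X (plus p (scal t v))) 0 l -> dirD3 v X p = l.
Proof.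
intros (H1 & H2 & H3). apply R3_eq.
- exact (is_dirD (fun q => cx (X q)) p v _ H1).
- exact (is_dirD (fun q => cy (X q)) p v _ H2).
- exact (is_dirD (fun q => cz (X q)) p v _ H3).
Qed.

Lemma dirD3_ext_on {V : NormedModule R_AbsRing} (U : V -> Prop) (v : V) (X Y : V ->
  R3) (p : V) :
  open U -> (forall q, U q -> X q = Y q) -> U p -> dirD3 v X p = dirD3 v Y p.
Proof.
intros HU E Hp. unfold dirD3, dirD.
assert (L := line_locally U p v 0 HU (eq_ind_r U Hp (line_0 p v))).
f_equal; [f_equal|]; apply Derive_ext_loc; apply filter_imp with (2 := L); intros t Ht;
  now rewrite (E _ Ht).
Qed.

Lemma det_frame e1 e2 e3 a b c : dot (cross (frame e1 e2 e3 a) (frame e1 e2 e3 b)) (frame e1 e2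
  e3 c) =
  dot (cross e1 e2) e3 * dot (cross a b) c.
Proof. unfold frame. coords. ring. Qed.

Lemma enorm_cross_frame e1 e2 e3 a b (n : R) : orthonormal e1 e2 e3 -> 0 <= n ->
  dot a a * dot b b - dot a b * dot a b = n * n ->
  enorm (cross (frame e1 e2 e3 a) (frame e1 e2 e3 b)) = n.
Proof.
intros H Hn E. unfold enorm. rewrite cross_sq, !(dot_frame _ _ _ _ _ H), E.
  now apply sqrt_square.
Qed.

Lemma is_derive_scal_r (f : R -> R) t l c : is_derive f t l ->
  is_derive (fun s => f s * c) t (l * c).
Proof.
intros H. eapply is_derive_eq.
- apply is_derive_mult_R; [exact H | apply is_derive_const_R].
- cbv beta. ring.
Qed.

Lemma is_derive_line_R (f : R -> R) t l : is_derive f t l ->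
  is_derive (fun s => f (plus t (scal s 1))) 0 l.
Proof.
intros H. eapply is_derive_eq; [apply (dirD_R 1 f t l H)|]. apply Rmult_1_l.
Qed.

Lemma line_R_0 (t s : R) : plus t (scal s 0) = t.
Proof. change (@eq R (t + s * 0) t). ring. Qed.

(** The patch is the usual one by profile parameter and rotation angle, and angle 0 is enough. There
    the metric is diagonal with entries [rho ^ 2] and [z ^ 2], the mixed second coefficient
    vanishes, and the principal curvatures can be read off. *)
Lemma profile_sqnorm (S : R3 -> Prop) o e1 e2 e3 J x z c rho w u b :
  profile_of S o e1 e2 e3 J x z -> constant_sqnorm_A S c ->
  unit_tangent_data J x z rho w u b ->
  (forall t, J t -> rho t * rho t = Derive x t * Derive x t + Derive z t * Derive z t /\
     Derive x t = rho t * w t /\ Derive z t = rho t * u t /\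
     Derive z t * Derive (Derive x) t - Derive x t * Derive (Derive z) t = b t * (rho t * rho
       t)) ->
  forall t, J t -> (b t / rho t) * (b t / rho t) + (w t / z t) * (w t / z t) = c.
Proof.
intros (HO & HP & HS) HA HD HE t Ht.
pose proof HP as (HJ & _ & _ & Hx & Hz & Pz & Hreg).
set (Y := fun q : R2 => (x (fst q), z (fst q) * sin (snd q), z (fst q) * cos (snd q)) : R3).
set (X := fun q : R2 => plus o (frame e1 e2 e3 (Y q))).
set (U := fun q : R2 => J (fst q)).
assert (OU : open U) by (apply (open_comp fst); trivial; intros; apply continuous_fst).
set (Y1 := fun q : R2 => (Derive x (fst q), Derive z (fst q) * sin (snd q),
  Derive z (fst q) * cos (snd q)) : R3).
set (Y2 := fun q : R2 => (0, z (fst q) * cos (snd q), - z (fst q) * sin (snd q)) : R3).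
assert (DX1 : forall q, U q -> dirD3 (1, 0) X q = frame e1 e2 e3 (Y1 q)).
{ intros [q1 q2] Hq. apply dirD3_line. apply is_derive3_frame.
  destruct (Ck2_R J x Hx q1 Hq) as (Dx1 & _). destruct (Ck2_R J z Hz q1 Hq) as (Dz1 & _).
  split; [|split]; unfold Y, Y1, cx, cy, cz; simpl.
  - now apply is_derive_line_R.
  - apply is_derive_ext with (fun s : R => z (plus q1 (scal s 1)) * sin q2).
    + intros s. f_equal. f_equal. symmetry. apply line_R_0.
    + apply (is_derive_scal_r (fun s : R => z (plus q1 (scal s 1)))).
      now apply is_derive_line_R.
  - apply is_derive_ext with (fun s : R => z (plus q1 (scal s 1)) * cos q2).
    + intros s. f_equal. f_equal. symmetry. apply line_R_0.
    + apply (is_derive_scal_r (fun s : R => z (plus q1 (scal s 1)))).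
      now apply is_derive_line_R. }
assert (dsin : forall q2 c : R,
  is_derive (fun s : R => c * sin (plus q2 (scal s 1))) 0 (c * cos q2)).
{ intros q2 c'. apply (is_derive_line_R (fun r => c' * sin r) q2). auto_derive; trivial; ring. }
assert (dcos : forall q2 c : R,
  is_derive (fun s : R => c * cos (plus q2 (scal s 1))) 0 (- c * sin q2)).
{ intros q2 c'. apply (is_derive_line_R (fun r => c' * cos r) q2). auto_derive; trivial; ring. }
assert (DX2 : forall q, U q -> dirD3 (0, 1) X q = frame e1 e2 e3 (Y2 q)).
{ intros [q1 q2] Hq. apply dirD3_line. apply is_derive3_frame.
  split; [|split]; unfold Y, Y2, cx, cy, cz; simpl.
  - apply is_derive_ext with (fun s : R => x q1); [intros s; f_equal; symmetry;
    apply line_R_0|].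
    apply is_derive_const_R.
  - apply is_derive_ext with (fun s : R => z q1 * sin (plus q2 (scal s 1))); [intros s;
    f_equal; f_equal; symmetry; apply line_R_0|].
    apply dsin.
  - apply is_derive_ext with (fun s : R => z q1 * cos (plus q2 (scal s 1))); [intros s;
    f_equal; f_equal; symmetry; apply line_R_0|].
    apply dcos. }
assert (Patch : C2_patch S U X).
{ split; [exact OU|]. split; [|split].
  - assert (lf : forall (p v : R2) (t : R),
    fst (plus p (scal t v)) = fst p + t * fst v) by reflexivity.
    assert (ls : forall (p v : R2) (t : R),
      snd (plus p (scal t v)) = snd p + t * snd v) by reflexivity.
    assert (Kx : Cks 2 U (fun q => x (fst q))).
    { apply (Cks_comp_linear 2 J fst x lf); [intros;
      apply continuous_fst | now apply Ck_Cks_R]. }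
    assert (Kz : Cks 2 U (fun q => z (fst q))).
    { apply (Cks_comp_linear 2 J fst z lf); [intros;
      apply continuous_fst | now apply Ck_Cks_R]. }
    assert (Ks : Cks 2 U (fun q => sin (snd q))).
    { apply Cks_mono with (fun q : R2 => True); trivial.
      apply (Cks_comp_linear 2 (fun _ => True) snd sin ls); [intros;
        apply continuous_snd | apply Cks_sin]. }
    assert (Kc : Cks 2 U (fun q => cos (snd q))).
    { apply Cks_mono with (fun q : R2 => True); trivial.
      apply (Cks_comp_linear 2 (fun _ => True) snd cos ls); [intros;
        apply continuous_snd | apply Cks_cos]. }
    assert (Kk : forall k, Cks 2 U (fun _ => k)) by (intros; apply Cks_const).
    assert (G : forall a1 a2 a3 a0 : R,
      Ck 2 U (fun q : R2 => a0 + (x (fst q) * a1 + (z (fst q) * sin (snd q) * a2 + z (fst q) *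
      cos (snd q) * a3)))).
    { intros a1 a2 a3 a0. apply Cks_Ck.
      apply (Cks_plus 2 U (fun _ => a0) (fun q : R2 => x (fst q) * a1 + (z (fst q) * sin (snd
        q) * a2 + z (fst q) * cos (snd q) * a3))); trivial.
      apply (Cks_plus 2 U (fun q : R2 => x (fst q) * a1) (fun q : R2 => z (fst q) * sin (snd q)
        * a2 + z (fst q) * cos (snd q) * a3)); trivial.
      { apply (Cks_mult 2 U (fun q : R2 => x (fst q)) (fun _ => a1)); trivial. }
      apply (Cks_plus 2 U (fun q : R2 => z (fst q) * sin (snd q) * a2) (fun q : R2 => z (fst q)
        * cos (snd q) * a3)); trivial.
      { apply (Cks_mult 2 U (fun q : R2 => z (fst q) * sin (snd q)) (fun _ => a2)); trivial.
        apply (Cks_mult 2 U (fun q : R2 => z (fst q)) (fun q : R2 => sin (snd q))); trivial. }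
      { apply (Cks_mult 2 U (fun q : R2 => z (fst q) * cos (snd q)) (fun _ => a3)); trivial.
        apply (Cks_mult 2 U (fun q : R2 => z (fst q)) (fun q : R2 => cos (snd q))); trivial. } }
    split; [|split].
    + exact (G (cx e1) (cx e2) (cx e3) (cx o)).
    + exact (G (cy e1) (cy e2) (cy e3) (cy o)).
    + exact (G (cz e1) (cz e2) (cz e3) (cz o)).
  - intros q Hq E. rewrite (DX1 q Hq), (DX2 q Hq) in E.
    pose proof (cross_sq (frame e1 e2 e3 (Y1 q)) (frame e1 e2 e3 (Y2 q))) as C. rewrite E in C.
    rewrite !(dot_frame _ _ _ _ _ HO) in C.
    assert (C1 : dot (Y1 q) (Y1 q) = rho (fst q) * rho (fst q)).
    { rewrite (proj1 (HE _ Hq)). unfold dot, Y1, cx, cy, cz; simpl.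
      transitivity (Derive x (fst q) * Derive x (fst q) + Derive z (fst q) * Derive z (fst q) *
        (sin (snd q) * sin (snd q) + cos (snd q) * cos (snd q))); [ring | rewrite sin_cos_sq;
        ring]. }
    assert (C2 : dot (Y2 q) (Y2 q) = z (fst q) * z (fst q)).
    { unfold dot, Y2, cx, cy, cz; simpl.
      transitivity (z (fst q) * z (fst q) * (sin (snd q) * sin (snd q) + cos (snd q) * cos (snd
        q))); [ring | rewrite sin_cos_sq; ring]. }
    assert (C3 : dot (Y1 q) (Y2 q) = 0) by (unfold dot, Y1, Y2, cx, cy, cz; simpl; ring).
    rewrite C1, C2, C3 in C. destruct (HD _ Hq) as ((P1 & P2 & _) & _).
    assert (0 < rho (fst q) * rho (fst q) * (z (fst q) * z (fst q))) by (repeat apply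
      Rmult_lt_0_compat; trivial).
    unfold dot, cx, cy, cz in C; simpl in C. lra.
  - intros q Hq. apply HS.
    + unfold Y, cy, cz; simpl. specialize (Pz _ Hq). pose proof (sin_cos_sq (snd q)) as sc.
      destruct (Req_dec (z (fst q) * sin (snd q)) 0) as [E|E]; [right | now left].
      intros E'. apply Rmult_integral in E, E'. destruct E as [E|E], E' as [E'|E']; try lra.
        rewrite E, E' in sc. lra.
    + exists (fst q), (snd q). now split. }
assert (Hu : U (t, 0)) by exact Ht.
rewrite <- (HA U X Patch (t, 0) Hu).
destruct (HD t Ht) as ((P1 & P2 & Pw) & _).
destruct (HE t Ht) as (E1 & E2 & E3 & E4).
destruct (Ck2_R J x Hx t Ht) as (_ & Dx2 & _). destruct (Ck2_R J z Hz t Ht) as (_ & Dz2 & _).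
set (x1 := Derive x) in *. set (z1 := Derive z) in *. set (x2 := Derive x1 t) in *.
  set (z2 := Derive z1 t) in *.
assert (D11 : dirD3 (1, 0) (dirD3 (1, 0) X) (t, 0) = frame e1 e2 e3 (x2, 0, z2)).
(* The zero translation brings the first derivative into the form that [is_derive3_frame]
   differentiates. *)
{ rewrite (dirD3_ext_on U (1, 0) _ (fun q => plus (0,0,0) (frame e1 e2 e3 (Y1 q))) (t, 0) OU);
  trivial.
  2:{ intros q Hq. rewrite (DX1 q Hq).
    generalize (frame e1 e2 e3 (Y1 q)); intros; apply R3_eq; coords; ring. }
  apply dirD3_line. apply is_derive3_frame. split; [|split]; unfold Y1, cx, cy, cz; simpl.
  - now apply is_derive_line_R.
  - apply is_derive_ext with (fun s : R => z1 (plus t (scal s 1)) * sin 0); [intros s; f_equal;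
    f_equal; symmetry; apply line_R_0|].
    replace 0 with (z2 * sin 0) at 2 by (rewrite sin_0; ring).
    apply (is_derive_scal_r (fun s : R => z1 (plus t (scal s 1)))). now apply is_derive_line_R.
  - apply is_derive_ext with (fun s : R => z1 (plus t (scal s 1)) * cos 0); [intros s; f_equal;
    f_equal; symmetry; apply line_R_0|].
    replace z2 with (z2 * cos 0) by (rewrite cos_0; ring).
    apply (is_derive_scal_r (fun s : R => z1 (plus t (scal s 1)))). now apply is_derive_line_R.
      }
assert (D12 : dirD3 (1, 0) (dirD3 (0, 1) X) (t, 0) = frame e1 e2 e3 (0, z1 t, 0)).
{ rewrite (dirD3_ext_on U (1, 0) _ (fun q => plus (0,0,0) (frame e1 e2 e3 (Y2 q))) (t, 0) OU);
  trivial.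
  2:{ intros q Hq. rewrite (DX2 q Hq).
    generalize (frame e1 e2 e3 (Y2 q)); intros; apply R3_eq; coords; ring. }
  destruct (Ck2_R J z Hz t Ht) as (Dz1 & _).
  apply dirD3_line. apply is_derive3_frame. split; [|split]; unfold Y2, cx, cy, cz; simpl.
  - apply is_derive_const_R.
  - apply is_derive_ext with (fun s : R => z (plus t (scal s 1)) * cos 0); [intros s; f_equal;
    f_equal; symmetry; apply line_R_0|].
    replace (z1 t) with (z1 t * cos 0) by (rewrite cos_0; ring).
    apply (is_derive_scal_r (fun s : R => z (plus t (scal s 1)))). now apply is_derive_line_R.
  - apply is_derive_ext with (fun s : R => z (plus t (scal s 1)) * (- sin 0)).
    + intros s. rewrite !line_R_0.
      change (@eq R (z (t + s * 1) * - sin 0) (- z (t + s * 1) * sin 0)). ring.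
    + replace 0 with (z1 t * - sin 0) at 2 by (rewrite sin_0; ring).
      apply (is_derive_scal_r (fun s : R => z (plus t (scal s 1)))).
        now apply is_derive_line_R. }
assert (D22 : dirD3 (0, 1) (dirD3 (0, 1) X) (t, 0) = frame e1 e2 e3 (0, 0, - z t)).
{ rewrite (dirD3_ext_on U (0, 1) _ (fun q => plus (0,0,0) (frame e1 e2 e3 (Y2 q))) (t, 0) OU);
  trivial.
  2:{ intros q Hq. rewrite (DX2 q Hq).
    generalize (frame e1 e2 e3 (Y2 q)); intros; apply R3_eq; coords; ring. }
  apply dirD3_line. apply is_derive3_frame. split; [|split]; unfold Y2, cx, cy, cz; simpl.
  - apply is_derive_const_R.
  - apply is_derive_ext with (fun s : R => z t * cos (plus 0 (scal s 1))); [intros s; f_equal;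
    f_equal; symmetry; apply line_R_0|].
    eapply is_derive_eq; [apply dcos | rewrite sin_0; apply Rmult_0_r].
  - apply is_derive_ext with (fun s : R => - z t * sin (plus 0 (scal s 1))); [intros s;
    rewrite line_R_0; reflexivity|].
    eapply is_derive_eq; [apply dsin | rewrite cos_0; apply Rmult_1_r]. }
unfold sqnorm_A, first_ff, second_ff, unit_normal.
rewrite D11, D12, D22, (DX1 (t, 0) Hu), (DX2 (t, 0) Hu).
assert (EY1 : Y1 (t, 0) = (x1 t, 0, z1 t)) by (unfold Y1; simpl; rewrite sin_0, cos_0;
  apply R3_eq; unfold cx, cy, cz; simpl; ring).
assert (EY2 : Y2 (t, 0) = (0, z t, 0)) by (unfold Y2; simpl; rewrite sin_0, cos_0; apply R3_eq;
  unfold cx, cy, cz; simpl; ring).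
rewrite EY1, EY2.
rewrite (enorm_cross_frame _ _ _ _ _ (rho t * z t) HO).
2:{ left; now apply Rmult_lt_0_compat. }
2:{ transitivity ((x1 t * x1 t + z1 t * z1 t) * (z t * z t)); [coords; ring|]. rewrite <- E1.
  ring. }
rewrite !dot_scal_l, !det_frame, !(dot_frame _ _ _ _ _ HO).
(* The frame may reverse orientation and with it the unit normal; only the square of its determinant
   enters. *)
pose proof (det_frame_sq _ _ _ HO) as DD. set (D := dot (cross e1 e2) e3) in *.
replace (dot (x1 t, 0, z1 t) (x1 t, 0, z1 t)) with (rho t * rho t) by (rewrite E1; coords;
  ring).
replace (dot (x1 t, 0, z1 t) (0, z t, 0)) with 0 by (coords; ring).
replace (dot (0, z t, 0) (0, z t, 0)) with (z t * z t) by (coords; ring).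
replace (dot (cross (x1 t, 0, z1 t) (0, z t, 0)) (x2, 0,
  z2)) with (- (z t * (b t * (rho t * rho t)))) by (rewrite <- E4; coords; ring).
replace (dot (cross (x1 t, 0, z1 t) (0, z t, 0)) (0, z1 t, 0)) with 0 by (coords; ring).
replace (dot (cross (x1 t, 0, z1 t) (0, z t, 0)) (0, 0,
  - z t)) with (- (rho t * w t * (z t * z t))) by (rewrite <- E2; coords; ring).
transitivity (D * D * (b t / rho t * (b t / rho t) + w t / z t * (w t / z t))); [rewrite DD;
  ring|].
field. lra.
Qed.

(** * Tangent lines, points of the axis and completeness *)

Lemma dirD_linear (U : R3 -> Prop) (F : R3 -> R) (p v : R3) : open U -> Ck 1 U F -> U p ->
  dirD v F p = cx v * pd1 F p + cy v * pd2 F p + cz v * pd3 F p.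
Proof.
intros HU HF Hp. apply is_dirD.
pose proof (chain_rule U F (fun t => plus p (scal t v)) 0 v HU HF) as H.
assert (E0 : plus p (scal 0 v) = p) by (apply R3_eq; coords; ring).
cbv beta in H. rewrite E0 in H. apply H; trivial.
assert (K : forall a c : R, is_derive (fun s : R => a + s * c) 0 c) by (intros; auto_derive;
  trivial; ring).
split; [|split]; apply K.
Qed.

Lemma continuous_lim3 (F : R3 -> R) (a : nat -> R3) (p : R3) : continuous F p -> lim3 a p ->
  is_lim_seq (fun n => F (a n)) (F p).
Proof.
intros HF (H1 & H2 & H3). apply is_lim_seq_spec. intros eps.
destruct (locally_box p (fun q => Rabs (F q - F p) < eps)) as (d & Hd & B).
{ apply (HF (fun y => Rabs (y - F p) < eps)). exists eps. intros y Hy. exact Hy. }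
apply is_lim_seq_spec in H1, H2, H3.
destruct (H1 (mkposreal d Hd)) as [N1 K1]. destruct (H2 (mkposreal d Hd)) as [N2 K2].
destruct (H3 (mkposreal d Hd)) as [N3 K3]. simpl in *.
exists (N1 + N2 + N3)%nat. intros n Hn. apply B; [apply K1 | apply K2 | apply K3]; lia.
Qed.

Lemma lim3_frame o e1 e2 e3 a p : lim3 a p ->
  lim3 (fun n => plus o (frame e1 e2 e3 (a n))) (plus o (frame e1 e2 e3 p)).
Proof.
intros (H1 & H2 & H3).
assert (K : forall a1 a2 a3 a0 : R,
  is_lim_seq (fun n => a0 + (cx (a n) * a1 + (cy (a n) * a2 + cz (a n) * a3)))
   (a0 + (cx p * a1 + (cy p * a2 + cz p * a3)))).
{ intros. apply is_lim_seq_plus'; [apply is_lim_seq_const|].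
  apply is_lim_seq_plus'; [|apply is_lim_seq_plus']; (apply is_lim_seq_mult';
    [assumption | apply is_lim_seq_const]). }
split; [|split]; apply K.
Qed.

Definition meridian (o e1 e2 e3 : R3) (x z : R) : R3 := plus o (frame e1 e2 e3 (x, 0, z)).

Definition d_frame (F : R3 -> R) (e : R3) (p : R3) : R := cx e * pd1 F p + cy e * pd2 F p + cz
  e * pd3 F p.

Lemma chain_rule_frame (U : R3 -> Prop) (F : R3 -> R) o e1 e2 e3 (q : R -> R3) t l :
  open U -> Ck 1 U F -> U (plus o (frame e1 e2 e3 (q t))) -> is_derive3 q t l ->
  is_derive (fun s => F (plus o (frame e1 e2 e3 (q s)))) t
   (cx l * d_frame F e1 (plus o (frame e1 e2 e3 (q t))) + cy l * d_frame F e2 (plus o (frame e1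
     e2 e3 (q t))) +
    cz l * d_frame F e3 (plus o (frame e1 e2 e3 (q t)))).
Proof.
intros HU HF Hq Hd.
apply is_derive_eq with (1 := chain_rule U F _ t _ HU HF Hq (is_derive3_frame o e1 e2 e3 q t l
  Hd)).
unfold d_frame, frame. set (p := plus o _). clearbody p.
generalize (pd1 F p) (pd2 F p) (pd3 F p). intros. coords. ring.
Qed.

Lemma frame_box (V : R3 -> Prop) o e1 e2 e3 (p : R3) : orthonormal e1 e2 e3 -> open V ->
  V (plus o (frame e1 e2 e3 p)) -> exists d, 0 < d /\ forall q : R3,
   Rabs (cx q - cx p) < d -> Rabs (cy q - cy p) < d -> Rabs (cz q - cz p) < d ->
   V (plus o (frame e1 e2 e3 q)).
Proof.
intros HO OV Vp. destruct (locally_box _ V (OV _ Vp)) as (d & Pd & B).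
(* A third for each coordinate: the norm is bounded by the sum of the three, and the frame preserves
   it. *)
exists (d / 3). split; [lra|]. intros q H1 H2 H3.
assert (N : enorm (frame e1 e2 e3 (minus q p)) < d).
{ unfold enorm. rewrite (dot_frame _ _ _ _ _ HO). apply Rle_lt_trans with (1 := enorm_le_sum _).
  rewrite cx_minus, cy_minus, cz_minus. lra. }
destruct (enorm_coord (frame e1 e2 e3 (minus q p))) as (N1 & N2 & N3).
apply B; eapply Rle_lt_trans; [|exact N| |exact N| |exact N].
- eapply Rle_trans; [|exact N1]. right. f_equal. unfold frame. coords. ring.
- eapply Rle_trans; [|exact N2]. right. f_equal. unfold frame. coords. ring.
- eapply Rle_trans; [|exact N3]. right. f_equal. unfold frame. coords. ring.
Qed.

Lemma d_frame_expand (F : R3 -> R) e1 e2 e3 p v : orthonormal e1 e2 e3 ->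
  cx v * pd1 F p + cy v * pd2 F p + cz v * pd3 F p =
  dot v e1 * d_frame F e1 p + dot v e2 * d_frame F e2 p + dot v e3 * d_frame F e3 p.
Proof.
intros HO. rewrite <- (frame_inv e1 e2 e3 v HO) at 1 2 3.
unfold d_frame, frame.
  generalize (pd1 F p) (pd2 F p) (pd3 F p) (dot v e1) (dot v e2) (dot v e3). intros. coords.
  ring.
Qed.

Lemma profile_in (S : R3 -> Prop) o e1 e2 e3 J x z t : profile_of S o e1 e2 e3 J x z -> J t ->
  S (meridian o e1 e2 e3 (x t) (z t)).
Proof.
intros (_ & HP & HS) Ht. destruct HP as (_ & _ & _ & _ & _ & Pz & _). specialize (Pz t Ht).
apply HS; [right; unfold cz; simpl; lra|]. exists t, 0. split; trivial. rewrite sin_0, cos_0.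
  f_equal; [f_equal|]; ring.
Qed.

Lemma profile_out (S : R3 -> Prop) o e1 e2 e3 J x z a c : profile_of S o e1 e2 e3 J x z ->
  0 < c ->
  S (meridian o e1 e2 e3 a c) -> exists t, J t /\ x t = a /\ z t = c.
Proof.
intros (_ & HP & HS) Hc H. destruct HP as (_ & _ & _ & _ & _ & Pz & _).
apply HS in H; [|right; unfold cz; simpl; lra]. destruct H as (t & th & Ht & E).
exists t. split; trivial. injection E as E1 E2 E3. split; [easy|].
specialize (Pz t Ht). symmetry in E2. apply Rmult_integral in E2.
  destruct E2 as [E2 | E2]; [lra|].
(* With [sin th = 0] the cosine is 1 or -1, and [0 < c] leaves 1. *)
pose proof (sin2_cos2 th) as P. rewrite E2 in P. unfold Rsqr in P.
assert (0 < cos th) by (rewrite E3 in Hc; nra). assert (cos th = 1) by nra. rewrite H0 in E3.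
  lra.
Qed.

(* [f1], [f3] are the derivatives of a defining function along the meridian
   half-plane; the tangent line and the curvature of every curve in the
   half-plane contained in the surface can be read off them. *)
Lemma normal_field (S : R3 -> Prop) o e1 e2 e3 J x z rho w u b t0 :
  embedded_C2_surface S -> profile_of S o e1 e2 e3 J x z ->
    unit_tangent_data J x z rho w u b -> J t0 ->
  exists (f1 f3 : R -> R -> R) (q11 q13 q31 q33 : R),
  (f1 (x t0) (z t0) <> 0 \/ f3 (x t0) (z t0) <> 0) /\
  (exists d, 0 < d /\ forall t, J t -> Rabs (x t - x t0) < d -> Rabs (z t - z t0) < d ->
      f1 (x t) (z t) * w t + f3 (x t) (z t) * u t = 0) /\
  (forall X Z s X' Z', is_derive X s X' -> is_derive Z s Z' -> X s = x t0 -> Z s = z t0 ->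
      is_derive (fun s => f1 (X s) (Z s)) s (q11 * X' + q13 * Z') /\
      is_derive (fun s => f3 (X s) (Z s)) s (q31 * X' + q33 * Z')) /\
  (forall X Z : nat -> R, is_lim_seq X (x t0) -> is_lim_seq Z (z t0) ->
      is_lim_seq (fun n => f1 (X n) (Z n)) (f1 (x t0) (z t0)) /\
      is_lim_seq (fun n => f3 (X n) (Z n)) (f3 (x t0) (z t0))).
Proof.
intros HE HPr HD Ht0.
pose proof HPr as (HO & HP & HS).
set (p := meridian o e1 e2 e3 (x t0) (z t0)).
assert (Sp : S p) by now apply (profile_in S o e1 e2 e3 J x z).
destruct (HE p Sp) as (V & F & OV & Vp & CF & Hreg & HF).
pose proof (C2_C1 V F OV CF) as CF1.
assert (Cd : forall v, Ck 1 V (dirD v F)) by (intros v; exact (proj2 (CF v))).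
assert (C1 : Ck 1 V (pd1 F)) by apply Cd. assert (C2 : Ck 1 V (pd2 F)) by apply Cd.
  assert (C3 : Ck 1 V (pd3 F)) by apply Cd.
destruct (HD t0 Ht0) as ((Pz & _) & _).
(* [F] vanishes along the circle of rotation through [p], whose tangent there is [e2]; so the
   gradient of [F] lies in the meridian plane. *)
assert (G2 : d_frame F e2 p = 0).
{ assert (D : is_derive (fun s => F (plus o (frame e1 e2 e3 (x t0, z t0 * sin s,
  z t0 * cos s)))) 0 (z t0 * d_frame F e2 p)).
  { assert (E0 : plus o (frame e1 e2 e3 (x t0, z t0 * sin 0, z t0 * cos 0)) = p).
    { unfold p, meridian. rewrite sin_0, cos_0, Rmult_0_r, Rmult_1_r. reflexivity. }
    pose proof (chain_rule_frame V F o e1 e2 e3 (fun s => (x t0, z t0 * sin s,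
      z t0 * cos s)) 0 (0, z t0, 0) OV CF1) as H.
    cbv beta in H. rewrite E0 in H. apply is_derive_eq with (1 := H Vp ltac:(
      split; [|split]; unfold cx, cy, cz; simpl;
      [apply is_derive_const_R |
       auto_derive; trivial; rewrite cos_0; ring | auto_derive; trivial; rewrite sin_0; ring])).
    unfold cx, cy, cz; simpl. ring. }
  assert (Z : is_derive (fun s => F (plus o (frame e1 e2 e3 (x t0, z t0 * sin s,
    z t0 * cos s)))) 0 0).
  { apply is_derive_ext_loc with (fun _ => 0); [|apply is_derive_const_R].
    assert (L : locally 0 (fun s => V (plus o (frame e1 e2 e3 (x t0, z t0 * sin s,
      z t0 * cos s))))).
    { destruct (frame_box V o e1 e2 e3 (x t0, 0, z t0) HO OV Vp) as (d & Hd & B).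
      assert (Cs : forall f f' : R -> R, (forall s,
        is_derive f s (f' s)) -> locally 0 (fun s => Rabs (f s - f 0) < d)).
      { intros f f' Df. exact (proj1 (filterlim_locally _ _) (is_derive_continuous _ _ _ (Df
        0)) (mkposreal d Hd)). }
      assert (l2 := Cs (fun s => z t0 * sin s) (fun s => z t0 * cos s) ltac:(intros s;
        auto_derive; trivial; ring)).
      assert (l3 := Cs (fun s => z t0 * cos s) (fun s => - (z t0 * sin s)) ltac:(intros s;
        auto_derive; trivial; ring)).
      cbv beta in l2, l3. rewrite sin_0, Rmult_0_r in l2. rewrite cos_0, Rmult_1_r in l3.
      apply filter_imp with (2 := filter_and _ _ l2 l3). intros s (b2 & b3).
      apply B; trivial. unfold cx; simpl. now rewrite Rminus_eq_0, Rabs_R0. }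
    apply filter_imp with (2 := L). intros s Hs. symmetry. apply HF; trivial.
    apply HS.
    - unfold cy, cz; simpl. destruct (Req_dec (z t0 * sin s) 0) as [E|E]; [right | now left].
      pose proof (sin_cos_sq s) as P.
      intros E'. apply Rmult_integral in E, E'. destruct E as [E|E], E' as [E'|E']; try lra.
        rewrite E, E' in P. lra.
    - exists t0, s. now split. }
  pose proof (is_derive_uniq _ _ _ _ D Z) as E. apply Rmult_integral in E.
    destruct E; [lra | trivial]. }
exists (fun a c => d_frame F e1 (meridian o e1 e2 e3 a c)),
  (fun a c => d_frame F e3 (meridian o e1 e2 e3 a c)).
(* Entries at [p] of the Hessian of [F] with respect to the frame. *)
set (QQ := fun ei ej => cx ei * d_frame (pd1 F) ej p + cy ei * d_frame (pd2 F) ej p + cz ei *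
  d_frame (pd3 F) ej p).
exists (QQ e1 e1), (QQ e1 e3), (QQ e3 e1), (QQ e3 e3).
split; [|split; [|split]].
- fold p. destruct (Hreg p Vp) as (v & Hv).
  rewrite (dirD_linear V F p v OV CF1 Vp), (d_frame_expand F e1 e2 e3 p v HO), G2 in Hv.
  destruct (Req_dec (d_frame F e1 p) 0) as [E|E]; [right | now left].
  intros E'. apply Hv. rewrite E, E'. ring.
- assert (Cm : exists d, 0 < d /\ forall a c,
  Rabs (a - x t0) < d -> Rabs (c - z t0) < d -> V (meridian o e1 e2 e3 a c)).
  { destruct (frame_box V o e1 e2 e3 (x t0, 0, z t0) HO OV Vp) as (d & Hd & B). exists d.
    split; trivial.
    intros a c Ha Hc. apply B; trivial. unfold cy; simpl. now rewrite Rminus_eq_0, Rabs_R0. }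
  destruct Cm as (d & Hd & B). exists d. split; trivial. intros t Ht H1 H2.
  destruct (HD t Ht) as ((_ & Pr & _) & (Dx & Dz) & _).
  assert (Vt := B _ _ H1 H2).
  assert (D : is_derive (fun s => F (meridian o e1 e2 e3 (x s) (z s))) t
    (rho t * (d_frame F e1 (meridian o e1 e2 e3 (x t) (z t)) * w t + d_frame F e3 (meridian o
      e1 e2 e3 (x t) (z t)) * u t))).
  { apply is_derive_eq with (1 := chain_rule_frame V F o e1 e2 e3 (fun s => (x s, 0,
    z s)) t (rho t * w t, 0, rho t * u t) OV CF1 Vt
     (conj Dx (conj (is_derive_const_R 0 t) Dz))).
    unfold meridian, cx at 1, cy at 1, cz at 1; simpl. ring. }
  assert (Z : is_derive (fun s => F (meridian o e1 e2 e3 (x s) (z s))) t 0).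
  { apply is_derive_ext_loc with (fun _ => 0); [|apply is_derive_const_R].
    assert (Cx : continuous x t) by (exact (is_derive_continuous _ _ _ Dx)).
    assert (Cz : continuous z t) by (exact (is_derive_continuous _ _ _ Dz)).
    assert (Px : 0 < d - Rabs (x t - x t0)) by lra.
      assert (Pz' : 0 < d - Rabs (z t - z t0)) by lra.
    pose proof (proj1 (filterlim_locally _ _) Cx (mkposreal _ Px)) as l1.
    pose proof (proj1 (filterlim_locally _ _) Cz (mkposreal _ Pz')) as l2.
    assert (l3 : locally t J) by (apply HP; trivial).
    apply filter_imp with (2 := filter_and _ _ l1 (filter_and _ _ l2 l3)).
    intros s (b1 & b2 & b3). symmetry.
      apply HF; [apply B | now apply (profile_in S o e1 e2 e3 J x z)].
    - change (Rabs (x s - x t) < d - Rabs (x t - x t0)) in b1.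
      replace (x s - x t0) with ((x s - x t) + (x t - x t0)) by ring.
        eapply Rle_lt_trans; [apply Rabs_triang|]. lra.
    - change (Rabs (z s - z t) < d - Rabs (z t - z t0)) in b2.
      replace (z s - z t0) with ((z s - z t) + (z t - z t0)) by ring.
        eapply Rle_lt_trans; [apply Rabs_triang|]. lra. }
  pose proof (is_derive_uniq _ _ _ _ D Z) as E. apply Rmult_integral in E.
    destruct E; [lra | trivial].
- intros X Z s X' Z' HX HZ EX EZ.
  assert (K : forall G, Ck 1 V G ->
    is_derive (fun s => G (meridian o e1 e2 e3 (X s) (Z s))) s (X' * d_frame G e1 p + Z' *
    d_frame G e3 p)).
  { intros G CG.
    assert (Es : plus o (frame e1 e2 e3 (X s, 0, Z s)) = p) by (unfold p, meridian;
      now rewrite EX, EZ).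
    pose proof (chain_rule_frame V G o e1 e2 e3 (fun s => (X s, 0, Z s)) s (X', 0,
      Z') OV CG) as H. cbv beta in H.
    rewrite Es in H. apply is_derive_eq with (1 := H Vp (conj HX (conj (is_derive_const_R 0 s)
      HZ))).
    unfold cx at 1, cy at 1, cz at 1; simpl. ring. }
  assert (K' : forall e, is_derive (fun s => d_frame F e (meridian o e1 e2 e3 (X s) (Z s))) s
    (QQ e e1 * X' + QQ e e3 * Z')).
  { intros e. unfold d_frame at 1. eapply is_derive_eq.
    - apply is_derive_plus_R; [apply is_derive_plus_R|];
      (apply is_derive_scal; apply K; assumption).
    - unfold plus; simpl. unfold QQ. ring. }
  split; apply K'.
- intros X Z HX HZ.
  assert (L : lim3 (fun n => meridian o e1 e2 e3 (X n) (Z n)) p).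
  { apply (lim3_frame o e1 e2 e3 (fun n => (X n, 0, Z n)) (x t0, 0, z t0)).
    split; [|split]; unfold cx, cy, cz; simpl; trivial. apply is_lim_seq_const. }
  assert (K : forall e, is_lim_seq (fun n => d_frame F e (meridian o e1 e2 e3 (X n) (Z n)))
    (d_frame F e p)).
  { intros e. unfold d_frame.
    apply is_lim_seq_plus'; [apply is_lim_seq_plus'|]; (apply is_lim_seq_mult';
      [apply is_lim_seq_const|]).
    - apply (continuous_lim3 (pd1 F)); trivial. now apply C1_continuous with V.
    - apply (continuous_lim3 (pd2 F)); trivial. now apply C1_continuous with V.
    - apply (continuous_lim3 (pd3 F)); trivial. now apply C1_continuous with V. }
  split; apply K.
Qed.

(** Choose a direction [v] along which [F] increases, and a unit vector [e] orthogonal to [v] and to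
    the axis. On the line of direction [v] displaced by a small [h] along [e], [F] still changes
    sign, and the zero found there is off the axis because its component along [e] is [h]. *)
Lemma axis_limit (S : R3 -> Prop) o e1 e2 e3 a eps :
  embedded_C2_surface S -> orthonormal e1 e2 e3 -> S (plus o (frame e1 e2 e3 (a, 0,
    0))) -> 0 < eps ->
  exists p : R3, (cy p <> 0 \/ cz p <> 0) /\ S (plus o (frame e1 e2 e3 p)) /\
   Rabs (cx p - a) < eps /\ Rabs (cy p) < eps /\ Rabs (cz p) < eps.
Proof.
intros HE HO Sp Heps. set (p0 := plus o _) in Sp.
destruct (HE p0 Sp) as (V & F & OV & Vp & CF & Hreg & HF).
pose proof (C2_C1 V F OV CF) as CF1.
destruct (Hreg p0 Vp) as (v & Hv).
assert (Hv' : exists v : R3, 0 < dirD v F p0).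
{ destruct (Rlt_le_dec 0 (dirD v F p0)) as [L|L]; [now exists v|].
  exists (scal (-1) v). rewrite (dirD_linear V F p0 _ OV CF1 Vp).
    rewrite (dirD_linear V F p0 _ OV CF1 Vp) in Hv, L.
  replace (cx (scal (-1) v)) with (- cx v) by (coords; ring).
    replace (cy (scal (-1) v)) with (- cy v) by (coords; ring).
  replace (cz (scal (-1) v)) with (- cz v) by (coords; ring). lra. }
clear v Hv. destruct Hv' as (v' & Hv').
set (v := (dot v' e1, dot v' e2, dot v' e3) : R3).
assert (Ev : v' = frame e1 e2 e3 v) by (symmetry; now apply frame_inv).
set (D := dirD v' F p0) in *.
assert (He : exists e : R3, cx e = 0 /\ dot e e = 1 /\ dot v e = 0).
{ destruct (Req_dec (cy v * cy v + cz v * cz v) 0) as [E|E].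
  - exists (0, 1, 0). split; [reflexivity|]. split; [coords; ring|]. assert (cy v = 0) by nra.
    unfold dot at 1. rewrite H. unfold cx, cy, cz; simpl. ring.
  - assert (P : 0 < cy v * cy v + cz v * cz v) by nra.
    pose proof (sqrt_lt_R0 _ P) as S0. pose proof (sqrt_sqrt _ (Rlt_le _ _ P)) as S1.
      set (n := sqrt _) in *.
    exists (0, - cz v / n, cy v / n). split; [reflexivity|]. split.
    + transitivity ((cy v * cy v + cz v * cz v) / (n * n)); [unfold dot, cx, cy, cz; simpl;
      field; lra|]. rewrite S1. field. lra.
    + unfold dot, cx, cy, cz; simpl. field. lra. }
destruct He as (e & e0 & ee & ve).
set (P := fun h s : R => (a + s * cx v, s * cy v + h * cy e, s * cz v + h * cz e) : R3).
set (N := Rabs (cx v) + Rabs (cy v) + Rabs (cz v) + 1).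
assert (HN : 1 <= N) by (unfold N; pose proof (Rabs_pos (cx v)); pose proof (Rabs_pos (cy v));
  pose proof (Rabs_pos (cz v)); lra).
assert (HeC : Rabs (cy e) <= 1 /\ Rabs (cz e) <= 1).
{ pose proof (enorm_coord e) as K. unfold enorm in K. rewrite ee, sqrt_1 in K. tauto. }
assert (Hbox : exists d, 0 < d /\ forall h s,
  Rabs h < d -> Rabs s < d -> V (plus o (frame e1 e2 e3 (P h s)))).
{ destruct (frame_box V o e1 e2 e3 (a, 0, 0) HO OV Vp) as (d & Hd & B).
  exists (d / (2 * N)). assert (Q0 : 0 < d / (2 * N)) by (apply Rdiv_lt_0_compat; lra).
    split; trivial.
  intros h s Hh Hs.
  assert (Q : d / (2 * N) * N = d / 2) by (field; lra).
  assert (K : forall r c, Rabs r < d / (2 * N) -> Rabs c <= N -> Rabs (r * c) < d / 2).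
  { intros r c Hr Hc. rewrite Rabs_mult. rewrite <- Q. pose proof (Rabs_pos c).
    pose proof (Rabs_pos r). nra. }
  assert (Nx : Rabs (cx v) <= N /\ Rabs (cy v) <= N /\ Rabs (cz v) <= N)
    by (unfold N; pose proof (Rabs_pos (cx v)); pose proof (Rabs_pos (cy v));
      pose proof (Rabs_pos (cz v)); lra).
  destruct Nx as (Nx & Ny & Nz). destruct HeC as (Ey & Ez).
  apply B.
  - replace (cx (P h s) - cx (a, 0, 0)) with (s * cx v)
      by (change (s * cx v = a + s * cx v - a); ring).
    pose proof (K s _ Hs Nx). lra.
  - replace (cy (P h s) - cy (a, 0, 0)) with (s * cy v + h * cy e)
      by (change (s * cy v + h * cy e = s * cy v + h * cy e - 0); ring).
    eapply Rle_lt_trans; [apply Rabs_triang|]. pose proof (K s _ Hs Ny).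
      pose proof (K h (cy e) Hh ltac:(lra)). lra.
  - replace (cz (P h s) - cz (a, 0, 0)) with (s * cz v + h * cz e)
      by (change (s * cz v + h * cz e = s * cz v + h * cz e - 0); ring).
    eapply Rle_lt_trans; [apply Rabs_triang|]. pose proof (K s _ Hs Nz).
      pose proof (K h (cz e) Hh ltac:(lra)). lra. }
destruct Hbox as (d & Hd & HV).
set (g := fun h s => F (plus o (frame e1 e2 e3 (P h s)))).
assert (P00 : plus o (frame e1 e2 e3 (P 0 0)) = p0) by (unfold P, p0; do 3 f_equal; [f_equal|];
  ring).
assert (g00 : g 0 0 = 0) by (unfold g; rewrite P00; now apply HF).
assert (Dg : is_derive (g 0) 0 D).
{ pose proof (chain_rule_frame V F o e1 e2 e3 (P 0) 0 v OV CF1) as H. rewrite P00 in H.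
  apply is_derive_eq with (1 := H Vp ltac:(
     split; [|split]; unfold P, cx at 1, cy at 1, cz at 1; simpl; auto_derive; trivial; ring)).
  unfold D. rewrite (dirD_linear V F p0 v' OV CF1 Vp), (d_frame_expand F e1 e2 e3 p0 v' HO).
    reflexivity. }
assert (Cg : forall h s, Rabs h < d -> Rabs s < d ->
  continuous (g h) s /\ continuous (fun h => g h s) h).
{ intros h s Hh Hs. specialize (HV h s Hh Hs). split.
  - apply (ex_derive_continuous (g h)). eexists.
    apply (chain_rule_frame V F o e1 e2 e3 (P h) s v OV CF1 HV).
    split; [|split]; unfold P, cx at 1, cy at 1, cz at 1; simpl; auto_derive; trivial; ring.
  - apply (ex_derive_continuous (fun h => g h s)). eexists.
    apply (chain_rule_frame V F o e1 e2 e3 (fun h => P h s) h e OV CF1 HV).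
    split; [|split]; unfold P, cx at 1, cy at 1, cz at 1; simpl; auto_derive; trivial;
      rewrite ?e0; ring. }
(* An error of half the slope [D] still fixes the signs of [g 0] at [s0] and [- s0]. The other
   bounds on [s0] keep the points in the box and within [eps]. *)
destruct (is_derive_bound _ _ _ Dg (D / 2) ltac:(lra)) as (d' & Hd' & B).
set (s0 := Rmin (Rmin (d / 2) (d' / 2)) (eps / (4 * N))).
assert (Es : 0 < eps / (4 * N)) by (apply Rdiv_lt_0_compat; lra).
assert (s0p : 0 < s0) by (repeat apply Rmin_pos; lra).
assert (s0d : s0 < d /\ s0 < d' /\ s0 <= eps / (4 * N)).
{ unfold s0. pose proof (Rmin_l (Rmin (d / 2) (d' / 2)) (eps / (4 * N))).
  pose proof (Rmin_r (Rmin (d / 2) (d' / 2)) (eps / (4 * N))).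
  pose proof (Rmin_l (d / 2) (d' / 2)). pose proof (Rmin_r (d / 2) (d' / 2)). lra. }
destruct s0d as (s0d & s0d' & s0e).
assert (gp : 0 < g 0 s0).
{ specialize (B s0). rewrite Rabs_pos_eq in B by lra. specialize (B s0d').
  rewrite Rplus_0_l, g00 in B.
  apply Rabs_le_between in B. nra. }
assert (gm : g 0 (- s0) < 0).
{ specialize (B (- s0)). rewrite Rabs_Ropp, Rabs_pos_eq in B by lra. specialize (B s0d').
  rewrite Rplus_0_l, g00 in B.
  apply Rabs_le_between in B. nra. }
assert (A0 : Rabs 0 < d) by (rewrite Rabs_R0; trivial).
assert (As : Rabs s0 < d) by (rewrite Rabs_pos_eq; lra).
assert (As' : Rabs (- s0) < d) by (rewrite Rabs_Ropp; trivial).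
assert (L : locally 0 (fun h => 0 < g h s0 /\ g h (- s0) < 0 /\ Rabs h < Rmin d (eps / 4))).
{ apply filter_and; [|apply filter_and].
  - apply (proj2 (Cg 0 s0 A0 As) (fun y => 0 < y)). now apply (open_gt 0).
  - apply (proj2 (Cg 0 (- s0) A0 As') (fun y => y < 0)). now apply (open_lt 0).
  - assert (0 < Rmin d (eps / 4)) by (apply Rmin_pos; lra).
    exists (mkposreal _ H). intros y Hy.
      replace y with (minus y 0) by (unfold minus, plus, opp; simpl; ring). exact Hy. }
destruct L as [d'' L].
set (h := d'' / 2). assert (hp : 0 < h) by (unfold h; destruct d''; simpl; lra).
destruct (L h) as (H1 & H2 & H3).
{ change (Rabs (h - 0) < d''). rewrite Rminus_0_r, Rabs_pos_eq by lra.
  unfold h; destruct d''; simpl; lra. }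
pose proof (Rmin_l d (eps / 4)) as M1. pose proof (Rmin_r d (eps / 4)) as M2.
assert (hd : Rabs h < d) by lra.
destruct (Ranalysis5.IVT_interv (g h) (- s0) s0) as (s & Hs & Es'); trivial; try lra.
{ intros s Hs. apply continuity_pt_filterlim. apply (Cg h s hd). apply Rabs_def1; lra. }
assert (sd : Rabs s <= s0) by (apply Rabs_le; lra).
exists (P h s).
assert (Pe : cy (P h s) * cy e + cz (P h s) * cz e = h).
{ transitivity (s * dot v e - s * cx v * cx e + h * (dot e e - cx e * cx e)).
  - unfold P, cy at 1, cz at 1, dot; simpl. ring.
  - rewrite ve, ee, e0. ring. }
assert (sN : s0 * N <= eps / 4).
{ apply Rle_trans with (eps / (4 * N) * N); [apply Rmult_le_compat_r; lra | right; field; lra].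
  }
assert (K1 : forall c, Rabs c <= N -> Rabs (s * c) <= eps / 4).
{ intros c Hc. rewrite Rabs_mult. pose proof (Rabs_pos c). pose proof (Rabs_pos s). nra. }
assert (K2 : forall c, Rabs c <= 1 -> Rabs (h * c) < eps / 4).
{ intros c Hc. rewrite Rabs_mult. pose proof (Rabs_pos c). pose proof (Rabs_pos h). nra. }
assert (Nx : Rabs (cx v) <= N /\ Rabs (cy v) <= N /\ Rabs (cz v) <= N) by (unfold N;
  pose proof (Rabs_pos (cx v)); pose proof (Rabs_pos (cy v)); pose proof (Rabs_pos (cz v));
  lra).
destruct Nx as (Nx & Ny & Nz).
split; [|split; [|split; [|split]]].
- destruct (Req_dec (cy (P h s)) 0) as [E|E]; [right | now left].
  intros E'. rewrite E, E' in Pe. lra.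
- apply HF; trivial. apply HV; trivial. lra.
- replace (cx (P h s) - a) with (s * cx v) by (unfold P, cx at 2; simpl; ring).
  apply Rle_lt_trans with (1 := K1 _ Nx). lra.
- change (cy (P h s)) with (s * cy v + h * cy e). eapply Rle_lt_trans; [apply Rabs_triang|].
  pose proof (K1 _ Ny). pose proof (K2 _ (proj1 HeC)). lra.
- change (cz (P h s)) with (s * cz v + h * cz e). eapply Rle_lt_trans; [apply Rabs_triang|].
  pose proof (K1 _ Nz). pose proof (K2 _ (proj2 HeC)). lra.
Qed.

(* A curve in the half-plane whose length is dominated by the variation of [G]. *)
Lemma complete_limit (S : R3 -> Prop) o e1 e2 e3 (I : R -> Prop) (X Z X1 Z1 G G1 : R ->
  R) (s : nat -> R) :
  complete_surface S -> orthonormal e1 e2 e3 ->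
  (forall a b t, I a -> I b -> a <= t <= b -> I t) ->
  (forall t, I t -> is_derive X t (X1 t) /\ is_derive Z t (Z1 t) /\ is_derive G t (G1 t)) ->
  (forall t, I t -> continuous X1 t /\ continuous Z1 t /\ continuous G1 t) ->
  (forall t, I t -> S (meridian o e1 e2 e3 (X t) (Z t))) ->
  (forall t, I t -> X1 t * X1 t + Z1 t * Z1 t <= G1 t * G1 t /\ 0 <= G1 t) ->
  (forall n, I (s n)) -> (exists l : R, is_lim_seq (fun n => G (s n)) l) ->
  exists a c : R, S (meridian o e1 e2 e3 a c) /\ is_lim_seq (fun n => X (s n)) a /\
    is_lim_seq (fun n => Z (s n)) c.
Proof.
intros HC HO HI HD HCont HS HG Hs [l Hl].
set (q := fun t => meridian o e1 e2 e3 (X t) (Z t)).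
set (q1 := fun t => frame e1 e2 e3 (X1 t, 0, Z1 t)).
assert (Dq : forall t, I t -> is_derive3 q t (q1 t)).
{ intros t Ht. destruct (HD t Ht) as (D1 & D2 & _).
  apply (is_derive3_frame o e1 e2 e3 (fun t => (X t, 0, Z t))).
  exact (conj D1 (conj (is_derive_const_R 0 t) D2)). }
assert (Cq : forall t, I t -> continuous3 q1 t).
{ intros t Ht. destruct (HCont t Ht) as (C1 & C2 & _).
  assert (K : continuous3 (fun s => plus (0,0,0) (frame e1 e2 e3 (X1 s, 0, Z1 s))) t).
  { apply continuous3_frame. exact (conj C1 (conj (continuous_const (0 : R) t) C2)). }
  destruct K as (K1 & K2 & K3). split; [|split].
  - apply continuous_ext with (2 := K1). intros r. apply Rplus_0_l.
  - apply continuous_ext with (2 := K2). intros r. apply Rplus_0_l.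
  - apply continuous_ext with (2 := K3). intros r. apply Rplus_0_l. }
assert (Nq : forall t, I t -> enorm (q1 t) <= G1 t).
{ intros t Ht. destruct (HG t Ht) as (N1 & N2). unfold enorm, q1.
  rewrite (dot_frame _ _ _ _ _ HO).
  rewrite <- (sqrt_square (G1 t)) by trivial. apply sqrt_le_1_alt.
  unfold dot, cx, cy, cz; simpl. lra. }
(* A path between two parameters stays in the convex set [I] and is no longer than the variation of
   [G]; convergence of [G (s n)] then makes the points intrinsically Cauchy. *)
assert (L1 : forall a b eps, I a -> I b -> a <= b -> G b - G a < eps ->
   Rbar_lt (intrinsic_dist S (q a) (q b)) eps /\ Rbar_lt (intrinsic_dist S (q b) (q a)) eps).
{ intros a b eps Ia Ib Hab Hlt.
  assert (IN : forall t, I (a + smoothstep t * (b - a)) /\ I (b + smoothstep t * (a - b))).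
  { intros t. pose proof (smoothstep_bound t). split; apply HI with a b; trivial; nra. }
  assert (Path : forall c d : R, (forall t, I (c + smoothstep t * (d - c))) ->
     (forall t, is_derive3 (fun t => q (c + smoothstep t * (d - c))) t (scal (smoothstep' t *
       (d - c)) (q1 (c + smoothstep t * (d - c))))) /\
     (forall t, continuous3 (fun t => scal (smoothstep' t * (d - c)) (q1 (c + smoothstep t * (d
       - c)))) t) /\
     C1_path_in S (q c) (q d) (fun t => q (c + smoothstep t * (d - c)))).
  { intros c d IN'.
    assert (Dv : forall t, is_derive (fun t => c + smoothstep t * (d - c)) t (smoothstep' t *
      (d - c))).
    { intros t. unfold smoothstep, smoothstep'. auto_derive; trivial. field. }
    assert (A1 : forall t, is_derive3 (fun t => q (c + smoothstep t * (d - c))) t (scal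
      (smoothstep' t * (d - c)) (q1 (c + smoothstep t * (d - c))))).
    { intros t. apply (is_derive3_comp q (fun t => c + smoothstep t * (d - c)));
      [apply Dq, IN' | apply Dv]. }
    assert (A2 : forall t, continuous3 (fun t => scal (smoothstep' t * (d - c)) (q1 (c +
      smoothstep t * (d - c)))) t).
    { intros t. apply (continuous3_comp_scal q1 (fun t => c + smoothstep t * (d - c)) (fun t =>
      smoothstep' t * (d - c))); [apply Cq, IN' | |].
      - apply (ex_derive_continuous (fun t => c + smoothstep t * (d - c))). eexists. apply Dv.
      - apply (ex_derive_continuous (fun t => smoothstep' t * (d - c))). unfold smoothstep'.
        auto_derive. trivial. }
    split; [exact A1|]. split; [exact A2|]. split; [|split; [|split]].
    - apply Ck3_1_path with (1 := A1) (2 := A2).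
    - intros t _. exact (HS _ (IN' t)).
    - rewrite smoothstep_0. replace (c + 0 * (d - c)) with c by ring. reflexivity.
    - rewrite smoothstep_1. replace (c + 1 * (d - c)) with d by ring. reflexivity. }
  assert (Dg : forall c d t, I (c + smoothstep t * (d - c)) ->
    is_derive (fun t => G (c + smoothstep t * (d - c))) t (smoothstep' t * (d - c) * G1 (c +
    smoothstep t * (d - c)))
      /\ continuous (fun t => smoothstep' t * (d - c) * G1 (c + smoothstep t * (d - c))) t).
  { intros c d t It.
    assert (Dv : is_derive (fun t => c + smoothstep t * (d - c)) t (smoothstep' t * (d - c))).
    { unfold smoothstep, smoothstep'. auto_derive; trivial. field. }
    split.
    - apply (is_derive_comp_R G (fun t => c + smoothstep t * (d - c))); trivial.
      apply (HD _ It).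
    - apply (continuous_mult_R (fun t => smoothstep' t * (d - c)) (fun t => G1 (c + smoothstep
      t * (d - c)))).
      + apply (ex_derive_continuous (fun t => smoothstep' t * (d - c))). unfold smoothstep'.
        auto_derive. trivial.
      + apply (continuous_comp (fun t => c + smoothstep t * (d - c)) G1); [|apply (HCont _ It)].
        apply (ex_derive_continuous (fun t => c + smoothstep t * (d - c))). eexists. apply Dv. }
  split.
  - destruct (Path a b (fun t => proj1 (IN t))) as (A1 & A2 & A3).
    apply intrinsic_dist_lt with (1 := A3).
    apply Rle_lt_trans with (2 := Hlt).
    replace (G b - G a) with (G (a + smoothstep 1 * (b - a)) - G (a + smoothstep 0 * (b - a)))
      by (rewrite smoothstep_0, smoothstep_1; f_equal; [f_equal; ring | f_equal; f_equal;
      ring]).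
    apply (path_length_le _ _ (fun t => G (a + smoothstep t * (b - a))) _ (fun t _ => A1 t)
      (fun t _ => A2 t) (fun t _ => proj1 (Dg a b t (proj1 (IN t)))) (fun t _ => proj2 (Dg a b
      t (proj1 (IN t))))).
    intros t Ht. rewrite enorm_scal, Rabs_pos_eq by (pose proof (smoothstep'_pos t Ht); nra).
    apply Rmult_le_compat_l; [pose proof (smoothstep'_pos t Ht); nra | apply Nq, IN].
  (* Travelling backwards [G] does not increase, so the dominating primitive is [- G]. *)
  - destruct (Path b a (fun t => proj2 (IN t))) as (A1 & A2 & A3).
    apply intrinsic_dist_lt with (1 := A3).
    apply Rle_lt_trans with (2 := Hlt).
    replace (G b - G a) with (- G (b + smoothstep 1 * (a - b)) - - G (b + smoothstep 0 * (a -
      b))) by (rewrite smoothstep_0, smoothstep_1; replace (b + 1 * (a - b)) with a by ring;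
      replace (b + 0 * (a - b)) with b by ring; ring).
    apply (path_length_le _ _ (fun t => - G (b + smoothstep t * (a - b))) (fun t => -
      (smoothstep' t * (a - b) * G1 (b + smoothstep t * (a - b)))) (fun t _ => A1 t) (fun t _
      => A2 t)).
    + intros t _. apply (is_derive_opp_R (fun t => G (b + smoothstep t * (a - b)))).
      apply (Dg b a t (proj2 (IN t))).
    + intros t _. apply continuous_opp_R. apply (Dg b a t (proj2 (IN t))).
    + intros t Ht. rewrite enorm_scal, Rabs_left1 by (pose proof (smoothstep'_pos t Ht); nra).
      replace (- (smoothstep' t * (a - b) * G1 (b + smoothstep t * (a - b)))) with (-
        (smoothstep' t * (a - b)) * G1 (b + smoothstep t * (a - b))) by ring.
      apply Rmult_le_compat_l; [pose proof (smoothstep'_pos t Ht); nra | apply Nq, IN]. }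
assert (Cau : forall eps : posreal, exists N : nat, forall m n : nat,
        (N <= m)%nat -> (N <= n)%nat -> Rbar_lt (intrinsic_dist S (q (s m)) (q (s n))) eps).
{ assert (HCau : ex_finite_lim_seq (fun n => G (s n))) by (now exists l).
  apply ex_lim_seq_cauchy_corr in HCau. intros eps. destruct (HCau eps) as [N HN]. exists N.
    intros m n Hm Hn.
  specialize (HN m n Hm Hn). apply Rabs_def2 in HN.
  destruct (Rle_lt_dec (s m) (s n)) as [Hle | Hle].
  - apply (L1 (s m) (s n) eps); trivial. lra.
  - apply (L1 (s n) (s m) eps); trivial; lra. }
destruct (HC (fun n => q (s n)) (fun n => HS _ (Hs n)) Cau) as (p & Sp & Hp).
apply intrinsic_lim in Hp. destruct Hp as (P1 & P2 & P3).
set (v := minus p o). set (p0 := (dot v e1, dot v e2, dot v e3) : R3).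
assert (Ep : p = plus o (frame e1 e2 e3 p0)).
{ unfold p0. rewrite frame_inv by trivial. unfold v. apply R3_eq; coords; ring. }
assert (K : forall e, is_lim_seq (fun n => dot (minus (q (s n)) o) e) (dot v e)).
{ intros e. unfold dot, v.
  assert (M : forall (u : nat -> R) (l c m : R),
    is_lim_seq u l -> is_lim_seq (fun n => (u n - c) * m) ((l - c) * m)).
  { intros u0 l0 c m Hu. apply is_lim_seq_mult'; [|apply is_lim_seq_const].
    apply is_lim_seq_minus'; trivial. apply is_lim_seq_const. }
  apply is_lim_seq_plus'; [apply is_lim_seq_plus'|].
  - exact (M _ _ (cx o) (cx e) P1).
  - exact (M _ _ (cy o) (cy e) P2).
  - exact (M _ _ (cz o) (cz e) P3). }
assert (Eq : forall t, minus (q t) o = frame e1 e2 e3 (X t, 0, Z t)).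
{ intros t. unfold q, meridian. generalize (frame e1 e2 e3 (X t, 0, Z t)). intros.
  apply R3_eq; coords; ring. }
destruct HO as (O1 & O2 & O3 & O4 & O5 & O6).
assert (F1 : forall t, dot (minus (q t) o) e1 = X t).
{ intros t. rewrite Eq.
  transitivity (X t * dot e1 e1 + Z t * dot e1 e3); [unfold frame; coords; ring|].
  rewrite O1, O5. ring. }
assert (F2 : forall t, dot (minus (q t) o) e2 = 0).
{ intros t. rewrite Eq.
  transitivity (X t * dot e1 e2 + Z t * dot e2 e3); [unfold frame; coords; ring|].
  rewrite O4, O6. ring. }
assert (F3 : forall t, dot (minus (q t) o) e3 = Z t).
{ intros t. rewrite Eq.
  transitivity (X t * dot e1 e3 + Z t * dot e3 e3); [unfold frame; coords; ring|].
  rewrite O3, O5. ring. }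
exists (dot v e1), (dot v e3). split; [|split].
- unfold meridian. rewrite Ep in Sp. unfold p0 in Sp.
  (* The limit stays in the meridian plane, as no point of the sequence has a component along
     [e2]. *)
  assert (E0 : dot v e2 = 0).
  { pose proof (K e2) as L2. apply (is_lim_seq_ext _ (fun _ => 0)) in L2; [|intros; apply F2].
    apply is_lim_seq_unique in L2. rewrite Lim_seq_const in L2. congruence. }
  rewrite E0 in Sp. exact Sp.
- apply is_lim_seq_ext with (2 := K e1). intros n. apply F1.
- apply is_lim_seq_ext with (2 := K e3). intros n. apply F3.
Qed.

(** * The first integral and its level curves *)

Definition hyp (y W : R) : R := sqrt (y * y + W * W).

(* The first integral of the profile equation. With [a = hyp y W] the distance
   [z] to the axis in units of [1 / sqrt c] and [W] the cosine of the tangent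
   angle, [W / a] and [y / a] are the two principal curvatures divided by
   [sqrt c]. *)
Definition first_int (y W : R) : R := (y - W) * hyp y W * exp (- atan (W / y)).

Lemma hyp_pos y W : 0 < y -> 0 < hyp y W.
Proof. intros Hy. apply sqrt_lt_R0. nra. Qed.

Lemma hyp_sq y W : hyp y W * hyp y W = y * y + W * W.
Proof. apply sqrt_sqrt. nra. Qed.

Lemma is_derive_hyp (y W : R -> R) t y' W' : is_derive y t y' -> is_derive W t W' -> 0 < y t ->
  is_derive (fun s => hyp (y s) (W s)) t ((y t * y' + W t * W') / hyp (y t) (W t)).
Proof.
intros Hy HW Py. pose proof (hyp_pos _ (W t) Py) as Pa. unfold hyp at 1.
eapply is_derive_eq.
- apply (is_derive_comp_R sqrt (fun s => y s * y s + W s * W s)).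
  + apply is_derive_Reals. apply derivable_pt_lim_sqrt. nra.
  + apply is_derive_plus_R; apply is_derive_mult_R; eassumption.
- cbv beta. fold (hyp (y t) (W t)).
  field. lra.
Qed.

(** In the coefficient of [y'] the exponential contributes [y W - W ^ 2], which cancels the same
    terms coming from the other two factors and leaves a positive multiple of [y ^ 2]. This
    positivity is the source of [first_int_incr]. *)
Lemma is_derive_first_int (y W : R -> R) t y' W' : is_derive y t y' -> is_derive W t W' ->
  0 < y t ->
  is_derive (fun s => first_int (y s) (W s)) t
   (2 * exp (- atan (W t / y t)) / hyp (y t) (W t) *
     (y t * y t * y' - (hyp (y t) (W t) * hyp (y t) (W t) - y t * W t) * W')).
Proof.
intros Hy HW Py. pose proof (hyp_pos _ (W t) Py) as Pa. pose proof (hyp_sq (y t) (W t)) as Ea.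
pose proof (is_derive_hyp y W t y' W' Hy HW Py) as Da.
assert (Dq : is_derive (fun s => atan (W s / y s)) t ((W' * y t - W t * y') / (hyp (y t) (W t)
  * hyp (y t) (W t)))).
{ eapply is_derive_eq.
  - apply (is_derive_comp_R atan (fun s => W s / y s)).
    + apply is_derive_Reals. apply derivable_pt_lim_atan.
    + apply (is_derive_div W y); try eassumption. lra.
  - rewrite Ea. cbv beta. field. repeat split; nra. }
unfold first_int at 1. eapply is_derive_eq.
- apply (is_derive_mult_R (fun s => (y s - W s) * hyp (y s) (W s)) (fun s => exp (- atan (W s /
  y s)))).
  + apply is_derive_mult_R; [apply is_derive_minus_R; eassumption | exact Da].
  + apply (is_derive_comp_R exp (fun s => - atan (W s / y s))).
    * apply is_derive_Reals. apply derivable_pt_lim_exp.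
    * apply is_derive_opp_R. exact Dq.
- cbv beta.
  set (e := exp _). set (a := hyp (y t) (W t)) in *.
  apply Rmult_eq_reg_r with a; [|lra].
  transitivity (e * ((y' - W') * (a * a) + (y t - W t) * (y t * y' + W t * W') - (y t - W t) *
    (W' * y t - W t * y'))).
  + field. lra.
  + rewrite Ea. field. lra.
Qed.

Definition first_int_y (y W : R) : R := 2 * exp (- atan (W / y)) / hyp y W * (y * y).

Lemma is_derive_first_int_y y W : 0 < y ->
  is_derive (fun y => first_int y W) y (first_int_y y W).
Proof.
intros Py. eapply is_derive_eq.
- apply (is_derive_first_int (fun y => y) (fun _ => W)); trivial;
  [apply is_derive_id_R | apply is_derive_const_R].
- unfold first_int_y, one, zero; simpl. ring.
Qed.

Lemma first_int_y_pos y W : 0 < y -> 0 < first_int_y y W.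
Proof.
intros Py. pose proof (hyp_pos y W Py). unfold first_int_y. apply Rmult_lt_0_compat; [|nra].
apply Rdiv_lt_0_compat; trivial. pose proof (exp_pos (- atan (W / y))). lra.
Qed.

(** The intermediate point is kept because [Y_derive] has to follow it as the angle varies. *)
Lemma first_int_MVT y1 y2 W : 0 < y1 -> 0 < y2 ->
  exists c, Rmin y1 y2 <= c <= Rmax y1 y2 /\
    first_int y2 W - first_int y1 W = first_int_y c W * (y2 - y1).
Proof.
intros P1 P2. assert (0 < Rmin y1 y2) by now apply Rmin_pos.
apply (MVT_gen (fun y => first_int y W) y1 y2 (fun y => first_int_y y W)).
- intros y Hy. apply is_derive_first_int_y. lra.
- intros y Hy. apply continuity_pt_filterlim.
  apply (ex_derive_continuous (fun y => first_int y W)).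
  eexists. apply is_derive_first_int_y. lra.
Qed.

Lemma first_int_incr y1 y2 W : 0 < y1 -> y1 < y2 -> first_int y1 W < first_int y2 W.
Proof.
intros P1 P2. destruct (first_int_MVT y1 y2 W) as (c & Hc & E); try lra.
rewrite Rmin_left in Hc by lra. pose proof (first_int_y_pos c W ltac:(lra)). nra.
Qed.

Lemma first_int_inj y1 y2 W : 0 < y1 -> 0 < y2 -> first_int y1 W = first_int y2 W -> y1 = y2.
Proof.
intros P1 P2 E. destruct (Rtotal_order y1 y2) as [L|[L|L]]; trivial.
- pose proof (first_int_incr y1 y2 W P1 L). lra.
- pose proof (first_int_incr y2 y1 W P2 L). lra.
Qed.

(* The limit of [first_int y W] as [y] tends to [0] from above. *)
Definition first_int0 (W : R) : R :=
  if Rle_dec 0 W then - (W * W) * exp (- (PI / 2)) else W * W * exp (PI / 2).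

(** With [s] equal to [- PI / 2] for [W > 0] and [PI / 2] for [W < 0], replacing [- atan (W / y)] by
    [s + atan (y / W)] gives the same function for [y > 0] in a form that is smooth across [y = 0].
    Limits at 0 become values. *)
Definition first_int_ext (s y W : R) : R := (y - W) * hyp y W * exp (s + atan (y / W)).

Lemma first_int_extE y W : 0 < y -> W <> 0 ->
  first_int y W = first_int_ext (if Rle_dec 0 W then - (PI / 2) else PI / 2) y W.
Proof.
intros Py W0. unfold first_int, first_int_ext. do 2 f_equal.
destruct (Rle_dec 0 W) as [P|P].
- replace (W / y) with (/ (y / W)) by (field; lra).
  rewrite atan_inv; [ring | apply Rdiv_lt_0_compat; lra].
- replace (W / y) with (- / (y / - W)) by (field; lra).
  rewrite atan_opp, atan_inv; [|apply Rdiv_lt_0_compat; lra].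
  replace (y / - W) with (- (y / W)) by (field; lra). rewrite atan_opp. ring.
Qed.

Lemma first_int_ext_0 W : W <> 0 ->
  first_int_ext (if Rle_dec 0 W then - (PI / 2) else PI / 2) 0 W = first_int0 W.
Proof.
intros W0. unfold first_int_ext, first_int0, hyp. replace (0 / W) with 0 by (field; trivial).
  rewrite atan_0, Rplus_0_r.
replace (0 * 0 + W * W) with (W * W) by ring.
destruct (Rle_dec 0 W) as [P|P].
- rewrite sqrt_square by lra. ring.
- replace (W * W) with ((- W) * (- W)) at 1 by ring. rewrite sqrt_square by lra. ring.
Qed.

Lemma is_derive_first_int_ext s y W : W <> 0 ->
  is_derive (fun y => first_int_ext s y W) y (2 * exp (s + atan (y / W)) / hyp y W * (y * y)).
Proof.
intros W0. assert (P : 0 < y * y + W * W) by nra.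
assert (Pa : 0 < hyp y W) by (apply sqrt_lt_R0; trivial). pose proof (hyp_sq y W) as Ea.
unfold first_int_ext, hyp. auto_derive; [repeat split; trivial|].
fold (hyp y W). unfold Rsqr. set (e := exp _). set (a := hyp y W) in *.
replace (/ (1 + (y * / W) * ((y * / W) * 1)) ) with (W * W / (a * a)) by (rewrite Ea; field;
  split; trivial; nra).
apply Rmult_eq_reg_r with a; [|lra].
transitivity (e * (a * a + (y - W) * y + (y - W) * W)).
- field. split; trivial; lra.
- rewrite Ea. field. lra.
Qed.

Lemma first_int_at_0 y : 0 < y -> first_int y 0 = y * y.
Proof.
intros Py. unfold first_int, hyp. replace (0 / y) with 0 by (field; lra).
  rewrite atan_0, Ropp_0, exp_0.
replace (y * y + 0 * 0) with (y * y) by ring. rewrite sqrt_square by lra. ring.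
Qed.

Lemma first_int0_at_0 : first_int0 0 = 0.
Proof. unfold first_int0. destruct (Rle_dec 0 0); lra. Qed.

Lemma first_int0_lt y W : 0 < y -> first_int0 W < first_int y W.
Proof.
intros Py. destruct (Req_dec W 0) as [-> | W0].
- rewrite first_int0_at_0, first_int_at_0 by trivial. nra.
(* From 0 to [y / 2] the mean value theorem only yields a weak inequality, as the derivative
   vanishes at 0; the strict one comes from [y / 2] to [y]. *)
- apply Rle_lt_trans with (first_int (y / 2) W); [|apply first_int_incr; lra].
  rewrite first_int_extE, <- (first_int_ext_0 W) by (trivial; lra).
    set (s := if Rle_dec 0 W then _ else _).
  destruct (MVT_gen (fun y => first_int_ext s y W) 0 (y / 2) (fun y => 2 * exp (s + atan (y /
    W)) / hyp y W * (y * y))) as (c & Hc & E).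
  + intros x _. now apply is_derive_first_int_ext.
  + intros x _. apply continuity_pt_filterlim.
    apply (ex_derive_continuous (fun y => first_int_ext s y W)). eexists.
    now apply is_derive_first_int_ext.
  + assert (0 <= 2 * exp (s + atan (c / W)) / hyp c W * (c * c)).
    { apply Rmult_le_pos; [|nra]. left.
      apply Rdiv_lt_0_compat; [pose proof (exp_pos (s + atan (c / W))); lra | apply sqrt_lt_R0;
      nra]. }
    nra.
Qed.

Lemma first_int_large K W : -1 <= W <= 1 -> exists y, 0 < y /\ K < first_int y W.
Proof.
(* The three factors are at least [1], [y] and [exp (- (PI / 2))], and for this [y] the product of
   these bounds is [Rabs K + 2 * exp (- (PI / 2))]. *)
intros HW. exists (2 + Rabs K * exp (PI / 2)).
pose proof (Rabs_pos K) as PK. pose proof (exp_pos (PI / 2)) as Pe. set (y := 2 + _).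
assert (Py : 2 <= y) by (unfold y; nra). split; [lra|].
assert (Pa : y <= hyp y W). { unfold hyp. rewrite <- (sqrt_square y) at 1 by lra.
  apply sqrt_le_1_alt. nra. }
assert (Pat : exp (- (PI / 2)) <= exp (- atan (W / y))).
{ left. apply exp_increasing. pose proof (atan_bound (W / y)). lra. }
pose proof (exp_pos (- (PI / 2))) as Pe'.
assert (E : exp (PI / 2) * exp (- (PI / 2)) = 1) by (rewrite <- exp_plus, Rplus_opp_r;
  apply exp_0).
unfold first_int. apply Rle_lt_trans with (Rabs K); [apply Rle_abs|].
apply Rlt_le_trans with (y * exp (- (PI / 2))).
- unfold y. rewrite Rmult_plus_distr_r, Rmult_assoc, E. lra.
- apply Rmult_le_compat; try lra. nra.
Qed.

Lemma first_int_solve K W : -1 <= W <= 1 -> first_int0 W < K -> exists y,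
  0 < y /\ first_int y W = K.
Proof.
intros HW HK. destruct (first_int_large K W HW) as (M & PM & HM).
(* [first_int_ext] divides by [W]; for [W = 0] the first integral is just [y * y]. *)
destruct (Req_dec W 0) as [-> | W0].
- rewrite first_int0_at_0 in HK. exists (sqrt K). assert (P := sqrt_lt_R0 K HK).
  split; trivial. rewrite first_int_at_0 by trivial. apply sqrt_sqrt; lra.
- set (s := if Rle_dec 0 W then - (PI / 2) else PI / 2).
  destruct (IVT_gen_consistent (fun y => first_int_ext s y W) 0 M K) as (y & Hy & E).
  + intros y. apply (ex_derive_continuous (fun y => first_int_ext s y W)). eexists.
    now apply is_derive_first_int_ext.
  + unfold s. rewrite first_int_ext_0, <- first_int_extE by trivial.
    rewrite Rmin_left, Rmax_right; lra.
  + rewrite Rmin_left, Rmax_right in Hy by lra.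
    assert (y <> 0). { intros ->. unfold s in E. rewrite first_int_ext_0 in E by trivial. lra. }
    exists y. split; [lra|]. rewrite first_int_extE by (trivial; lra). exact E.
Qed.

(** Combined with the monotonicity of the cosine, this makes the angles available on a level an
    interval symmetric about 0, as worked out in [level_domain]. *)
Lemma first_int0_decr W1 W2 : W1 < W2 -> first_int0 W2 < first_int0 W1.
Proof.
intros L. unfold first_int0. pose proof (exp_pos (- (PI / 2))). pose proof (exp_pos (PI / 2)).
destruct (Rle_dec 0 W2) as [P2|P2], (Rle_dec 0 W1) as [P1|P1]; try lra.
- assert (W1 * W1 < W2 * W2) by nra. nra.
- assert (0 < W1 * W1) by nra.
  assert (0 < W1 * W1 * exp (PI / 2)) by now apply Rmult_lt_0_compat.
  assert (0 <= W2 * W2 * exp (- (PI / 2))) by (apply Rmult_le_pos; nra). lra.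
- assert (W2 * W2 < W1 * W1) by nra. nra.
Qed.

(** The factor [c] need only be continuous, since its increment is multiplied by [f], which is 0 at
    [t]. In [Y_derive] the second factor contains an intermediate point, of which nothing beyond
    continuity is known. *)
Lemma is_derive_mult_vanish (f c : R -> R) t l : is_derive f t l -> f t = 0 -> continuous c t ->
  is_derive (fun s => f s * c s) t (l * c t).
Proof.
intros Hf f0 Hc. apply is_derive_of_bound. intros eps He.
set (M := Rabs (c t) + 1). pose proof (Rabs_pos (c t)) as Pc.
set (N := Rabs l + 1). pose proof (Rabs_pos l) as Pl.
destruct (is_derive_bound f t l Hf (eps / (2 * M))) as (d1' & Pd1 & B1);
  [apply Rdiv_lt_0_compat; unfold M; lra|].
assert (Pe : 0 < Rmin 1 (eps / (2 * N))) by (apply Rmin_pos; [lra | apply Rdiv_lt_0_compat;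
  unfold N; lra]).
pose proof (proj1 (filterlim_locally _ _) Hc (mkposreal _ Pe)) as [d2' B2].
exists (Rmin d1' d2'). split; [apply Rmin_pos; [trivial | apply cond_pos]|].
intros h Hh. pose proof (Rmin_l d1' d2'). pose proof (Rmin_r d1' d2').
specialize (B1 h ltac:(lra)). specialize (B2 (t + h)).
assert (B2' : Rabs (c (t + h) - c t) < Rmin 1 (eps / (2 * N))).
{ apply B2. change (Rabs (t + h - t) < d2'). replace (t + h - t) with h by ring. lra. }
pose proof (Rmin_l 1 (eps / (2 * N))). pose proof (Rmin_r 1 (eps / (2 * N))).
rewrite f0 in *.
replace (f (t + h) * c (t + h) - 0 * c t - h * (l * c t)) with ((f (t + h) - 0 - h * l) * c (t
  + h) + h * (l * (c (t + h) - c t))) by ring.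
eapply Rle_trans; [apply Rabs_triang|]. rewrite !Rabs_mult.
assert (C1 : Rabs (c (t + h)) <= M).
{ unfold M. replace (c (t + h)) with (c (t + h) - c t + c t) by ring.
  eapply Rle_trans; [apply Rabs_triang|]. lra. }
pose proof (Rabs_pos h) as Ph. pose proof (Rabs_pos (f (t + h) - 0 - h * l)) as Pf.
assert (X1 : Rabs (f (t + h) - 0 - h * l) * Rabs (c (t + h)) <= eps / 2 * Rabs h).
{ apply Rle_trans with (eps / (2 * M) * Rabs h * M).
  - apply Rmult_le_compat; trivial; apply Rabs_pos.
  - right. field. unfold M. lra. }
assert (X2 : Rabs l * Rabs (c (t + h) - c t) <= eps / 2).
{ apply Rle_trans with (N * (eps / (2 * N))).
  - apply Rmult_le_compat; try apply Rabs_pos; unfold N in *; lra.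
  - right. field. unfold N. lra. }
nra.
Qed.

Lemma continuous_bound (f : R -> R) t : continuous f t <->
  forall eps, 0 < eps -> exists d, 0 < d /\ forall s,
    Rabs (s - t) < d -> Rabs (f s - f t) < eps.
Proof.
split.
- intros Hf eps He. pose proof (proj1 (filterlim_locally _ _) Hf (mkposreal _ He)) as [d B].
  exists d. split; [apply cond_pos|]. intros s Hs. now apply B.
- intros Hf. apply filterlim_locally. intros eps.
  destruct (Hf eps (cond_pos eps)) as (d & Pd & B).
  exists (mkposreal d Pd). intros s Hs. now apply B.
Qed.

(* The level set [first_int = K] as a graph over the tangent angle [s]. *)
Definition level_curve (K : R) (Y : R -> R) : Prop :=
  forall s, first_int0 (cos s) < K -> 0 < Y s /\ first_int (Y s) (cos s) = K.

Lemma level_curve_exists K : exists Y, level_curve K Y.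
Proof.
assert (E : forall s, exists y, first_int0 (cos s) < K -> 0 < y /\ first_int y (cos s) = K).
{ intros s. destruct (Rlt_dec (first_int0 (cos s)) K) as [L|L].
  - destruct (first_int_solve K (cos s) (COS_bound s) L) as (y & Hy). now exists y.
  - exists 0. intros L'. contradiction. }
exists (fun s => proj1_sig (constructive_indefinite_description _ (E s))). intros s.
destruct (constructive_indefinite_description _ (E s)) as [y Hy]. exact Hy.
Qed.

Lemma Hcos_derive y s : 0 < y -> is_derive (fun s => first_int y (cos s)) s
  (2 * exp (- atan (cos s / y)) / hyp y (cos s) * ((hyp y (cos s) * hyp y (cos s) - y * cos s)
    * sin s)).
Proof.
intros Py. eapply is_derive_eq.
- apply (is_derive_first_int (fun _ => y) cos s 0 (- sin s)); trivial;
  [apply is_derive_const_R | apply is_derive_cos].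
- ring.
Qed.

(** Half of [Y s] serves as a barrier: [first_int (Y s / 2)] is below [K] at the angle [s], by
    continuity also nearby, and it dominates [first_int0]. *)
Lemma Y_locally K Y s : level_curve K Y -> first_int0 (cos s) < K ->
  locally s (fun r => first_int0 (cos r) < K).
Proof.
intros HY Hs. destruct (HY s Hs) as (PY & EY).
assert (L : first_int (Y s / 2) (cos s) < K) by (rewrite <- EY; apply first_int_incr; lra).
assert (C : continuous (fun r => first_int (Y s / 2) (cos r)) s).
{ apply (ex_derive_continuous (fun r => first_int (Y s / 2) (cos r))). eexists.
  apply Hcos_derive. lra. }
apply filter_imp with (P := fun r => first_int (Y s / 2) (cos r) < K).
- intros r Hr. apply Rlt_trans with (2 := Hr). apply first_int0_lt. lra.
- apply (C (fun v => v < K)). now apply (open_lt K).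
Qed.

(** The inequalities between [first_int] and [K] at [Y s - e] and [Y s + e] persist for nearby
    angles, and monotonicity traps [Y r] between these values. *)
Lemma Y_continuous K Y s : level_curve K Y -> first_int0 (cos s) < K -> continuous Y s.
Proof.
intros HY Hs. destruct (HY s Hs) as (PY & EY). apply filterlim_locally. intros eps.
set (e := Rmin (eps / 2) (Y s / 2)).
assert (Pe : 0 < e) by (apply Rmin_pos; destruct eps; simpl; lra).
assert (e1 : e <= eps / 2) by apply Rmin_l. assert (e2 : e <= Y s / 2) by apply Rmin_r.
assert (C : forall y, 0 < y -> continuous (fun r => first_int y (cos r)) s).
{ intros y Py. apply (ex_derive_continuous (fun r => first_int y (cos r))). eexists.
  now apply Hcos_derive. }
assert (L1 : first_int (Y s - e) (cos s) < K) by (rewrite <- EY; apply first_int_incr; lra).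
assert (L2 : K < first_int (Y s + e) (cos s)) by (rewrite <- EY; apply first_int_incr; lra).
pose proof (C (Y s - e) ltac:(lra) (fun v => v < K) (open_lt K _ L1)) as M1.
pose proof (C (Y s + e) ltac:(lra) (fun v => K < v) (open_gt K _ L2)) as M2.
unfold filtermap in M1, M2.
apply filter_imp with (2 := filter_and _ _ (Y_locally K Y s HY Hs) (filter_and (F := locally s)
  _ _ M1 M2)).
intros r (Hr & N1 & N2). destruct (HY r Hr) as (PYr & EYr). rewrite <- EYr in N1, N2.
change (Rabs (Y r - Y s) < eps). apply Rabs_def1.
- apply Rnot_le_lt. intros Q'.
  destruct (Req_dec (Y s + e) (Y r)) as [E|E]; [rewrite E in N2; lra|].
  pose proof (first_int_incr (Y s + e) (Y r) (cos r)). destruct eps; simpl in *. lra.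
- apply Rnot_le_lt. intros Q'.
  destruct (Req_dec (Y s - e) (Y r)) as [E|E]; [rewrite E in N1; lra|].
  pose proof (first_int_incr (Y r) (Y s - e) (cos r)). destruct eps; simpl in *. lra.
Qed.

(** [refA] and [refX] are the coordinates of the reference curve of a level, the distance to the
    axis and the position along it, in units of [1 / sqrt c] and parametrized by the tangent
    angle. *)
Definition refA (Y : R -> R) (s : R) : R := hyp (Y s) (cos s).

(** An implicit function argument: the mean value theorem in [y] at the angle [r] gives [Y r - Y s]
    as [K - first_int (Y s) (cos r)] divided by the partial derivative at some [xi r] between [Y s]
    and [Y r]. The numerator is differentiable and vanishes at [r = s], the denominator is
    continuous there, and [is_derive_mult_vanish] concludes. *)
Lemma Y_derive K Y s : level_curve K Y -> first_int0 (cos s) < K ->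
  is_derive Y s (- (refA Y s * refA Y s - Y s * cos s) * sin s / (Y s * Y s)).
Proof.
intros HY Hs. destruct (HY s Hs) as (PY & EY).
assert (X : exists xi : R -> R, forall r, first_int0 (cos r) < K ->
   Rmin (Y s) (Y r) <= xi r <= Rmax (Y s) (Y r) /\
     first_int (Y r) (cos r) - first_int (Y s) (cos r) = first_int_y (xi r) (cos r) * (Y r - Y
     s)).
{ assert (E : forall r, exists v,
  first_int0 (cos r) < K -> Rmin (Y s) (Y r) <= v <= Rmax (Y s) (Y r) /\
  first_int (Y r) (cos r) - first_int (Y s) (cos r) = first_int_y v (cos r) * (Y r - Y s)).
  { intros r. destruct (Rlt_dec (first_int0 (cos r)) K) as [L|L].
    - destruct (HY r L) as (PYr & _).
      destruct (first_int_MVT (Y s) (Y r) (cos r) PY PYr) as (v & Hv). now exists v.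
    - exists 0. intros L'. contradiction. }
  exists (fun r => proj1_sig (constructive_indefinite_description _ (E r))). intros r.
  destruct (constructive_indefinite_description _ (E r)) as [v Hv]. exact Hv. }
destruct X as (xi & Hxi).
assert (xis : xi s = Y s). { destruct (Hxi s Hs) as (B & _).
  rewrite Rmin_left, Rmax_left in B; lra. }
assert (CY := Y_continuous K Y s HY Hs).
assert (Cxi : continuous xi s).
{ apply continuous_bound. intros eps He.
  destruct (proj1 (continuous_bound Y s) CY eps He) as (d & Pd & B).
  destruct (Y_locally K Y s HY Hs) as [d' B']. exists (Rmin d d').
    split; [apply Rmin_pos; [trivial | apply cond_pos]|].
  intros r Hr. pose proof (Rmin_l d d'). pose proof (Rmin_r d d'). specialize (B r ltac:(lra)).
  assert (Kr : first_int0 (cos r) < K) by (apply B'; change (Rabs (r - s) < d'); lra).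
  destruct (Hxi r Kr) as (Bx & _). rewrite xis. apply Rabs_def2 in B.
  unfold Rmin, Rmax in Bx. apply Rabs_def1; destruct (Rle_dec (Y s) (Y r)); lra. }
set (c := fun r => - / first_int_y (xi r) (cos r)).
assert (Cc : continuous c s).
{ assert (Pxi : 0 < xi s) by lra.
  assert (Phyp : 0 < hyp (xi s) (cos s)) by now apply hyp_pos.
  assert (Ccos : continuous cos s) by (apply (ex_derive_continuous cos); auto_derive; trivial).
  assert (C1 : continuous (fun r => xi r * xi r) s) by now apply continuous_mult_R.
  assert (C2 : continuous (fun r => hyp (xi r) (cos r)) s).
  { apply (continuous_comp (fun r => xi r * xi r + cos r * cos r) sqrt);
    [|apply continuous_sqrt].
    apply continuous_plus_R; trivial. now apply continuous_mult_R. }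
  assert (Ci : forall g : R -> R, continuous g s -> g s <> 0 -> continuous (fun r => / g r) s).
  { intros g Cg g0. apply (continuous_comp g Rinv); trivial. now apply continuous_Rinv. }
  assert (C3 : continuous (fun r => exp (- atan (cos r / xi r))) s).
  { apply (continuous_comp (fun r => - atan (cos r / xi r)) exp).
    - apply continuous_opp_R.
      apply (continuous_comp (fun r => cos r / xi r) atan).
      + apply (continuous_mult_R cos (fun r => / xi r)); trivial. apply Ci; trivial; lra.
      + apply continuity_pt_filterlim. apply derivable_continuous_pt. apply derivable_pt_atan.
    - apply (ex_derive_continuous exp). eexists. apply is_derive_exp. }
  apply continuous_opp_R. apply Ci.
  - unfold first_int_y.
    apply (continuous_mult_R (fun r => 2 * exp (- atan (cos r / xi r)) / hyp (xi r) (cos r))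
    (fun r => xi r * xi r)); trivial.
    apply (continuous_mult_R (fun r => 2 * exp (- atan (cos r / xi r))) (fun r => / hyp (xi r)
      (cos r))).
    + apply (continuous_mult_R (fun _ => 2) (fun r => exp (- atan (cos r / xi r)))); trivial.
      apply continuous_const.
    + apply Ci; trivial; lra.
  - pose proof (first_int_y_pos (xi s) (cos s) Pxi). lra. }
assert (Df : is_derive (fun r => first_int (Y s) (cos r) - K) s (2 * exp (- atan (cos s / Y s))
  / hyp (Y s) (cos s) * ((hyp (Y s) (cos s) * hyp (Y s) (cos s) - Y s * cos s) * sin s))).
{ eapply is_derive_eq.
  - apply is_derive_minus_R; [apply Hcos_derive; trivial | apply is_derive_const_R].
  - cbv beta. ring. }
pose proof (is_derive_mult_vanish _ c s _ Df ltac:(cbv beta; lra) Cc) as D.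
apply is_derive_ext_loc with (fun r => Y s + (first_int (Y s) (cos r) - K) * c r).
- apply filter_imp with (2 := Y_locally K Y s HY Hs). intros r Hr.
  destruct (HY r Hr) as (PYr & EYr). destruct (Hxi r Hr) as (Bx & Ex). rewrite EYr in Ex.
  assert (Px : 0 < xi r) by (pose proof (Rmin_pos _ _ PY PYr); lra).
  pose proof (first_int_y_pos (xi r) (cos r) Px) as PH. unfold c.
  match goal with |- @eq _ ?p ?q => change (@eq R p q) end.
  replace (first_int (Y s) (cos r) - K) with (- (first_int_y (xi r) (cos r) * (Y r - Y s))) by
    lra. field. lra.
- eapply is_derive_eq.
  + apply (is_derive_plus_R (fun _ => Y s)); [apply is_derive_const_R | exact D].
  + cbv beta. unfold c, first_int_y, refA. rewrite xis.
    pose proof (hyp_pos (Y s) (cos s) PY). pose proof (exp_pos (- atan (cos s / Y s))). field.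
      lra.
Qed.

Lemma refA_pos K Y s : level_curve K Y -> first_int0 (cos s) < K -> 0 < refA Y s.
Proof. intros HY Hs. apply hyp_pos. now apply (HY s). Qed.

Lemma refA_derive K Y s : level_curve K Y -> first_int0 (cos s) < K ->
  is_derive (refA Y) s (- sin s * refA Y s / Y s).
Proof.
intros HY Hs. pose proof (refA_pos K Y s HY Hs) as PA. destruct (HY s Hs) as (PY & EY).
pose proof (hyp_sq (Y s) (cos s)) as EA. fold (refA Y s) in EA.
eapply is_derive_eq.
- apply (is_derive_hyp Y cos s _ _ (Y_derive K Y s HY Hs) (is_derive_cos s) PY).
- fold (refA Y s). apply Rmult_eq_reg_r with (refA Y s); [|lra]. field_simplify; [|lra|lra].
  replace (refA Y s ^ 2) with (Y s * Y s + cos s * cos s) by (rewrite <- EA; ring). field. lra.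
Qed.

Lemma refA_continuous K Y s : level_curve K Y -> first_int0 (cos s) < K ->
  continuous (refA Y) s.
Proof. intros HY Hs. apply (ex_derive_continuous (refA Y)). eexists. now apply (refA_derive K).
  Qed.

(** In units of [sqrt c] the meridian has curvature [Y / refA], so an angle [dr] corresponds to the
    length [refA / Y dr], whose component along the axis is [cos r] times as large. *)
Definition refX (Y : R -> R) (s : R) : R := RInt (fun r => cos r * refA Y r / Y r) 0 s.

Lemma refX_integrand_continuous K Y s : level_curve K Y -> first_int0 (cos s) < K ->
  continuous (fun r => cos r * refA Y r / Y r) s.
Proof.
intros HY Hs. destruct (HY s Hs) as (PY & _).
apply (continuous_mult_R (fun r => cos r * refA Y r) (fun r => / Y r)).
- apply (continuous_mult_R cos (refA Y)); [|now apply (refA_continuous K)].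
  apply (ex_derive_continuous cos). auto_derive. trivial.
- apply (continuous_comp Y Rinv); [now apply (Y_continuous K)|]. apply continuous_Rinv. lra.
Qed.

Lemma refX_derive K Y d s : level_curve K Y -> (forall r,
  Rabs r < d -> first_int0 (cos r) < K) -> Rabs s < d ->
  is_derive (refX Y) s (cos s * refA Y s / Y s).
Proof.
intros HY Hd Hs. apply (is_derive_RInt (V := R_NormedModule) (fun r => cos r * refA Y r / Y r)
  (refX Y) 0 s).
- assert (P : 0 < d - Rabs s) by lra. exists (mkposreal _ P). intros r Hr.
  change (Rabs (r - s) < d - Rabs s) in Hr.
  assert (Lr : Rabs r < d). { replace r with (r - s + s) by ring.
    eapply Rle_lt_trans; [apply Rabs_triang|]. lra. }
  apply (RInt_correct (V := R_CompleteNormedModule)).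
    apply (ex_RInt_continuous (V := R_CompleteNormedModule)).
  intros q Hq. apply (refX_integrand_continuous K); trivial. apply Hd.
  unfold Rmin, Rmax in Hq. apply Rabs_def2 in Lr. apply Rabs_def1; destruct (Rle_dec 0 r); lra.
- apply (refX_integrand_continuous K); auto.
Qed.

(** The angle enters through its cosine only, and [Y] is the unique positive solution. *)
Lemma level_curve_even K Y s : level_curve K Y -> first_int0 (cos s) < K -> Y (- s) = Y s.
Proof.
intros HY Hs. assert (Hs' : first_int0 (cos (- s)) < K) by now rewrite cos_neg.
destruct (HY s Hs) as (P1 & E1). destruct (HY (- s) Hs') as (P2 & E2). rewrite cos_neg in E2.
apply first_int_inj with (cos s); congruence.
Qed.

Lemma refX_0 Y : refX Y 0 = 0.
Proof. unfold refX. apply (RInt_point (V := R_CompleteNormedModule)). Qed.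

Lemma derive_0_const (f : R -> R) a b : a <= b -> (forall t,
  a <= t <= b -> is_derive f t 0) -> f b = f a.
Proof.
intros Hab D. destruct (MVT_gen f a b (fun _ => 0)) as (c & _ & E).
- intros x Hx. rewrite Rmin_left, Rmax_right in Hx by lra. apply D. lra.
- intros x Hx. rewrite Rmin_left, Rmax_right in Hx by lra. apply continuity_pt_filterlim.
  apply (ex_derive_continuous f). eexists. apply D. lra.
- lra.
Qed.

Lemma refX_odd K Y d s : level_curve K Y -> (forall r,
  Rabs r < d -> first_int0 (cos r) < K) -> 0 <= s < d ->
  refX Y (- s) = - refX Y s.
Proof.
intros HY Hd Hs.
assert (E : refX Y s + refX Y (- s) = refX Y 0 + refX Y (- 0)).
{ apply (derive_0_const (fun r => refX Y r + refX Y (- r)) 0 s); [lra|]. intros t Ht.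
  assert (T1 : Rabs t < d) by (apply Rabs_def1; lra).
    assert (T2 : Rabs (- t) < d) by (rewrite Rabs_Ropp; trivial).
  eapply is_derive_eq.
  - apply (is_derive_plus_R (refX Y) (fun r => refX Y (- r))).
    + apply (refX_derive K Y d); trivial.
    + apply (is_derive_comp_R (refX Y) Ropp); [apply (refX_derive K Y d); trivial|].
      apply (is_derive_opp_R (fun r => r)). apply is_derive_id_R.
  - cbv beta. unfold refA. rewrite cos_neg, (level_curve_even K Y t HY (Hd t T1)). unfold Rdiv.
    ring. }
rewrite Ropp_0, refX_0 in E. lra.
Qed.

(* The curvature is smaller where [cos < 0], so that before the angle [PI] the
   reference curve travels further backwards than forwards and crosses its
   mirror image. *)
Lemma refX_crossing K Y d : level_curve K Y -> (forall r,
  Rabs r < d -> first_int0 (cos r) < K) -> PI <= d ->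
  exists s, PI / 2 < s < PI /\ refX Y s = 0.
Proof.
intros HY Hd Hpi. pose proof PI_RGT_0 as PP.
assert (Dd : forall s, 0 <= s < PI -> is_derive (refX Y) s (cos s * refA Y s / Y s)).
{ intros s Hs. apply (refX_derive K Y d); trivial. apply Rabs_def1; lra. }
assert (Cd : forall s, 0 <= s < PI -> continuous (refX Y) s) by (intros s Hs;
  apply (ex_derive_continuous (refX Y)); eexists; now apply Dd).
assert (cmp : forall s, 0 < s < PI / 2 ->
  cos s * refA Y s / Y s + cos (PI - s) * refA Y (PI - s) / Y (PI - s) < 0).
{ intros s Hs. assert (Pc : 0 < cos s) by (apply cos_gt_0; lra).
  destruct (HY s (Hd s ltac:(apply Rabs_def1; lra))) as (P1 & E1).
  destruct (HY (PI - s) (Hd (PI - s) ltac:(apply Rabs_def1; lra))) as (P2 & E2).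
  unfold refA. assert (Ec : cos (PI - s) = - cos s) by (rewrite cos_minus, cos_PI, sin_PI;
    ring).
  rewrite Ec in *. set (y1 := Y s) in *. set (y2 := Y (PI - s)) in *. set (c := cos s) in *.
  (* Changing [c] into [- c] increases both [y - W] and the exponential, so the level [K] is reached
     at a smaller [y]. *)
  assert (L : y2 < y1).
  { apply Rnot_le_lt. intros L.
    assert (L1 : first_int y1 c <= first_int y2 c).
      { destruct L as [L | ->]; [left; now apply first_int_incr | lra]. }
    assert (L2 : first_int y2 c < first_int y2 (- c)).
    { unfold first_int. assert (Eh : hyp y2 (- c) = hyp y2 c) by (unfold hyp; f_equal; ring).
      rewrite Eh.
      assert (Ph := hyp_pos y2 c P2).
      assert (Ex : exp (- atan (c / y2)) < exp (- atan (- c / y2))).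
      { apply exp_increasing. replace (- c / y2) with (- (c / y2)) by (field; lra).
        rewrite atan_opp.
        assert (0 < atan (c / y2)). { rewrite <- atan_0. apply atan_increasing.
          apply Rdiv_lt_0_compat; lra. } lra. }
      pose proof (exp_pos (- atan (c / y2))).
      apply Rle_lt_trans with ((y2 - - c) * hyp y2 c * exp (- atan (c / y2))).
      - apply Rmult_le_compat_r; [lra|]. apply Rmult_le_compat_r; lra.
      - apply Rmult_lt_compat_l; trivial. apply Rmult_lt_0_compat; lra. }
    lra. }
  pose proof (hyp_pos y1 c P1) as Ph1. pose proof (hyp_pos y2 (- c) P2) as Ph2.
  pose proof (hyp_sq y1 c) as Q1. pose proof (hyp_sq y2 (- c)) as Q2.
  set (a1 := hyp y1 c) in *. set (a2 := hyp y2 (- c)) in *.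
  assert (K1 : a1 * y2 < a2 * y1).
  { apply Rsqr_incrst_0; try (apply Rmult_le_pos; lra). unfold Rsqr.
    replace (a1 * y2 * (a1 * y2)) with (a1 * a1 * (y2 * y2)) by ring.
    replace (a2 * y1 * (a2 * y1)) with (a2 * a2 * (y1 * y1)) by ring. rewrite Q1, Q2.
    assert (y2 * y2 < y1 * y1) by nra. assert (0 < c * c) by nra. nra. }
  replace (c * a1 / y1 + - c * a2 / y2) with (- (c * (a2 * y1 - a1 * y2) / (y1 * y2))) by
    (field; lra).
  assert (0 < c * (a2 * y1 - a1 * y2) / (y1 * y2)) by (apply Rdiv_lt_0_compat;
    apply Rmult_lt_0_compat; lra). lra. }
(* By [cmp] the function [B] increases up to the value 0 at [PI / 2], so it is negative before. As
   [PI] may lie outside the domain, the sign of [refX] is read off at [PI - s0], with [s0] so small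
   that [refX Y s0] is below [- B (PI / 4)]. *)
set (B := fun s => refX Y (PI - s) - refX Y s).
assert (DB : forall s, 0 < s <= PI / 2 ->
  is_derive B s (- (cos (PI - s) * refA Y (PI - s) / Y (PI - s)) - cos s * refA Y s / Y s)).
{ intros s Hs. eapply is_derive_eq.
  - apply (is_derive_minus_R (fun s => refX Y (PI - s)) (refX Y)); [|apply Dd; lra].
    apply (is_derive_comp_R (refX Y) (fun s => PI - s)); [apply Dd; lra|].
    apply (is_derive_minus_R (fun _ => PI) (fun s => s));
      [apply is_derive_const_R | apply is_derive_id_R].
  - cbv beta. ring. }
assert (Binc : forall s1 s2, 0 < s1 -> s1 < s2 -> s2 <= PI / 2 -> B s1 < B s2).
{ intros s1 s2 H1 H2 H3.
  (* [cmp] is available only before [PI / 2]; the end point is then reached through a midpoint, with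
     a weak inequality on the second half. *)
  assert (Aux : forall s1 s2, 0 < s1 -> s1 < s2 -> s2 < PI / 2 -> B s1 < B s2).
  { clear s1 s2 H1 H2 H3. intros s1 s2 H1 H2 H3.
    destruct (MVT_gen B s1 s2 (fun s => - (cos (PI - s) * refA Y (PI - s) / Y (PI - s)) - cos s
      * refA Y s / Y s)) as (c & Hc & E).
    - intros x Hx. rewrite Rmin_left, Rmax_right in Hx by lra. apply DB. lra.
    - intros x Hx. rewrite Rmin_left, Rmax_right in Hx by lra. apply continuity_pt_filterlim.
      apply (ex_derive_continuous B). eexists. apply DB. lra.
    - rewrite Rmin_left, Rmax_right in Hc by lra. pose proof (cmp c ltac:(lra)). nra. }
  destruct (Rlt_dec s2 (PI / 2)) as [L|L]; [now apply Aux|].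
  apply Rlt_le_trans with (B ((s1 + s2) / 2)); [apply Aux; lra|].
  destruct (MVT_gen B ((s1 + s2) / 2) s2 (fun s => - (cos (PI - s) * refA Y (PI - s) / Y (PI -
    s)) - cos s * refA Y s / Y s)) as (c & Hc & E).
  - intros x Hx. rewrite Rmin_left, Rmax_right in Hx by lra. apply DB. lra.
  - intros x Hx. rewrite Rmin_left, Rmax_right in Hx by lra. apply continuity_pt_filterlim.
    apply (ex_derive_continuous B). eexists. apply DB. lra.
  - rewrite Rmin_left, Rmax_right in Hc by lra.
    assert (- (cos (PI - c) * refA Y (PI - c) / Y (PI - c)) - cos c * refA Y c / Y c >= 0);
      [|nra].
    destruct (Rlt_dec c (PI / 2)) as [Lc|Lc]; [pose proof (cmp c ltac:(lra)); lra|].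
    assert (Ec : c = PI / 2) by lra. rewrite Ec. replace (PI - PI / 2) with (PI / 2) by field.
      rewrite cos_PI2. unfold Rdiv. lra. }
assert (B0 : B (PI / 2) = 0) by (unfold B; replace (PI - PI / 2) with (PI / 2) by field; ring).
assert (B1 : B (PI / 4) < 0) by (rewrite <- B0; apply Binc; lra).
destruct (proj1 (continuous_bound (refX Y) 0) (Cd 0 ltac:(lra)) (- B (PI / 4)) ltac:(lra)) as
  (e & Pe & Ce).
set (s0 := Rmin (e / 2) (PI / 8)).
assert (Ps0 : 0 < s0) by (apply Rmin_pos; lra).
assert (s0 <= e / 2) by apply Rmin_l. assert (s0 <= PI / 8) by apply Rmin_r.
assert (Q : refX Y (PI - s0) < 0).
{ specialize (Ce s0 ltac:(rewrite Rminus_0_r, Rabs_pos_eq; lra)).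
  rewrite refX_0, Rminus_0_r in Ce. apply Rabs_def2 in Ce.
  pose proof (Binc s0 (PI / 4) Ps0 ltac:(lra) ltac:(lra)) as BB. unfold B in BB at 1. lra. }
assert (P : 0 < refX Y (PI / 2)).
{ destruct (MVT_gen (refX Y) 0 (PI / 4) (fun s => cos s * refA Y s / Y s)) as (c & Hc & E).
  - intros x Hx. rewrite Rmin_left, Rmax_right in Hx by lra. apply Dd. lra.
  - intros x Hx. rewrite Rmin_left, Rmax_right in Hx by lra. apply continuity_pt_filterlim.
    apply Cd. lra.
  - rewrite Rmin_left, Rmax_right in Hc by lra. rewrite refX_0 in E.
    assert (Pd : forall s, 0 <= s <= PI / 2 -> 0 <= cos s * refA Y s / Y s).
    { intros s Hs. destruct (HY s (Hd s ltac:(apply Rabs_def1; lra))) as (P1 & _).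
      apply Rmult_le_pos; [apply Rmult_le_pos|]; [apply cos_ge_0; lra | left;
        apply (refA_pos K); trivial; apply Hd; apply Rabs_def1; lra | left;
        now apply Rinv_0_lt_compat]. }
    assert (0 < cos c * refA Y c / Y c).
    { destruct (HY c (Hd c ltac:(apply Rabs_def1; lra))) as (P1 & _).
      apply Rdiv_lt_0_compat; trivial.
        apply Rmult_lt_0_compat; [apply cos_gt_0; lra | apply (refA_pos K); trivial; apply Hd;
        apply Rabs_def1; lra]. }
    destruct (MVT_gen (refX Y) (PI / 4) (PI / 2) (fun s => cos s * refA Y s / Y s)) as (c' &
      Hc' & E').
    + intros x Hx. rewrite Rmin_left, Rmax_right in Hx by lra. apply Dd. lra.
    + intros x Hx. rewrite Rmin_left, Rmax_right in Hx by lra. apply continuity_pt_filterlim.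
      apply Cd. lra.
    + rewrite Rmin_left, Rmax_right in Hc' by lra. pose proof (Pd c' ltac:(lra)). nra. }
destruct (Ranalysis5.IVT_interv (fun s => - refX Y s) (PI / 2) (PI - s0)) as (s & Hs & E);
  try lra.
- intros s Hs. apply continuity_pt_filterlim. apply continuous_opp_R. apply Cd. lra.
- exists s. split; [|lra]. destruct Hs as [[L|L] Hs2]; [lra|]. exfalso. rewrite <- L in E. lra.
Qed.

(** The end [d] is the angle whose cosine [W] solves [first_int0 W = K]. The largest value of
    [first_int0] on [-1, 1] is [exp (PI / 2)], at [-1]; once [K] reaches it, no angle below [PI] is
    an end. *)
Lemma level_domain K s0 : - PI <= s0 <= PI -> first_int0 (cos s0) < K ->
  exists d, 0 < d /\ Rabs s0 < d /\ (forall s, Rabs s < d -> first_int0 (cos s) < K) /\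
   ((K = 0 /\ d = PI / 2) \/ (d < PI /\ d <> PI / 2 /\ first_int0 (cos d) = K) \/ PI <= d).
Proof.
intros Hs0 HK. pose proof PI_RGT_0 as PP.
assert (cosabs : forall s, cos (Rabs s) = cos s).
{ intros s. unfold Rabs. destruct (Rcase_abs s); trivial. apply cos_neg. }
assert (Hs0' : Rabs s0 <= PI) by (apply Rabs_le; lra). pose proof (Rabs_pos s0) as Ps0.
assert (G : forall W, -1 <= W < 1 -> first_int0 W = K ->
   exists d, 0 < d <= PI /\ cos d = W /\ Rabs s0 < d /\ (forall s,
     Rabs s < d -> first_int0 (cos s) < K)).
{ intros W HW EW. exists (acos W). pose proof (acos_bound W) as Bd.
  assert (cd : cos (acos W) = W) by (apply cos_acos; lra).
  assert (acos W <> 0) by (intros E; rewrite E, cos_0 in cd; lra).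
  split; [lra|]. split; trivial. split.
  - apply Rnot_le_lt. intros L. assert (L2 : cos s0 <= W).
    { rewrite <- cd, <- cosabs.
      destruct L as [L | <-]; [left; apply cos_decreasing_1; lra | lra]. }
    destruct L2 as [L' | E]; [pose proof (first_int0_decr _ _ L'); lra | rewrite E in HK; lra].
  - intros s Hs. rewrite <- EW. apply first_int0_decr. rewrite <- cd at 1.
    rewrite <- (cosabs s). pose proof (Rabs_pos s).
    apply cos_decreasing_1; lra. }
pose proof (exp_pos (PI / 2)) as Pe. pose proof (exp_pos (- (PI / 2))) as Pe'.
assert (Eee : exp (PI / 2) * exp (- (PI / 2)) = 1) by (rewrite <- exp_plus, Rplus_opp_r;
  apply exp_0).
assert (Em1 : first_int0 (-1) = exp (PI / 2)) by (unfold first_int0; destruct (Rle_dec 0 (-1));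
  lra).
destruct (Rtotal_order K (exp (PI / 2))) as [LK | [EK | LK]].
- assert (EW : exists W, -1 < W < 1 /\ first_int0 W = K).
  { destruct (Rle_lt_dec 0 K) as [PK | NK].
    - assert (PQ : 0 <= K * exp (- (PI / 2))) by (apply Rmult_le_pos; lra).
      assert (LQ : K * exp (- (PI / 2)) < 1) by (rewrite <- Eee; apply Rmult_lt_compat_r; lra).
      pose proof (sqrt_sqrt _ PQ) as SQ. pose proof (sqrt_pos (K * exp (- (PI / 2)))) as SP.
      set (r := sqrt _) in *. exists (- r). split; [nra|].
      unfold first_int0. destruct (Rle_dec 0 (- r)) as [L|L].
      + assert (r0 : r = 0) by lra. rewrite r0 in *.
        assert (Z : K * exp (- (PI / 2)) = 0) by lra.
        apply Rmult_integral in Z. destruct Z; lra.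
      + replace (- r * - r) with (r * r) by ring. rewrite SQ.
        rewrite Rmult_assoc, (Rmult_comm (exp (- (PI / 2)))), Eee. ring.
    - assert (PQ : 0 <= - K * exp (PI / 2)) by (apply Rmult_le_pos; lra).
      pose proof (sqrt_sqrt _ PQ) as SQ. pose proof (sqrt_pos (- K * exp (PI / 2))) as SP.
      set (r := sqrt _) in *. exists r.
      assert (Er : first_int0 r = K).
      { unfold first_int0. destruct (Rle_dec 0 r); [|lra].
        replace (- (r * r)) with (K * exp (PI / 2)) by lra. rewrite Rmult_assoc, Eee. ring. }
      (* A solution [r >= 1] would leave no angle on the level, but [s0] is on it. *)
      split; trivial. split; [lra|]. apply Rnot_le_lt. intros L.
      assert (L2 : cos s0 <= r) by (pose proof (COS_bound s0); lra).
      destruct L2 as [L' | E]; [pose proof (first_int0_decr _ _ L'); lra | rewrite E in HK;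
        lra]. }
  destruct EW as (W & HW & EW). destruct (G W ltac:(lra) EW) as (d & Hd & cd & L1 & L2).
  exists d. split; [lra|]. split; trivial. split; trivial.
  assert (d <> PI) by (intros E; rewrite E, cos_PI in cd; lra).
  destruct (Req_dec W 0) as [W0 | W0].
  + left. rewrite W0 in *. split; [now rewrite <- EW, first_int0_at_0|].
    apply cos_inj; [lra | lra|]. now rewrite cd, cos_PI2.
  + right; left. split; [lra|]. split; [|now rewrite cd].
    intros E. rewrite E, cos_PI2 in cd. lra.
- destruct (G (-1) ltac:(lra) ltac:(lra)) as (d & Hd & cd & L1 & L2).
  exists d. split; [lra|]. split; trivial. split; trivial. right; right.
  right. apply cos_inj; [lra | lra |]. now rewrite cd, cos_PI.
(* Every angle is available here; the bound only has to exceed [PI], hence [Rabs s0]. *)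
- exists (2 * PI). split; [lra|]. split; [lra|]. split.
  + intros s _. apply Rle_lt_trans with (2 := LK). rewrite <- Em1.
    pose proof (COS_bound s) as [C1 C2].
    destruct C1 as [C1 | <-]; [left; now apply first_int0_decr | lra].
  + right; right. lra.
Qed.

Lemma level_curve_0 Y s : level_curve 0 Y -> 0 < cos s ->
  Y s = cos s /\ refA Y s = sqrt 2 * cos s.
Proof.
intros HY Hc. assert (L : first_int0 (cos s) < 0) by (rewrite <- first_int0_at_0;
  now apply first_int0_decr).
destruct (HY s L) as (P & E).
assert (EY : Y s = cos s).
{ apply first_int_inj with (cos s); trivial. rewrite E. unfold first_int. ring. }
split; trivial. unfold refA, hyp. rewrite EY.
  replace (cos s * cos s + cos s * cos s) with (2 * (cos s * cos s)) by ring.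
rewrite sqrt_mult_alt by lra. rewrite sqrt_square; lra.
Qed.

(** * Level curves on the surface *)

Definition profile_equation (J : R -> Prop) (z rho w b : R -> R) (k : R) : Prop :=
  forall t, J t -> (b t / rho t) * (b t / rho t) + (w t / z t) * (w t / z t) = k * k.

Lemma derive_local_max (f : R -> R) t l : is_derive f t l -> locally t (fun s => f s <= f t) ->
  l = 0.
Proof.
intros D [d B]. destruct (Req_dec l 0) as [E|E]; trivial. exfalso.
assert (Pl : 0 < Rabs l) by now apply Rabs_pos_lt.
destruct (is_derive_bound f t l D (Rabs l / 2) ltac:(lra)) as (e & Pe & Be).
set (r := Rmin (e / 2) (d / 2)).
  assert (Pr : 0 < r) by (apply Rmin_pos; destruct d; simpl; lra).
assert (re : r < e) by (pose proof (Rmin_l (e / 2) (d / 2)); unfold r; lra).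
assert (rd : r < d) by (pose proof (Rmin_r (e / 2) (d / 2)); unfold r; destruct d; simpl in *;
  lra).
destruct (Rle_lt_dec 0 l) as [L|L].
- rewrite (Rabs_pos_eq l) in Be by trivial. specialize (Be r).
  rewrite (Rabs_pos_eq r) in Be by lra. specialize (Be re).
  assert (Q : f (t + r) <= f t).
  { apply B. change (Rabs (t + r - t) < d). replace (t + r - t) with r by ring.
    rewrite Rabs_pos_eq; lra. }
  apply Rabs_le_between in Be. assert (0 < l) by lra. nra.
- rewrite (Rabs_left l) in Be by trivial. specialize (Be (- r)).
  rewrite Rabs_Ropp, (Rabs_pos_eq r) in Be by lra. specialize (Be re).
  assert (Q : f (t + - r) <= f t).
  { apply B. change (Rabs (t + - r - t) < d). replace (t + - r - t) with (- r) by ring.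
    rewrite Rabs_Ropp, Rabs_pos_eq; lra. }
  apply Rabs_le_between in Be. nra.
Qed.

(** As [b] is only continuous, the equation is not differentiated. Instead [(w / z) ^ 2] is at most
    [k * k] with equality at [t], so its derivative vanishes there, and for [b t = 0] this
    derivative is a nonzero multiple of [u t]. *)
Lemma curvature_zero (J : R -> Prop) x z rho w u b k t :
  open J -> unit_tangent_data J x z rho w u b -> profile_equation J z rho w b k ->
  0 < k -> J t -> b t = 0 -> u t = 0 /\ w t * w t = k * k * (z t * z t).
Proof.
intros HJ HD HE Pk Ht Hb.
destruct (HD t Ht) as ((Pz & Pr & _) & (Dx & Dz) & (Dw & Du) & _).
assert (E : (w t / z t) * (w t / z t) = k * k).
{ rewrite <- (HE t Ht), Hb. unfold Rdiv. ring. }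
assert (E2 : w t * w t = k * k * (z t * z t)) by (rewrite <- E; field; lra).
split; trivial.
assert (D : is_derive (fun s => (w s / z s) * (w s / z s)) t (- (2 * k * k * rho t * u t / z
  t))).
{ assert (Dq : is_derive (fun s => w s / z s) t ((b t * u t * z t - w t * (rho t * u t)) / (z t
  * z t))).
  { eapply is_derive_eq; [apply (is_derive_div w z); try eassumption; lra|]. field. lra. }
  eapply is_derive_eq; [apply is_derive_mult_R; [exact Dq | exact Dq]|].
  cbv beta. rewrite Hb.
  transitivity (- (2 * ((w t / z t) * (w t / z t)) * rho t * u t / z t)); [field; lra|].
    rewrite E. unfold Rdiv. ring. }
apply derive_local_max in D.
- assert (F : 2 * k * k * rho t * u t / z t = 0) by lra.
  assert (F' : 2 * k * k * rho t * u t = 0) by (transitivity (2 * k * k * rho t * u t / z t * z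
    t); [field; lra | rewrite F; ring]).
  assert (0 < 2 * k * k * rho t) by (repeat apply Rmult_lt_0_compat; lra).
  apply Rmult_integral in F'. destruct F'; [lra | trivial].
- apply filter_imp with (2 := HJ t Ht). intros s Hs. rewrite E, <- (HE s Hs).
  pose proof (Rle_0_sqr (b s / rho s)). unfold Rsqr in *. lra.
Qed.

Lemma locally_R_bound (P : R -> Prop) t : locally t P -> exists d, 0 < d /\ forall s,
  Rabs (s - t) < d -> P s.
Proof. intros [d B]. exists d. split; [apply cond_pos|]. intros s Hs. now apply B. Qed.

Lemma derive_0_const_around (f : R -> R) t0 d : (forall t,
  Rabs (t - t0) < d -> is_derive f t 0) ->
  forall t, Rabs (t - t0) < d -> f t = f t0.
Proof.
intros D t Ht. apply Rabs_def2 in Ht. destruct (Rle_lt_dec t0 t) as [L|L].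
- apply (derive_0_const f t0 t L). intros s Hs. apply D. apply Rabs_def1; lra.
- symmetry. apply (derive_0_const f t t0); [lra|]. intros s Hs. apply D. apply Rabs_def1; lra.
Qed.

Definition is_sign (sg : R) : Prop := sg = 1 \/ sg = -1.

Lemma is_sign_sq sg : is_sign sg -> sg * sg = 1.
Proof. intros [-> | ->]; ring. Qed.

(** This links the profile to the variables of the first integral: [y = sg * z * b / rho], [W] is
    the cosine of the angle, and [hyp y W] is [k] times the distance to the axis. *)
Lemma profile_hyp z rho w b k sg c : sg * sg = 1 -> 0 < z -> 0 < rho -> 0 < k -> w = sg * c ->
  (b / rho) * (b / rho) + (w / z) * (w / z) = k * k ->
  hyp (sg * z * b / rho) c = k * z.
Proof.
intros Hs Pz Pr Pk Hw E. unfold hyp. rewrite <- (sqrt_square (k * z)) by nra. f_equal.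
transitivity ((sg * sg) * (z * z) * ((b / rho) * (b / rho)) + c * c); [field; lra|].
rewrite Hs. replace (c * c) with (z * z * ((w / z) * (w / z))).
- transitivity (z * z * ((b / rho) * (b / rho) + (w / z) * (w / z))); [ring|]. rewrite E. ring.
- transitivity (w * w); [field; lra|]. rewrite Hw.
  transitivity (sg * sg * (c * c)); [ring | rewrite Hs; ring].
Qed.

(** Defining the angle as an integral of [b] avoids any choice of branch and makes it differentiable
    at once. The sign [sg] tells whether the profile runs with increasing or with decreasing
    angle. *)
Lemma tangent_angle (J : R -> Prop) x z rho w u b k t0 sg s0 :
  open J -> unit_tangent_data J x z rho w u b -> profile_equation J z rho w b k -> 0 < k ->
  J t0 -> is_sign sg -> 0 < sg * b t0 -> w t0 = sg * cos s0 -> u t0 = - sg * sin s0 ->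
  exists (d : R) (th : R -> R), 0 < d /\ th t0 = s0 /\
   forall t, Rabs (t - t0) < d ->
     J t /\ is_derive th t (b t) /\ 0 < sg * b t /\ w t = sg * cos (th t) /\
       u t = - sg * sin (th t) /\
     first_int (sg * z t * b t / rho t) (cos (th t)) = first_int (sg * z t0 * b t0 / rho t0)
       (cos s0).
Proof.
intros HJ HD HE Pk Ht0 Hsg Hb0 Hw0 Hu0. pose proof (is_sign_sq sg Hsg) as sg2.
destruct (HD t0 Ht0) as (_ & _ & _ & Cb & _).
assert (L : locally t0 (fun t => J t /\ 0 < sg * b t)).
{ apply filter_and; [now apply HJ|].
  apply (continuous_mult_R (fun _ => sg) b t0 (continuous_const sg t0) Cb (fun v => 0 < v)).
    now apply (open_gt 0). }
destruct (locally_R_bound _ _ L) as (d & Pd & Bd).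
set (th := fun t => s0 + RInt b t0 t).
assert (Th0 : th t0 = s0) by (unfold th; rewrite RInt_point; apply Rplus_0_r).
assert (Dth : forall t, Rabs (t - t0) < d -> is_derive th t (b t)).
{ intros t Ht. unfold th. eapply is_derive_eq.
  - apply is_derive_plus_R; [apply is_derive_const_R|].
    apply (is_derive_RInt (V := R_NormedModule) b (fun t => RInt b t0 t) t0 t).
    + assert (P : 0 < d - Rabs (t - t0)) by lra. exists (mkposreal _ P). intros r Hr.
      change (Rabs (r - t) < d - Rabs (t - t0)) in Hr.
      assert (Lr : Rabs (r - t0) < d). { replace (r - t0) with (r - t + (t - t0)) by ring.
        eapply Rle_lt_trans; [apply Rabs_triang|]. lra. }
      apply (RInt_correct (V := R_CompleteNormedModule)).
        apply (ex_RInt_continuous (V := R_CompleteNormedModule)).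
      intros q Hq. assert (Jq : J q).
      { apply (Bd q). apply Rabs_def2 in Lr. unfold Rmin, Rmax in Hq.
        apply Rabs_def1; destruct (Rle_dec t0 r); lra. }
      apply (HD q Jq).
    + apply (HD t (proj1 (Bd t Ht))).
  - cbv beta. ring. }
exists d, th. split; trivial. split; trivial.
(* The tangent turned by the angle [th] has zero derivative and equals [(sg, 0)] at [t0]. *)
assert (D1 : forall t, Rabs (t - t0) < d ->
   w t * cos (th t) - u t * sin (th t) = sg /\ w t * sin (th t) + u t * cos (th t) = 0).
{ assert (Dc : forall t, Rabs (t - t0) < d ->
  is_derive (fun t => cos (th t)) t (- (b t * sin (th t)))).
  { intros t Ht. eapply is_derive_eq; [apply (is_derive_comp_R cos th);
    [apply is_derive_cos | now apply Dth]|].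
    cbv beta. ring. }
  assert (Ds : forall t, Rabs (t - t0) < d ->
    is_derive (fun t => sin (th t)) t (b t * cos (th t))).
  { intros t Ht. eapply is_derive_eq; [apply (is_derive_comp_R sin th);
    [apply is_derive_sin | now apply Dth]|].
    cbv beta. ring. }
  intros t Ht. split.
  - transitivity (w t0 * cos (th t0) - u t0 * sin (th t0)).
    + apply (derive_0_const_around (fun t => w t * cos (th t) - u t * sin (th t)) t0 d);
      trivial.
      intros r Hr. destruct (HD r (proj1 (Bd r Hr))) as (_ & _ & (Dw & Du) & _).
      eapply is_derive_eq.
      * apply is_derive_minus_R; apply is_derive_mult_R;
        [exact Dw | exact (Dc r Hr) | exact Du | exact (Ds r Hr)].
      * cbv beta. ring.
    + rewrite Th0, Hw0, Hu0. pose proof (sin_cos_sq s0) as P.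
      transitivity (sg * (sin s0 * sin s0 + cos s0 * cos s0)); [ring | rewrite P; ring].
  - transitivity (w t0 * sin (th t0) + u t0 * cos (th t0)).
    + apply (derive_0_const_around (fun t => w t * sin (th t) + u t * cos (th t)) t0 d);
      trivial.
      intros r Hr. destruct (HD r (proj1 (Bd r Hr))) as (_ & _ & (Dw & Du) & _).
      eapply is_derive_eq.
      * apply is_derive_plus_R; apply is_derive_mult_R;
        [exact Dw | exact (Ds r Hr) | exact Du | exact (Dc r Hr)].
      * cbv beta. ring.
    + rewrite Th0, Hw0, Hu0. ring. }
assert (D2 : forall t, Rabs (t - t0) < d -> w t = sg * cos (th t) /\ u t = - sg * sin (th t)).
{ intros t Ht. destruct (D1 t Ht) as (A1 & A2). pose proof (sin_cos_sq (th t)) as P. split.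
  - transitivity (w t * (sin (th t) * sin (th t) + cos (th t) * cos (th t))); [rewrite P;
    ring|].
    transitivity ((w t * cos (th t) - u t * sin (th t)) * cos (th t) + (w t * sin (th t) + u t
      * cos (th t)) * sin (th t)); [ring|].
    rewrite A1, A2. ring.
  - transitivity (u t * (sin (th t) * sin (th t) + cos (th t) * cos (th t))); [rewrite P;
    ring|].
    transitivity (- (w t * cos (th t) - u t * sin (th t)) * sin (th t) + (w t * sin (th t) + u
      t * cos (th t)) * cos (th t)); [ring|].
    rewrite A1, A2. ring. }
(* The quantity [sg * z * b / rho] is not visibly differentiable, [b] being only continuous. By the
   profile equation it coincides with this square root, which is. *)
set (y := fun t => sqrt (k * k * (z t * z t) - w t * w t)).
assert (Ey : forall t, Rabs (t - t0) < d ->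
  0 < sg * z t * b t / rho t /\ y t = sg * z t * b t / rho t /\
    (sg * z t * b t / rho t) * (sg * z t * b t / rho t) = k * k * (z t * z t) - w t * w t).
{ intros t Ht. destruct (Bd t Ht) as (Jt & Pb). destruct (HD t Jt) as ((Pz & Pr & _) & _).
  assert (P : 0 < sg * z t * b t / rho t).
  { replace (sg * z t * b t / rho t) with (z t * (sg * b t) / rho t) by (field; lra).
    apply Rdiv_lt_0_compat; trivial. now apply Rmult_lt_0_compat. }
  assert (Q : (sg * z t * b t / rho t) * (sg * z t * b t / rho t) = k * k * (z t * z t) - w t *
    w t).
  { rewrite <- (HE t Jt).
    transitivity (sg * sg * (z t * z t) * (b t / rho t * (b t / rho t))); [field; lra|].
    rewrite sg2. field. lra. }
  split; trivial. split; trivial. unfold y. rewrite <- Q. apply sqrt_square. lra. }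
assert (DH : forall t, Rabs (t - t0) < d ->
  is_derive (fun t => first_int (y t) (cos (th t))) t 0).
{ intros t Ht. destruct (Bd t Ht) as (Jt & Pb).
  destruct (HD t Jt) as ((Pz & Pr & _) & (Dx & Dz) & (Dw & Du) & _).
  destruct (Ey t Ht) as (P1 & P2 & P3). destruct (D2 t Ht) as (Ew & Eu).
  assert (Dy : is_derive y t ((k * k * (z t * (rho t * u t)) - w t * (b t * u t)) / y t)).
  { assert (Q : 0 < k * k * (z t * z t) - w t * w t) by (rewrite <- P3; nra).
    assert (Py : 0 < y t) by now apply sqrt_lt_R0.
    unfold y at 1. eapply is_derive_eq.
    - apply (is_derive_comp_R sqrt (fun t => k * k * (z t * z t) - w t * w t)).
      + apply is_derive_Reals. apply derivable_pt_lim_sqrt. exact Q.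
      + apply is_derive_minus_R; [apply (is_derive_scal (fun t => z t * z t) t (k * k))|];
        (apply is_derive_mult_R; eassumption).
    - cbv beta. fold (y t). field. lra. }
  assert (Dc : is_derive (fun t => cos (th t)) t (- (b t * sin (th t)))).
  { eapply is_derive_eq; [apply (is_derive_comp_R cos th);
    [apply is_derive_cos | now apply Dth]|].
    cbv beta. ring. }
  eapply is_derive_eq.
  - apply (is_derive_first_int y (fun t => cos (th t)) t _ _ Dy Dc). rewrite P2. exact P1.
  - rewrite P2. rewrite (profile_hyp (z t) (rho t) (w t) (b t) k sg (cos (th t)) sg2 Pz Pr Pk
    Ew (HE t Jt)).
    set (e := 2 * exp _ / _). set (Y := sg * z t * b t / rho t) in *.
    replace (Y * Y * ((k * k * (z t * (rho t * u t)) - w t * (b t * u t)) / Y) - (k * z t * (k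
      * z t) - Y * cos (th t)) * - (b t * sin (th t)))
      with (k * k * z t * u t * (Y * rho t - sg * z t * b t) + Y * b t * (- w t * u t - cos (th
        t) * sin (th t)) + k * k * z t * z t * b t * (sg * u t + sin (th t))).
    2:{ field. lra. }
    replace (Y * rho t - sg * z t * b t) with 0 by (unfold Y; field; lra).
    rewrite Ew, Eu. replace (- (sg * cos (th t)) * (- sg * sin (th t)) - cos (th t) * sin (th
      t)) with ((sg * sg - 1) * cos (th t) * sin (th t)) by ring.
    replace (sg * (- sg * sin (th t)) + sin (th t)) with ((1 - sg * sg) * sin (th t)) by ring.
      rewrite sg2. ring. }
intros t Ht. destruct (Bd t Ht) as (Jt & Pb). destruct (D2 t Ht) as (Ew & Eu).
split; trivial. split; [now apply Dth|]. split; trivial. split; trivial. split; trivial.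
assert (T0 : Rabs (t0 - t0) < d) by (rewrite Rminus_eq_0, Rabs_R0; trivial).
destruct (Ey t Ht) as (_ & P2 & _). destruct (Ey t0 T0) as (_ & Q2 & _).
rewrite <- P2, <- Q2, <- Th0.
  exact (derive_0_const_around (fun t => first_int (y t) (cos (th t))) t0 d DH t Ht).
Qed.

(** At [t] the profile passes through the point of angle [s] of the reference curve, scaled by
    [1 / k] and shifted by [x0], with the same tangent line and bending to the same side. The sign
    is existential because the profile may run along the curve either way. *)
Definition on_ref (J : R -> Prop) (x z w u b : R -> R) (k x0 : R) (Y : R ->
  R) (s t : R) : Prop :=
  J t /\ x t = x0 + refX Y s / k /\ z t = refA Y s / k /\
  exists sg, is_sign sg /\ 0 < sg * b t /\ w t = sg * cos s /\ u t = - sg * sin s.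

(** Near [t0] injectivity of the first integral determines [y], and so [z], from the angle; then
    [x - refX / k] has zero derivative. The angle is strictly monotone in [t] and takes all values
    near [s0] by the intermediate value theorem. *)
Lemma on_ref_locally (J : R -> Prop) x z rho w u b k x0 K Y d s0 t0 :
  open J -> unit_tangent_data J x z rho w u b -> profile_equation J z rho w b k -> 0 < k ->
  level_curve K Y -> (forall s, Rabs s < d -> first_int0 (cos s) < K) -> Rabs s0 < d ->
  on_ref J x z w u b k x0 Y s0 t0 ->
  exists e, 0 < e /\ forall s, Rabs (s - s0) < e -> exists t, on_ref J x z w u b k x0 Y s t.
Proof.
intros HJ HD HE Pk HY Hd Hs0 (Jt0 & Ex0 & Ez0 & sg & Hsg & Pb0 & Ew0 & Eu0).
pose proof (is_sign_sq sg Hsg) as sg2.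
destruct (tangent_angle J x z rho w u b k t0 sg s0 HJ HD HE Pk Jt0 Hsg Pb0 Ew0 Eu0) as (d' & th
  & Pd' & Th0 & B).
destruct (HD t0 Jt0) as ((Pz0 & Pr0 & _) & _).
destruct (HY s0 (Hd s0 Hs0)) as (PY0 & EY0).
assert (Hy : forall t, J t -> 0 < sg * b t -> 0 < sg * z t * b t / rho t).
{ intros t Jt Pb. destruct (HD t Jt) as ((Pz & Pr & _) & _).
  replace (sg * z t * b t / rho t) with (z t * (sg * b t) / rho t) by (field; lra).
  apply Rdiv_lt_0_compat; trivial. now apply Rmult_lt_0_compat. }
(* Both numbers are positive and have the same [hyp] with [cos s0], namely [k * z t0]. *)
assert (Y0 : sg * z t0 * b t0 / rho t0 = Y s0).
{ assert (E : hyp (sg * z t0 * b t0 / rho t0) (cos s0) = hyp (Y s0) (cos s0)).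
  { rewrite (profile_hyp _ _ _ _ k sg _ sg2 Pz0 Pr0 Pk Ew0 (HE t0 Jt0)), Ez0. unfold refA.
    field. lra. }
  pose proof (hyp_sq (sg * z t0 * b t0 / rho t0) (cos s0)) as Q1.
    pose proof (hyp_sq (Y s0) (cos s0)) as Q2.
  rewrite E in Q1. pose proof (Hy t0 Jt0 Pb0) as P1. nra. }
rewrite Y0, EY0 in B.
assert (T0 : Rabs (t0 - t0) < d') by (rewrite Rminus_eq_0, Rabs_R0; trivial).
assert (Cth : continuous th t0) by (apply (ex_derive_continuous th); eexists; apply (B t0 T0)).
destruct (proj1 (continuous_bound th t0) Cth (d - Rabs s0) ltac:(lra)) as (d'' & Pd'' & Bth).
set (e := Rmin (d' / 2) (d'' / 2)). assert (Pe : 0 < e) by (apply Rmin_pos; lra).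
assert (e1 : e <= d' / 2) by apply Rmin_l. assert (e2 : e <= d'' / 2) by apply Rmin_r.
assert (Hth : forall t, Rabs (t - t0) < 2 * e -> Rabs (th t) < d).
{ intros t Ht. specialize (Bth t ltac:(lra)). rewrite Th0 in Bth.
  replace (th t) with (th t - s0 + s0) by ring. eapply Rle_lt_trans; [apply Rabs_triang|]. lra.
    }
assert (EY : forall t, Rabs (t - t0) < 2 * e ->
  sg * z t * b t / rho t = Y (th t) /\ k * z t = refA Y (th t)).
{ intros t Ht. destruct (B t ltac:(lra)) as (Jt & Dt & Pbt & Ewt & Eut & EH).
  destruct (HD t Jt) as ((Pz & Pr & _) & _).
  pose proof (Hy t Jt Pbt) as Py. destruct (HY (th t) (Hd _ (Hth t Ht))) as (PY & EYt).
  assert (E : sg * z t * b t / rho t = Y (th t)) by (apply first_int_inj with (cos (th t));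
    trivial; congruence).
  split; trivial. unfold refA. rewrite <- E. symmetry. apply (profile_hyp _ _ (w t)); trivial.
    now apply HE. }
assert (EX : forall t, Rabs (t - t0) < 2 * e -> x t - refX Y (th t) / k = x0).
{ intros t Ht. transitivity (x t0 - refX Y (th t0) / k); [|rewrite Th0, Ex0; ring].
  apply (derive_0_const_around (fun t => x t - refX Y (th t) / k) t0 (2 * e)); trivial.
  intros r Hr. destruct (B r ltac:(lra)) as (Jr & Dr & Pbr & Ewr & Eur & EHr).
  destruct (HD r Jr) as ((Pz & Pr & _) & (Dx & _) & _). destruct (EY r Hr) as (E1 & E2).
  eapply is_derive_eq.
  - apply (is_derive_minus_R x (fun t => refX Y (th t) / k)); [exact Dx|].
    eapply (is_derive_scal_r (fun t => refX Y (th t)) r).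
    apply (is_derive_comp_R (refX Y) th); [apply (refX_derive K Y d); auto | exact Dr].
  - cbv beta. rewrite <- E1, <- E2, Ewr.
    assert (b r <> 0) by (intros E; rewrite E in Pbr; lra).
    assert (sg <> 0) by (intros E; rewrite E in sg2; lra).
    replace (sg * cos (th r)) with (cos (th r) / sg) by (apply Rmult_eq_reg_r with sg; trivial;
      transitivity (cos (th r)); [field; trivial | transitivity (sg * sg * cos (th r));
      [rewrite sg2 |]; ring]).
    field. repeat split; lra. }
assert (OR : forall t, Rabs (t - t0) < 2 * e -> on_ref J x z w u b k x0 Y (th t) t).
{ intros t Ht. destruct (B t ltac:(lra)) as (Jt & Dt & Pbt & Ewt & Eut & EH).
  destruct (EY t Ht) as (_ & E2).
  split; trivial. split; [rewrite <- (EX t Ht); ring|]. split; [rewrite <- E2; field; lra|].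
    now exists sg. }
assert (mono : forall r t, Rabs (r - t0) < 2 * e -> Rabs (t - t0) < 2 * e -> r < t ->
  sg * th r < sg * th t).
{ intros r t Hr Ht L. apply Rabs_def2 in Hr, Ht.
  destruct (MVT_gen th r t b) as (c & Hc & E).
  - intros q Hq. rewrite Rmin_left, Rmax_right in Hq by lra. apply (B q). apply Rabs_def1; lra.
  - intros q Hq. rewrite Rmin_left, Rmax_right in Hq by lra. apply continuity_pt_filterlim.
    apply (ex_derive_continuous th). eexists. apply (B q). apply Rabs_def1; lra.
  - rewrite Rmin_left, Rmax_right in Hc by lra.
    destruct (B c ltac:(apply Rabs_def1; lra)) as (_ & _ & Pbc & _).
    assert (0 < (sg * b c) * (t - r)) by (apply Rmult_lt_0_compat; lra). nra. }
assert (M1 : sg * th (t0 - e) < sg * s0) by (rewrite <- Th0; apply mono; try (apply Rabs_def1;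
  lra); lra).
assert (M2 : sg * s0 < sg * th (t0 + e)) by (rewrite <- Th0; apply mono; try (apply Rabs_def1;
  lra); lra).
set (eta := Rmin (sg * s0 - sg * th (t0 - e)) (sg * th (t0 + e) - sg * s0)).
assert (Peta : 0 < eta) by (apply Rmin_pos; lra).
assert (h1 : eta <= sg * s0 - sg * th (t0 - e)) by apply Rmin_l.
  assert (h2 : eta <= sg * th (t0 + e) - sg * s0) by apply Rmin_r.
exists eta. split; trivial. intros s Hs.
assert (Hs' : Rabs (sg * (s - s0)) < eta).
{ rewrite Rabs_mult. replace (Rabs sg) with 1; [lra|].
  destruct Hsg as [-> | ->]; [now rewrite Rabs_R1 | rewrite Rabs_left; lra]. }
apply Rabs_def2 in Hs'.
destruct (Ranalysis5.IVT_interv (fun t => sg * th t - sg * s) (t0 - e) (t0 + e)) as (t & Ht &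
  E); try lra.
- intros t Ht. apply continuity_pt_filterlim.
  apply (ex_derive_continuous (fun t => sg * th t - sg * s)).
  eexists. apply (is_derive_minus_R (fun t => sg * th t) (fun _ => sg * s)).
  + apply is_derive_scal. apply (B t). apply Rabs_def1; lra.
  + apply is_derive_const_R.
- exists t. assert (Et : th t = s).
  { transitivity (sg * sg * th t); [rewrite sg2; ring|].
    transitivity (sg * sg * s); [|rewrite sg2; ring].
    rewrite !Rmult_assoc. f_equal. lra. }
  rewrite <- Et. apply OR. apply Rabs_def1; lra.
Qed.

Lemma is_lim_seq_eq (v : nat -> R) (l l' : R) : is_lim_seq v l -> is_lim_seq v l' -> l = l'.
Proof. intros L L'. apply is_lim_seq_unique in L, L'. rewrite L in L'. now injection L'. Qed.

(** Zeros along a sequence, possibly on one side of [s] only, suffice; at the end of an arc nothing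
    is known about the other side. *)
Lemma derive_zero_seq (g : R -> R) s l (r : nat -> R) : is_derive g s l -> is_lim_seq r s ->
  (forall n, r n <> s) ->
  (exists N, forall n, (N <= n)%nat -> g (r n) = 0) -> g s = 0 /\ l = 0.
Proof.
intros D Hr Hne [N HN].
assert (g0 : g s = 0).
{ assert (L : is_lim_seq (fun n => g (r n)) (g s)).
  { apply is_lim_seq_continuous; trivial. apply continuity_pt_filterlim.
    apply (ex_derive_continuous g). now exists l. }
  assert (L' : is_lim_seq (fun n => g (r n)) 0).
  { apply is_lim_seq_ext_loc with (fun _ => 0); [exists N; intros n Hn; symmetry;
    auto | apply is_lim_seq_const]. }
  exact (is_lim_seq_eq _ _ _ L L'). }
split; trivial. apply Rabs_eq_0. apply Rle_antisym; [|apply Rabs_pos].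
apply le_epsilon. intros eps He. rewrite Rplus_0_l.
destruct (is_derive_bound g s l D eps He) as (d & Pd & B).
apply is_lim_seq_spec in Hr. destruct (Hr (mkposreal d Pd)) as [M HM]. simpl in HM.
specialize (HM (N + M)%nat ltac:(lia)). specialize (HN (N + M)%nat ltac:(lia)).
  specialize (Hne (N + M)%nat).
set (h := r (N + M)%nat - s) in *. specialize (B h HM).
  replace (s + h) with (r (N + M)%nat) in B by (unfold h; ring).
rewrite HN, g0 in B. replace (0 - 0 - h * l) with (- (h * l)) in B by ring.
  rewrite Rabs_Ropp, Rabs_mult in B.
assert (0 < Rabs h) by (apply Rabs_pos_lt; unfold h; lra).
apply Rmult_le_reg_l with (Rabs h); trivial. lra.
Qed.

(** The unit vectors [(c, - s)] and [(w, u)] are both orthogonal to the nonzero vector [(f1, f3)] of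
    the plane, so they agree up to a sign, which is their inner product. *)
Lemma tangent_match f1 f3 c s w u : f1 * c - f3 * s = 0 -> f1 * w + f3 * u = 0 ->
  (f1 <> 0 \/ f3 <> 0) ->
  s * s + c * c = 1 -> w * w + u * u = 1 -> exists sg, is_sign sg /\ w = sg * c /\ u = - sg * s.
Proof.
intros E1 E2 Hf E3 E4.
assert (E5 : c * u + s * w = 0).
{ assert (A1 : f1 * (c * u + s * w) = 0) by (transitivity (u * (f1 * c - f3 * s) + s * (f1 * w
  + f3 * u)); [ring | rewrite E1, E2; ring]).
  assert (A3 : f3 * (c * u + s * w) = 0) by (transitivity (- w * (f1 * c - f3 * s) + c * (f1 *
    w + f3 * u)); [ring | rewrite E1, E2; ring]).
  destruct Hf; [apply Rmult_integral in A1; destruct A1 | apply Rmult_integral in A3;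
    destruct A3]; trivial; contradiction. }
exists (w * c - u * s). split; [|split].
- assert (Q : (w * c - u * s) * (w * c - u * s) = 1).
  { transitivity ((w * w + u * u) * (s * s + c * c) - (c * u + s * w) * (c * u + s * w));
    [ring|]. rewrite E3, E4, E5. ring. }
  unfold is_sign. assert (Q' : (w * c - u * s - 1) * (w * c - u * s + 1) = 0) by lra.
  apply Rmult_integral in Q'. lra.
- transitivity (w * (s * s + c * c) - s * (c * u + s * w)); [rewrite E3, E5; ring | ring].
- transitivity (u * (s * s + c * c) - c * (c * u + s * w)); [rewrite E3, E5; ring | ring].
Qed.

(** Starts at [a] and tends to [s] without reaching it, as [complete_limit] needs for a half-open
    interval ending at [s]. *)
Definition approach (a s : R) (n : nat) : R := s + (a - s) / (INR n + 1).

Lemma approach_lim a s : is_lim_seq (approach a s) s.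
Proof.
unfold approach. replace (Finite s) with (Finite (s + (a - s) * 0)) by (f_equal; ring).
apply is_lim_seq_plus'; [apply is_lim_seq_const|].
  apply is_lim_seq_mult'; [apply is_lim_seq_const|].
replace (Finite 0) with (Rbar_inv p_infty) by reflexivity.
  apply is_lim_seq_inv; [|discriminate].
apply is_lim_seq_ext with (fun n => INR (S n)).
- intros n. apply S_INR.
- apply (is_lim_seq_incr_1 INR). apply is_lim_seq_INR.
Qed.

Lemma approach_between a s n : a <> s ->
  Rmin a s <= approach a s n <= Rmax a s /\ approach a s n <> s.
Proof.
intros Ha. unfold approach. pose proof (pos_INR n) as Pn.
assert (P : 0 < / (INR n + 1)) by (apply Rinv_0_lt_compat; lra).
assert (P1 : / (INR n + 1) <= 1) by (rewrite <- Rinv_1; apply Rinv_le_contravar; lra).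
unfold Rdiv. set (q := / (INR n + 1)) in *. split.
- unfold Rmin, Rmax. destruct (Rle_dec a s); nra.
- intros E. assert (E' : (a - s) * q = 0) by lra. apply Rmult_integral in E'. lra.
Qed.

(** Length per unit of angle along the scaled reference curve, that is its radius of curvature. *)
Definition speed (Y : R -> R) (k s : R) : R := refA Y s / (k * Y s).

Lemma speed_continuous K Y k s : level_curve K Y -> 0 < k -> first_int0 (cos s) < K ->
  continuous (speed Y k) s.
Proof.
intros HY Pk Hs. destruct (HY s Hs) as (PY & _).
apply (continuous_mult_R (refA Y) (fun r => / (k * Y r))); [now apply (refA_continuous K)|].
apply (continuous_comp (fun r => k * Y r) Rinv).
- apply (continuous_mult_R (fun _ => k) Y);
  [apply continuous_const | now apply (Y_continuous K)].
- apply continuous_Rinv. assert (0 < k * Y s) by now apply Rmult_lt_0_compat. lra.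
Qed.

Lemma ref_derive K Y k x0 d s : level_curve K Y -> 0 < k -> (forall r,
  Rabs r < d -> first_int0 (cos r) < K) -> Rabs s < d ->
  is_derive (fun s => x0 + refX Y s / k) s (speed Y k s * cos s) /\
  is_derive (fun s => refA Y s / k) s (- (speed Y k s * sin s)) /\ 0 < speed Y k s.
Proof.
intros HY Pk Hd Hs. destruct (HY s (Hd s Hs)) as (PY & _).
  pose proof (refA_pos K Y s HY (Hd s Hs)) as PA.
split; [|split].
- eapply is_derive_eq.
  + apply is_derive_plus_R; [apply is_derive_const_R|].
    eapply (is_derive_scal_r (refX Y) s). now apply (refX_derive K Y d).
  + cbv beta. unfold speed. field. lra.
- eapply is_derive_eq.
  + eapply (is_derive_scal_r (refA Y) s). apply (refA_derive K); auto.
  + unfold speed. field. lra.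
- apply Rdiv_lt_0_compat; trivial. now apply Rmult_lt_0_compat.
Qed.

Lemma continuous_cos s : continuous cos s.
Proof. apply (ex_derive_continuous cos). auto_derive. trivial. Qed.
Lemma continuous_sin s : continuous sin s.
Proof. apply (ex_derive_continuous sin). auto_derive. trivial. Qed.

Lemma on_ref_in (S : R3 -> Prop) o e1 e2 e3 (J : R -> Prop) x z w u b k x0 Y s :
  profile_of S o e1 e2 e3 J x z -> (exists t, on_ref J x z w u b k x0 Y s t) ->
  S (meridian o e1 e2 e3 (x0 + refX Y s / k) (refA Y s / k)).
Proof.
intros HPr (t & Jt & Ex & Ez & _). rewrite <- Ex, <- Ez.
  now apply (profile_in S o e1 e2 e3 J x z).
Qed.

(** Completeness puts the limit point on the surface, at positive distance from the axis and so on
    the profile; the normal field carries the tangent line to the limit. The condition [0 < sg * b]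
    is of second order: both curves lie in the zero set of one defining function and share a tangent
    line, so the Hessian on that line determines both curvatures, and that of the reference curve is
    not zero. *)
Lemma on_ref_closed (S : R3 -> Prop) o e1 e2 e3 (J : R -> Prop) x z rho w u b k x0 K Y d a s :
  embedded_C2_surface S -> complete_surface S -> profile_of S o e1 e2 e3 J x z ->
  unit_tangent_data J x z rho w u b -> profile_equation J z rho w b k -> 0 < k ->
  level_curve K Y -> (forall s, Rabs s < d -> first_int0 (cos s) < K) -> Rabs a < d ->
    Rabs s < d -> a <> s ->
  (forall r, Rmin a s <= r <= Rmax a s -> r <> s -> exists t, on_ref J x z w u b k x0 Y r t) ->
  exists t, on_ref J x z w u b k x0 Y s t.
Proof.
intros HE HC HPr HD HEq Pk HY Hd Ha Hs Has Hon.
pose proof HPr as (HO & HP & _). pose proof HP as (HJ & _).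
set (X := fun s => x0 + refX Y s / k). set (Z := fun s => refA Y s / k).
set (m := speed Y k).
set (I := fun r => Rmin a s <= r <= Rmax a s /\ r <> s).
assert (Id : forall r, Rmin a s <= r <= Rmax a s -> Rabs r < d).
{ intros r Hr. apply Rabs_def2 in Ha, Hs. unfold Rmin, Rmax in Hr.
  apply Rabs_def1; destruct (Rle_dec a s); lra. }
set (G := fun s => RInt m 0 s).
assert (Cm : forall r, Rabs r < d -> continuous m r) by (intros r Hr;
  apply (speed_continuous K); auto).
assert (DG : forall r, Rabs r < d -> is_derive G r (m r)).
{ intros r Hr. apply (is_derive_RInt (V := R_NormedModule) m G 0 r); auto.
  assert (P : 0 < d - Rabs r) by lra. exists (mkposreal _ P). intros q Hq.
  change (Rabs (q - r) < d - Rabs r) in Hq.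
  assert (Lq : Rabs q < d). { replace q with (q - r + r) by ring.
    eapply Rle_lt_trans; [apply Rabs_triang|]. lra. }
  apply (RInt_correct (V := R_CompleteNormedModule)).
    apply (ex_RInt_continuous (V := R_CompleteNormedModule)).
  intros v Hv. apply Cm. unfold Rmin, Rmax in Hv. apply Rabs_def2 in Lq.
    apply Rabs_def1; destruct (Rle_dec 0 q); lra. }
assert (Dref : forall r, Rabs r < d ->
  is_derive X r (m r * cos r) /\ is_derive Z r (- (m r * sin r)) /\ 0 < m r).
{ intros r Hr. now apply (ref_derive K Y k x0 d). }
set (r := approach a s).
assert (Ir : forall n, I (r n)) by (intros n; apply approach_between; trivial).
destruct (complete_limit S o e1 e2 e3 I X Z (fun r => m r * cos r) (fun r => - (m r * sin r)) G
  m r HC HO) as (xs & zs & Sp & LX & LZ).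
- intros p q t (P1 & P2) (Q1 & Q2) Ht. split; [lra|]. intros ->. unfold Rmin, Rmax in *.
  destruct (Rle_dec a s); lra.
- intros t (T1 & T2). destruct (Dref t (Id t T1)) as (D1 & D2 & _). split; trivial.
  split; trivial. apply DG. now apply Id.
- intros t (T1 & T2). pose proof (Cm t (Id t T1)) as Cmt. split; [|split]; trivial.
  + apply (continuous_mult_R m cos); trivial. apply continuous_cos.
  + apply continuous_opp_R. apply (continuous_mult_R m sin); trivial. apply continuous_sin.
- intros t (T1 & T2). apply (on_ref_in S o e1 e2 e3 J x z w u b); auto.
- intros t (T1 & T2). destruct (Dref t (Id t T1)) as (_ & _ & Pm). split; [|lra].
  right. pose proof (sin_cos_sq t) as P.
  transitivity (m t * m t * (sin t * sin t + cos t * cos t)); [ring | rewrite P; ring].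
- exact Ir.
- exists (G s). apply is_lim_seq_continuous; [|apply approach_lim].
  apply continuity_pt_filterlim.
  apply (ex_derive_continuous G). eexists. now apply DG.
- destruct (Dref s Hs) as (DX & DZ & Pm).
  assert (Exs : xs = X s).
  { assert (L : is_lim_seq (fun n => X (r n)) (X s)).
    { apply is_lim_seq_continuous; [|apply approach_lim]. apply continuity_pt_filterlim.
      apply (ex_derive_continuous X). eexists; exact DX. }
    exact (is_lim_seq_eq _ _ _ LX L). }
  assert (Ezs : zs = Z s).
  { assert (L : is_lim_seq (fun n => Z (r n)) (Z s)).
    { apply is_lim_seq_continuous; [|apply approach_lim]. apply continuity_pt_filterlim.
      apply (ex_derive_continuous Z). eexists; exact DZ. }
    exact (is_lim_seq_eq _ _ _ LZ L). }
  rewrite Exs, Ezs in *. clear xs zs Exs Ezs.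
  assert (PZ : 0 < Z s) by (apply Rdiv_lt_0_compat; trivial; apply (refA_pos K); auto).
  destruct (profile_out S o e1 e2 e3 J x z _ _ HPr PZ Sp) as (t1 & Jt1 & Ex1 & Ez1).
  destruct (normal_field S o e1 e2 e3 J x z rho w u b t1 HE HPr HD Jt1) as (f1 & f3 & q11 & q13
    & q31 & q33 & Nf & (del & Pdel & Tf) & Df & _).
  destruct (HD t1 Jt1) as ((Pz1 & Pr1 & Wu) & (Dx & Dz) & (Dw & Du) & _).
  pose proof (sin_cos_sq s) as SC.
  destruct (Df X Z s _ _ DX DZ (eq_sym Ex1) (eq_sym Ez1)) as (Df1 & Df3).
  (* The normal paired with the tangent [(cos r, - sin r)] of the reference curve. It vanishes along
     the approach, hence at [s] together with its derivative. *)
  set (g := fun r => f1 (X r) (Z r) * cos r - f3 (X r) (Z r) * sin r).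
  assert (Dg : is_derive g s ((q11 * (m s * cos s) + q13 * (- (m s * sin s))) * cos s - f1 (X
    s) (Z s) * sin s
     - ((q31 * (m s * cos s) + q33 * (- (m s * sin s))) * sin s + f3 (X s) (Z s) * cos s))).
  { eapply is_derive_eq.
    - apply is_derive_minus_R.
      + apply is_derive_mult_R; [exact Df1 | apply is_derive_cos].
      + apply is_derive_mult_R; [exact Df3 | apply is_derive_sin].
    - cbv beta. ring. }
  destruct (derive_zero_seq g s _ r Dg (approach_lim a s)) as (g0 & g1).
  { intros n. apply (Ir n). }
  { apply is_lim_seq_spec in LX, LZ. destruct (LX (mkposreal del Pdel)) as [N1 B1].
    destruct (LZ (mkposreal del Pdel)) as [N2 B2].
    simpl in B1, B2. exists (N1 + N2)%nat. intros n Hn. specialize (B1 n ltac:(lia)).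
      specialize (B2 n ltac:(lia)).
    destruct (Hon (r n) (proj1 (Ir n)) (proj2 (Ir n))) as (t & Jt & Ex & Ez & sg & Hsg & Pb &
      Ew & Eu).
    fold (X (r n)) in Ex. fold (Z (r n)) in Ez.
    specialize (Tf t Jt). rewrite Ex, Ez, Ex1, Ez1, Ew, Eu in Tf. specialize (Tf B1 B2).
    unfold g. pose proof (is_sign_sq sg Hsg) as sg2.
    transitivity (sg * (f1 (X (r n)) (Z (r n)) * (sg * cos (r n)) + f3 (X (r n)) (Z (r n)) * (-
      sg * sin (r n)))).
    - transitivity (sg * sg * (f1 (X (r n)) (Z (r n)) * cos (r n) - f3 (X (r n)) (Z (r n)) *
      sin (r n))); [rewrite sg2|]; ring.
    - rewrite Tf. ring. }
  assert (T1 : f1 (x t1) (z t1) * w t1 + f3 (x t1) (z t1) * u t1 = 0).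
  { apply Tf; trivial; rewrite Rminus_eq_0, Rabs_R0; trivial. }
  destruct (Df x z t1 _ _ Dx Dz eq_refl eq_refl) as (Dp1 & Dp3).
  assert (T2 : (q11 * (rho t1 * w t1) + q13 * (rho t1 * u t1)) * w t1 + f1 (x t1) (z t1) * (b
    t1 * u t1)
      + ((q31 * (rho t1 * w t1) + q33 * (rho t1 * u t1)) * u t1 + f3 (x t1) (z t1) * (- (b t1 *
        w t1))) = 0).
  { assert (D : is_derive (fun t => f1 (x t) (z t) * w t + f3 (x t) (z t) * u t) t1
     ((q11 * (rho t1 * w t1) + q13 * (rho t1 * u t1)) * w t1 + f1 (x t1) (z t1) * (b t1 * u t1)
      + ((q31 * (rho t1 * w t1) + q33 * (rho t1 * u t1)) * u t1 + f3 (x t1) (z t1) * (- (b t1 *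
        w t1))))).
    { eapply is_derive_eq.
      - apply is_derive_plus_R.
        + apply is_derive_mult_R; [exact Dp1 | exact Dw].
        + apply is_derive_mult_R; [exact Dp3 | exact Du].
      - cbv beta. ring. }
    assert (D' : is_derive (fun t => f1 (x t) (z t) * w t + f3 (x t) (z t) * u t) t1 0).
    { apply is_derive_ext_loc with (fun _ => 0); [|apply is_derive_const_R].
      assert (Cx : continuous x t1) by (exact (is_derive_continuous _ _ _ Dx)).
      assert (Cz : continuous z t1) by (exact (is_derive_continuous _ _ _ Dz)).
      pose proof (proj1 (filterlim_locally _ _) Cx (mkposreal _ Pdel)) as l1.
      pose proof (proj1 (filterlim_locally _ _) Cz (mkposreal _ Pdel)) as l2.
      apply filter_imp with (2 := filter_and _ _ l1 (filter_and _ _ l2 (HJ t1 Jt1))).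
      intros t (b1 & b2 & b3). symmetry. now apply Tf. }
    exact (is_derive_uniq _ _ _ _ D D'). }
  unfold g in g0. rewrite <- Ex1, <- Ez1 in g0, g1.
  set (F1 := f1 (x t1) (z t1)) in *. set (F3 := f3 (x t1) (z t1)) in *.
  destruct (tangent_match F1 F3 (cos s) (sin s) (w t1) (u t1) g0 T1 Nf SC Wu) as (sg & Hsg & Ew
    & Eu).
  pose proof (is_sign_sq sg Hsg) as sg2.
  exists t1. split; trivial. split; trivial. split; trivial. exists sg. split; trivial.
    split; [|now split].
  (* [N] is the signed length of the normal and [q] the Hessian on the unit tangent. Differentiating
     orthogonality gives [N = m s * q] on the reference curve and [rho * q = sg * b * N] on the
     profile; comparing them yields [sg * b = rho / m s]. *)
  set (N := F1 * sin s + F3 * cos s).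
  set (q := q11 * (cos s * cos s) - q13 * (sin s * cos s) - q31 * (sin s * cos s) + q33 * (sin
    s * sin s)).
  assert (EN : N = m s * q) by (unfold N, q; lra).
  assert (Eq : rho t1 * q = sg * b t1 * N).
  { rewrite Ew, Eu in T2.
    assert (T3 : sg * sg * (rho t1 * q) - sg * b t1 * N = 0) by (rewrite <- T2; unfold q, N;
      ring).
    rewrite sg2 in T3. lra. }
  assert (N0 : N <> 0).
  { intros E. assert (F1 = 0) by (transitivity (F1 * (sin s * sin s + cos s * cos s));
    [rewrite SC; ring|];
      transitivity (sin s * N + cos s * (F1 * cos s - F3 * sin s)); [unfold N;
        ring | rewrite E, g0; ring]).
    assert (F3 = 0) by (transitivity (F3 * (sin s * sin s + cos s * cos s)); [rewrite SC;
      ring|];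
      transitivity (cos s * N - sin s * (F1 * cos s - F3 * sin s)); [unfold N;
        ring | rewrite E, g0; ring]).
    destruct Nf; contradiction. }
  assert (E : sg * b t1 = rho t1 / m s).
  { apply Rmult_eq_reg_r with (N * m s).
    - transitivity (sg * b t1 * N * m s); [ring|]. rewrite <- Eq. rewrite EN. field. lra.
    - apply Rmult_integral_contrapositive_currified; lra. }
  rewrite E. apply Rdiv_lt_0_compat; trivial.
Qed.

(** Take the supremum of the points up to which [P] holds throughout: closedness gives [P] there,
    and openness would push it further unless it is [b]. *)
Lemma interval_induction (P : R -> Prop) a b : a <= b -> P a ->
  (forall s, a <= s <= b -> P s -> exists e, 0 < e /\ forall r, Rabs (r - s) < e -> P r) ->
  (forall s, a < s <= b -> (forall r, a <= r < s -> P r) -> P s) -> P b.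
Proof.
intros Hab Pa Hopen Hclosed.
set (E := fun s => a <= s <= b /\ forall r, a <= r <= s -> P r).
assert (Ea : E a). { split; [lra|]. intros r Hr. replace r with a by lra. trivial. }
destruct (completeness E) as (m & M1 & M2).
- exists b. intros s (Hs & _). lra.
- now exists a.
- assert (am : a <= m) by now apply M1.
  assert (mb : m <= b) by (apply M2; intros s (Hs & _); lra).
  assert (L : forall r, a <= r < m -> P r).
  { intros r Hr. apply NNPP. intros NP. assert (m <= r); [|lra].
    apply M2. intros s (Hs1 & Hs2). apply Rnot_lt_le. intros Lr. apply NP. apply Hs2. lra. }
  assert (Pm : P m). { destruct (Req_dec a m) as [<- | Ne]; trivial. apply Hclosed; trivial.
    lra. }
  destruct (Req_dec m b) as [<- | Nb]; trivial. exfalso.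
  destruct (Hopen m ltac:(lra) Pm) as (e & Pe & B).
  set (s := Rmin b (m + e / 2)). assert (s <= b) by apply Rmin_l.
    assert (s <= m + e / 2) by apply Rmin_r.
  assert (m < s) by (apply Rmin_glb_lt; lra).
  assert (E s). { split; [lra|]. intros r Hr. destruct (Rlt_le_dec r m); [apply L; lra|].
    apply B. apply Rabs_def1; lra. }
  assert (s <= m) by now apply M1. lra.
Qed.

Lemma interval_connected (P : R -> Prop) a b : P a ->
  (forall s, Rmin a b <= s <= Rmax a b -> P s -> exists e, 0 < e /\ forall r,
    Rabs (r - s) < e -> P r) ->
  (forall s, Rmin a b <= s <= Rmax a b -> s <> a -> (forall r,
    Rmin a s <= r <= Rmax a s -> r <> s -> P r) -> P s) -> P b.
Proof.
intros Pa Hopen Hclosed. destruct (Rle_lt_dec a b) as [L|L].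
- rewrite Rmin_left, Rmax_right in Hopen, Hclosed by lra.
  apply (interval_induction P a b); trivial.
  intros s Hs Hr. apply Hclosed; try lra. intros r. rewrite Rmin_left, Rmax_right by lra.
    intros Hr' Ne. apply Hr. lra.
- rewrite Rmin_right, Rmax_left in Hopen, Hclosed by lra.
  replace b with (- - b) by ring. apply (interval_induction (fun s => P (- s)) (- a) (- b)).
  + lra.
  + now rewrite Ropp_involutive.
  + intros s Hs Ps. destruct (Hopen (- s) ltac:(lra) Ps) as (e & Pe & B). exists e.
    split; trivial.
    intros r Hr. apply B. replace (- r - - s) with (- (r - s)) by ring. now rewrite Rabs_Ropp.
  + intros s Hs Hr. apply Hclosed; try lra. intros r. rewrite Rmin_right, Rmax_left by lra.
    intros Hr' Ne.
    rewrite <- (Ropp_involutive r). apply Hr. lra.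
Qed.

Lemma on_ref_all (S : R3 -> Prop) o e1 e2 e3 (J : R -> Prop) x z rho w u b k x0 K Y d s0 s :
  embedded_C2_surface S -> complete_surface S -> profile_of S o e1 e2 e3 J x z ->
  unit_tangent_data J x z rho w u b -> profile_equation J z rho w b k -> 0 < k ->
  level_curve K Y -> (forall s, Rabs s < d -> first_int0 (cos s) < K) -> Rabs s0 < d ->
    Rabs s < d ->
  (exists t, on_ref J x z w u b k x0 Y s0 t) -> exists t, on_ref J x z w u b k x0 Y s t.
Proof.
intros HE HC HPr HD HEq Pk HY Hd Hs0 Hs Hon.
assert (B : forall r, Rmin s0 s <= r <= Rmax s0 s -> Rabs r < d).
{ intros r Hr. apply Rabs_def2 in Hs0, Hs. unfold Rmin, Rmax in Hr.
  apply Rabs_def1; destruct (Rle_dec s0 s); lra. }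
apply (interval_connected (fun s => exists t, on_ref J x z w u b k x0 Y s t) s0 s); trivial.
- intros r Hr (t & Ht). apply (on_ref_locally J x z rho w u b k x0 K Y d r t); auto. apply HPr.
- intros r Hr Ne Hq. apply (on_ref_closed S o e1 e2 e3 J x z rho w u b k x0 K Y d s0 r); auto.
Qed.

(** * The possible profiles *)

(** The nonzero slope moves [f] by at least [Rabs l * h / 2] to either side within distance [h], and
    the intermediate value theorem fills the gap. *)
Lemma open_image (J : R -> Prop) (f : R ->
  R) t l : locally t (fun s => J s /\ continuous f s) ->
  is_derive f t l -> l <> 0 -> exists e, 0 < e /\ forall r, Rabs (r - f t) < e -> exists s,
    J s /\ f s = r.
Proof.
intros L D Hl. destruct (locally_R_bound _ _ L) as (d & Pd & B).
assert (Pl : 0 < Rabs l) by now apply Rabs_pos_lt.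
destruct (is_derive_bound f t l D (Rabs l / 2) ltac:(lra)) as (d' & Pd' & B').
set (h := Rmin (d / 2) (d' / 2)). assert (Ph : 0 < h) by (apply Rmin_pos; lra).
assert (h1 : h <= d / 2) by apply Rmin_l. assert (h2 : h <= d' / 2) by apply Rmin_r.
pose proof (B' h ltac:(rewrite Rabs_pos_eq; lra)) as B1.
pose proof (B' (- h) ltac:(rewrite Rabs_Ropp, Rabs_pos_eq; lra)) as B2.
rewrite Rabs_Ropp in B2. rewrite (Rabs_pos_eq h) in B1, B2 by lra.
apply Rabs_le_between in B1, B2.
exists (Rabs l * h / 2).
  split; [assert (0 < Rabs l * h) by (apply Rmult_lt_0_compat; lra); lra|].
intros r Hr. apply Rabs_def2 in Hr.
assert (Cont : forall c s, t - h <= s <= t + h -> continuity_pt (fun s => c * (f s - r)) s).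
{ intros c s Hs. apply continuity_pt_filterlim.
  apply (continuous_mult_R (fun _ => c) (fun s => f s - r)); [apply continuous_const|].
  apply continuous_minus_R; [|apply continuous_const]. apply B. apply Rabs_def1; lra. }
(* The factor [c] normalizes the sign, since the intermediate value lemma expects a function going
   from negative to positive. *)
assert (Ex : exists c, c <> 0 /\ exists s, t - h <= s <= t + h /\ c * (f s - r) = 0).
{ destruct (Rle_lt_dec 0 l) as [P|P].
  - rewrite (Rabs_pos_eq l) in * by lra. exists 1. split; [lra|].
    destruct (Ranalysis5.IVT_interv (fun s => 1 * (f s - r)) (t - h) (t + h)) as (s & Hs & E).
    + intros s Hs. now apply Cont.
    + lra.
    + change (t - h) with (t + - h). lra.
    + lra.
    + now exists s.
  - rewrite (Rabs_left l) in * by lra. exists (-1). split; [lra|].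
    destruct (Ranalysis5.IVT_interv (fun s => -1 * (f s - r)) (t - h) (t + h)) as (s & Hs & E).
    + intros s Hs. now apply Cont.
    + lra.
    + change (t - h) with (t + - h). lra.
    + lra.
    + now exists s. }
destruct Ex as (c & Hc & s & Hs & E). exists s. split; [apply B; apply Rabs_def1; lra|].
apply Rmult_integral in E. destruct E; [contradiction | lra].
Qed.

Lemma rotate_in (S : R3 -> Prop) o e1 e2 e3 (J : R -> Prop) x z a rho th :
  profile_of S o e1 e2 e3 J x z -> 0 < rho -> S (meridian o e1 e2 e3 a rho) ->
  S (plus o (frame e1 e2 e3 (a, rho * sin th, rho * cos th))).
Proof.
intros HPr Pr HS. destruct (profile_out S o e1 e2 e3 J x z a rho HPr Pr HS) as (t & Jt & Ex &
  Ez).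
destruct HPr as (_ & _ & Hrot). apply Hrot.
- unfold cy, cz; simpl. pose proof (sin_cos_sq th) as P.
  destruct (Req_dec (rho * sin th) 0) as [E|E]; [right | now left].
  intros E'. apply Rmult_integral in E, E'. destruct E as [E|E], E' as [E'|E']; try lra.
    rewrite E, E' in P. lra.
- exists t, th. now rewrite Ex, Ez.
Qed.

Lemma frame_coord o e1 e2 e3 p : orthonormal e1 e2 e3 -> exists p0,
  p = plus o (frame e1 e2 e3 p0).
Proof.
intros HO. exists (dot (minus p o) e1, dot (minus p o) e2, dot (minus p o) e3).
rewrite frame_inv by trivial. apply R3_eq; coords; ring.
Qed.

Lemma minus_frame o e1 e2 e3 p q :
  minus (plus o (frame e1 e2 e3 p)) (plus o (frame e1 e2 e3 q)) = frame e1 e2 e3 (minus p q).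
Proof. unfold frame. apply R3_eq; coords; ring. Qed.

Lemma radial_form_frame o e1 e2 e3 p : orthonormal e1 e2 e3 ->
  radial_form e1 (minus (plus o (frame e1 e2 e3 p)) o) (minus (plus o (frame e1 e2 e3 p)) o) =
    cy p * cy p + cz p * cz p.
Proof.
intros HO. replace (minus (plus o (frame e1 e2 e3 p)) o) with (frame e1 e2 e3 p) by (generalize
  (frame e1 e2 e3 p); intros; apply R3_eq; coords; ring).
unfold radial_form. rewrite (dot_frame _ _ _ p p HO).
replace (dot (frame e1 e2 e3 p) e1) with (cx p); [unfold dot; ring|].
destruct HO as (H1 & H2 & H3 & H4 & H5 & H6).
transitivity (cx p * dot e1 e1 + cy p * dot e1 e2 + cz p * dot e1 e3); [rewrite H1, H4, H5;
  ring|].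
unfold frame. coords. ring.
Qed.

Lemma off_axis_dec (p : R3) : (cy p <> 0 \/ cz p <> 0) \/ (cy p = 0 /\ cz p = 0).
Proof. destruct (Req_dec (cy p) 0), (Req_dec (cz p) 0); tauto. Qed.

(** By [curvature_zero] the profile has [z = 1 / k] and a tangent parallel to the axis. The values
    of [x] form an open set as [w] is not zero, and a closed one by completeness, hence all of the
    line. Points of the axis are excluded by [axis_limit], which would give points of the surface
    too close to the axis. *)
Lemma flat_profile_cylinder (S : R3 -> Prop) o e1 e2 e3 (J : R -> Prop) x z rho w u b k :
  embedded_C2_surface S -> complete_surface S -> profile_of S o e1 e2 e3 J x z ->
  unit_tangent_data J x z rho w u b -> profile_equation J z rho w b k -> 0 < k ->
  (forall t, J t -> b t = 0) -> circular_cylinder S.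
Proof.
intros HE HC HPr HD HEq Pk Hb.
pose proof HPr as (HO & HP & HS). pose proof HP as (HJ & (t0 & Jt0) & _).
assert (A : forall t, J t -> w t * w t = 1 /\ z t = / k).
{ intros t Jt. destruct (curvature_zero J x z rho w u b k t HJ HD HEq Pk Jt (Hb t Jt)) as (u0 &
  E).
  destruct (HD t Jt) as ((Pz & _ & W) & _). rewrite u0 in W. split; [lra|].
  assert (E' : k * z t = 1).
  { assert (P : 0 < k * z t) by now apply Rmult_lt_0_compat.
    assert (F : (k * z t - 1) * (k * z t + 1) = 0) by lra. apply Rmult_integral in F. lra.
      } apply Rmult_eq_reg_l with k; [|lra]. rewrite E', Rinv_r; lra. }
assert (Pk' : 0 < / k) by now apply Rinv_0_lt_compat.
assert (All : forall s, exists t, J t /\ x t = s).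
{ intros s. apply (interval_connected (fun s => exists t, J t /\ x t = s) (x t0) s);
  [now exists t0 | |].
  - intros r _ (t & Jt & Ex). destruct (HD t Jt) as ((_ & Pr & _) & (Dx & _) & _).
    rewrite <- Ex. apply (open_image J x t (rho t * w t)); trivial.
    + apply filter_imp with (2 := HJ t Jt). intros q Jq. split; trivial.
      destruct (HD q Jq) as (_ & (Dq & _) & _). exact (is_derive_continuous _ _ _ Dq).
    + destruct (A t Jt) as (Ew & _). apply Rmult_integral_contrapositive_currified; [lra|].
      intros E. rewrite E in Ew. lra.
  - intros r _ Ne Hr. apply not_eq_sym in Ne.
    destruct (complete_limit S o e1 e2 e3 (fun q => Rmin (x t0) r <= q <= Rmax (x t0) r /\
      q <> r) (fun q => q) (fun _ => / k) (fun _ => 1) (fun _ => 0) (fun q => q) (fun _ => 1)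
      (approach (x t0) r) HC HO) as (xs & zs & Sp & LX & LZ).
    + intros p q t (P1 & P2) (Q1 & Q2) Ht. split; [lra|]. intros ->. unfold Rmin, Rmax in *.
      destruct (Rle_dec (x t0) r); lra.
    + intros t _. split; [exact (is_derive_id_R t)|].
      split; [exact (is_derive_const_R (/ k) t) | exact (is_derive_id_R t)].
    + intros t _. split; [|split]; apply continuous_const.
    + intros q (Q1 & Q2). destruct (Hr q Q1 Q2) as (t & Jt & Ex).
      destruct (A t Jt) as (_ & Ez). rewrite <- Ex, <- Ez.
      now apply (profile_in S o e1 e2 e3 J x z).
    + intros t _. lra.
    + intros n. now apply approach_between.
    + exists r. apply approach_lim.
    + assert (xs = r) by exact (is_lim_seq_eq _ _ _ LX (approach_lim (x t0) r)).
      assert (zs = / k) by exact (is_lim_seq_eq _ _ _ LZ (is_lim_seq_const (/ k))).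
      subst. destruct (profile_out S o e1 e2 e3 J x z _ _ HPr Pk' Sp) as (t & Jt & Ex & _).
        now exists t. }
apply circular_cylinder_tube. exists o, e1, (/ k). split; trivial. split; [apply HO|].
intros p. destruct (frame_coord o e1 e2 e3 p HO) as (p0 & ->). unfold tube.
  rewrite (radial_form_frame _ _ _ _ _ HO).
assert (Off : (cy p0 <> 0 \/ cz p0 <> 0) -> S (plus o (frame e1 e2 e3 p0)) ->
  cy p0 * cy p0 + cz p0 * cz p0 = / k * / k).
{ intros Hoff Hp. apply HS in Hp; trivial. destruct Hp as (t & th & Jt & ->).
  destruct (A t Jt) as (_ & Ez).
  unfold cy, cz; simpl. rewrite Ez. pose proof (sin_cos_sq th) as P.
  transitivity (/ k * / k * (sin th * sin th + cos th * cos th)); [ring | rewrite P; ring]. }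
destruct (off_axis_dec p0) as [Hoff | (Y0 & Z0)].
- split; [now apply Off|]. intros E.
  destruct (polar_exists _ _ Hoff) as (r & th & Pr & Er & Ey & Ez).
  assert (r = / k) by nra. subst r.
  destruct (All (cx p0)) as (t & Jt & Ex). destruct (A t Jt) as (_ & Ezt).
  replace p0 with ((cx p0, / k * sin th, / k * cos th) : R3) by (apply R3_eq;
    [reflexivity | symmetry; exact Ey | symmetry; exact Ez]).
  apply (rotate_in S o e1 e2 e3 J x z); trivial. rewrite <- Ex, <- Ezt.
    now apply (profile_in S o e1 e2 e3 J x z).
- rewrite Y0, Z0. split; [|intros; nra]. intros Hp. exfalso.
  replace p0 with ((cx p0, 0, 0) : R3) in Hp by (apply R3_eq; [reflexivity | symmetry;
    exact Y0 | symmetry; exact Z0]).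
  destruct (axis_limit S o e1 e2 e3 (cx p0) (/ k / 2) HE HO Hp ltac:(lra)) as (p & Hoff & Sp &
    B1 & B2 & B3).
  apply HS in Sp; trivial. destruct Sp as (t & th & Jt & ->). destruct (A t Jt) as (_ & Ez).
  unfold cy, cz in B2, B3; simpl in B2, B3. rewrite Ez in B2, B3.
    pose proof (sin_cos_sq th) as P.
  apply Rabs_def2 in B2, B3.
  assert (/ k * sin th * (/ k * sin th) < / k / 2 * (/ k / 2)) by nra.
  assert (/ k * cos th * (/ k * cos th) < / k / 2 * (/ k / 2)) by nra.
  assert (/ k * / k * (sin th * sin th + cos th * cos th) = / k * sin th * (/ k * sin th) + / k
    * cos th * (/ k * cos th)) by ring.
  rewrite P in *. nra.
Qed.

(** * The levels other than 0 *)

Lemma self_crossing_absurd (S : R3 -> Prop) o e1 e2 e3 (J : R ->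
  Prop) x z rho w u b k x0 K Y d :
  embedded_C2_surface S -> profile_of S o e1 e2 e3 J x z ->
  unit_tangent_data J x z rho w u b ->
  level_curve K Y -> (forall s, Rabs s < d -> first_int0 (cos s) < K) -> PI <= d ->
  (forall s, Rabs s < d -> exists t, on_ref J x z w u b k x0 Y s t) -> False.
Proof.
intros HE HPr HD HY Hd Hpi Hall.
destruct (refX_crossing K Y d HY Hd Hpi) as (s & Hs & X0). pose proof PI_RGT_0.
assert (Ls : Rabs s < d) by (rewrite Rabs_pos_eq; lra).
destruct (Hall s Ls) as (t1 & Jt1 & Ex1 & Ez1 & sg1 & Hsg1 & _ & Ew1 & Eu1).
destruct (Hall (- s) ltac:(rewrite Rabs_Ropp;
  trivial)) as (t2 & Jt2 & Ex2 & Ez2 & sg2 & Hsg2 & _ & Ew2 & Eu2).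
(* The points of angles [s] and [- s] have opposite values of [refX], here 0, and the same distance
   to the axis, so they coincide. *)
rewrite (refX_odd K Y d s HY Hd ltac:(lra)), X0 in Ex2. rewrite X0 in Ex1.
unfold refA in Ez2. rewrite (level_curve_even K Y s HY (Hd s Ls)), cos_neg in Ez2.
  fold (refA Y s) in Ez2.
rewrite cos_neg in Ew2. rewrite sin_neg in Eu2.
destruct (normal_field S o e1 e2 e3 J x z rho w u b t1 HE HPr HD Jt1) as (f1 & f3 & q11 & q13 &
  q31 & q33 & Nf & (del & Pdel & Tf) & _).
assert (T1 := Tf t1 Jt1 ltac:(rewrite Rminus_eq_0, Rabs_R0;
  trivial) ltac:(rewrite Rminus_eq_0, Rabs_R0; trivial)).
assert (Ex : x t2 = x t1) by (rewrite Ex1, Ex2; f_equal; unfold Rdiv; ring).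
  assert (Ez : z t2 = z t1) by congruence.
assert (T2 := Tf t2 Jt2 ltac:(rewrite Ex, Rminus_eq_0, Rabs_R0;
  trivial) ltac:(rewrite Ez, Rminus_eq_0, Rabs_R0; trivial)).
rewrite Ex, Ez in T2. set (F1 := f1 (x t1) (z t1)) in *. set (F3 := f3 (x t1) (z t1)) in *.
rewrite Ew1, Eu1 in T1. rewrite Ew2, Eu2 in T2.
(* The normal would be orthogonal to both tangents, which are independent as [cos s < 0 < sin s]. *)
assert (U1 : F1 * cos s - F3 * sin s = 0) by (destruct Hsg1 as [-> | ->]; lra).
assert (U2 : F1 * cos s + F3 * sin s = 0) by (destruct Hsg2 as [-> | ->]; lra).
assert (Ps : 0 < sin s) by (apply sin_gt_0; lra).
assert (Pc : cos s < 0) by (apply cos_lt_0; lra).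
assert (V1 : F1 * cos s = 0) by lra. assert (V3 : F3 * sin s = 0) by lra.
apply Rmult_integral in V1, V3. destruct Nf, V1, V3; try lra; contradiction.
Qed.

(** For each [eps > 0] the value of [first_int eps] exceeds [K] at the angle [d], hence near it, and
    monotonicity forces [Y] below [eps]. *)
Lemma Y_lim_boundary K Y d (r : nat -> R) : level_curve K Y -> first_int0 (cos d) = K ->
  is_lim_seq r d ->
  (forall n, first_int0 (cos (r n)) < K) -> is_lim_seq (fun n => Y (r n)) 0.
Proof.
intros HY Hd Lr Hr. apply is_lim_seq_spec. intros eps.
assert (C : continuous (fun s => first_int eps (cos s)) d).
{ apply (ex_derive_continuous (fun s => first_int eps (cos s))). eexists. apply Hcos_derive.
  apply cond_pos. }
assert (L : K < first_int eps (cos d)) by (rewrite <- Hd; apply first_int0_lt, cond_pos).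
destruct (locally_R_bound _ _ (C (fun v => K < v) (open_gt K _ L))) as (e & Pe & B).
apply is_lim_seq_spec in Lr. destruct (Lr (mkposreal e Pe)) as [N HN]. exists N. intros n Hn.
specialize (B _ (HN n Hn)). destruct (HY _ (Hr n)) as (PY & EY).
rewrite Rminus_0_r, Rabs_pos_eq by lra. apply Rnot_le_lt. intros [L' | E].
- pose proof (first_int_incr eps (Y (r n)) (cos (r n)) (cond_pos eps) L'). lra.
- rewrite E in B. lra.
Qed.

Lemma dead_end_absurd (S : R3 -> Prop) o e1 e2 e3 (J : R -> Prop) x z rho w u b k x0 K Y d :
  embedded_C2_surface S -> complete_surface S -> profile_of S o e1 e2 e3 J x z ->
  unit_tangent_data J x z rho w u b -> profile_equation J z rho w b k -> 0 < k ->
  level_curve K Y -> (forall s, Rabs s < d -> first_int0 (cos s) < K) ->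
  0 < d < PI -> d <> PI / 2 -> first_int0 (cos d) = K ->
  (forall s, Rabs s < d -> exists t, on_ref J x z w u b k x0 Y s t) -> False.
Proof.
intros HE HC HPr HD HEq Pk HY Hd Hdpi Hd2 HdK Hall.
pose proof HPr as (HO & HP & _). pose proof HP as (HJ & _).
set (X := fun s => x0 + refX Y s / k). set (Z := fun s => refA Y s / k). set (m := speed Y k).
set (r := approach (d / 2) d).
assert (Hr : forall n, d / 2 <= r n < d).
{ intros n. destruct (approach_between (d / 2) d n ltac:(lra)) as (B & Ne).
  rewrite Rmin_left, Rmax_right in B by lra. fold r in B, Ne. lra. }
assert (Lr : is_lim_seq r d) by apply approach_lim.
assert (Dref : forall s, Rabs s < d ->
  is_derive X s (m s * cos s) /\ is_derive Z s (- (m s * sin s)) /\ 0 < m s).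
{ intros s Hs. now apply (ref_derive K Y k x0 d). }
(* The speed [m] is unbounded near [d] because [Y] tends to 0 there. A lower bound for the sine on
   the second half of the interval makes [- Z' / sm] dominate it, and [Z] has a limit. *)
set (sm := Rmin (sin (d / 2)) (sin d)).
assert (Psm : 0 < sm) by (apply Rmin_pos; apply sin_gt_0; lra).
assert (Hsm : forall s, d / 2 <= s < d -> sm <= sin s).
{ intros s Hs. destruct (Rle_lt_dec s (PI / 2)) as [L|L].
  - apply Rle_trans with (1 := Rmin_l _ _). apply sin_incr_1; lra.
  - apply Rle_trans with (1 := Rmin_r _ _). apply sin_decr_1; lra. }
assert (Rn : forall n, Rabs (r n) < d) by (intros n; specialize (Hr n); apply Rabs_def1; lra).
assert (LY : is_lim_seq (fun n => Y (r n)) 0).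
{ apply (Y_lim_boundary K Y d r); auto. }
assert (Lc : is_lim_seq (fun n => cos (r n)) (cos d)).
{ apply is_lim_seq_continuous; trivial. apply continuity_pt_filterlim. apply continuous_cos. }
assert (Ls : is_lim_seq (fun n => sin (r n)) (sin d)).
{ apply is_lim_seq_continuous; trivial. apply continuity_pt_filterlim. apply continuous_sin. }
assert (LA : is_lim_seq (fun n => Z (r n)) (Rabs (cos d) / k)).
{ unfold Z, Rdiv. apply is_lim_seq_mult'; [|apply is_lim_seq_const]. unfold refA, hyp.
  replace (Finite (Rabs (cos d))) with (Finite (sqrt (0 * 0 + cos d * cos d))).
  2:{ f_equal. rewrite <- sqrt_Rsqr_abs. f_equal. unfold Rsqr. ring. }
  apply (is_lim_seq_continuous sqrt (fun n => Y (r n) * Y (r n) + cos (r n) * cos (r n))).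
  - apply continuity_pt_filterlim. apply continuous_sqrt.
  - apply is_lim_seq_plus'; now apply is_lim_seq_mult'. }
(* near the end the length is dominated by the variation of [Z] *)
destruct (complete_limit S o e1 e2 e3 (fun s => d / 2 <= s < d) X Z (fun s => m s * cos s) (fun
  s => - (m s * sin s))
   (fun s => - Z s / sm) (fun s => m s * sin s / sm) r HC HO) as (xs & zs & Sp & LX & LZ).
- intros; lra.
- intros t Ht. destruct (Dref t ltac:(apply Rabs_def1; lra)) as (D1 & D2 & _). split; trivial.
  split; trivial.
  eapply is_derive_eq.
  + apply (is_derive_scal_r (fun s => - Z s) t). apply (is_derive_opp_R Z). exact D2.
  + cbv beta. unfold Rdiv. ring.
- intros t Ht. pose proof (speed_continuous K Y k t HY Pk (Hd t ltac:(apply Rabs_def1;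
  lra))) as Cm. fold m in Cm.
  split; [|split].
  + apply (continuous_mult_R m cos); trivial. apply continuous_cos.
  + apply continuous_opp_R. apply (continuous_mult_R m sin); trivial. apply continuous_sin.
  + apply (continuous_mult_R (fun s => m s * sin s) (fun _ => / sm)); [|apply continuous_const].
    apply (continuous_mult_R m sin); trivial. apply continuous_sin.
- intros t Ht. apply (on_ref_in S o e1 e2 e3 J x z w u b); auto. apply Hall.
  apply Rabs_def1; lra.
- intros t Ht. destruct (Dref t ltac:(apply Rabs_def1; lra)) as (_ & _ & Pm).
  specialize (Hsm t Ht).
  assert (Q : m t <= m t * sin t / sm).
  { apply Rmult_le_reg_r with sm; trivial. unfold Rdiv. rewrite Rmult_assoc, Rinv_l by lra.
    nra. }
  split; [|lra]. pose proof (sin_cos_sq t) as P.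
  apply Rle_trans with (m t * m t); [right;
    transitivity (m t * m t * (sin t * sin t + cos t * cos t)); [ring | rewrite P; ring]|].
  apply Rmult_le_compat; lra.
- exact Hr.
- exists (- (Rabs (cos d) / k) / sm). unfold Rdiv at 1 2.
  apply is_lim_seq_mult'; [|apply is_lim_seq_const].
  apply (is_lim_seq_opp (fun n => Z (r n)) (Rabs (cos d) / k)). exact LA.
- assert (Ezs : zs = Rabs (cos d) / k).
  { exact (is_lim_seq_eq _ _ _ LZ LA). }
  (* Since [d] is not [PI / 2], the end of the curve is off the axis and belongs to the profile. *)
  assert (cd : cos d <> 0).
  { intros E. apply Hd2. apply cos_inj; try lra. now rewrite E, cos_PI2. }
  assert (Pzs : 0 < zs) by (rewrite Ezs; apply Rdiv_lt_0_compat; trivial;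
    now apply Rabs_pos_lt).
  destruct (profile_out S o e1 e2 e3 J x z _ _ HPr Pzs Sp) as (t1 & Jt1 & Ex1 & Ez1).
  destruct (normal_field S o e1 e2 e3 J x z rho w u b t1 HE HPr HD Jt1) as (f1 & f3 & q11 & q13
    & q31 & q33 & Nf & (del & Pdel & Tf) & _ & Lf).
  rewrite <- Ex1 in LX. rewrite <- Ez1 in LZ. destruct (Lf _ _ LX LZ) as (Lf1 & Lf3).
  assert (T0 : f1 (x t1) (z t1) * cos d - f3 (x t1) (z t1) * sin d = 0).
  { assert (L1 : is_lim_seq (fun n => f1 (X (r n)) (Z (r n)) * cos (r n) - f3 (X (r n)) (Z (r
    n)) * sin (r n)) (f1 (x t1) (z t1) * cos d - f3 (x t1) (z t1) * sin d)).
    { apply is_lim_seq_minus'; now apply is_lim_seq_mult'. }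
    assert (L2 : is_lim_seq (fun n => f1 (X (r n)) (Z (r n)) * cos (r n) - f3 (X (r n)) (Z (r
      n)) * sin (r n)) 0).
    { apply is_lim_seq_ext_loc with (fun _ => 0); [|apply is_lim_seq_const].
      apply is_lim_seq_spec in LX, LZ. destruct (LX (mkposreal del Pdel)) as [N1 B1].
        destruct (LZ (mkposreal del Pdel)) as [N2 B2].
      simpl in B1, B2. exists (N1 + N2)%nat. intros n Hn. specialize (B1 n ltac:(lia)).
        specialize (B2 n ltac:(lia)).
      destruct (Hall (r n) (Rn n)) as (t & Jt & Ex & Ez & sg & Hsg & Pb & Ew & Eu).
      fold (X (r n)) in Ex. fold (Z (r n)) in Ez.
      specialize (Tf t Jt). rewrite Ex, Ez, Ew, Eu in Tf. specialize (Tf B1 B2).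
      destruct Hsg as [-> | ->]; lra. }
    exact (is_lim_seq_eq _ _ _ L1 L2). }
  assert (T1 := Tf t1 Jt1 ltac:(rewrite Rminus_eq_0, Rabs_R0;
    trivial) ltac:(rewrite Rminus_eq_0, Rabs_R0; trivial)).
  destruct (HD t1 Jt1) as ((Pz & Pr & Wu) & _).
  pose proof (sin_cos_sq d) as SC.
  destruct (tangent_match _ _ (cos d) (sin d) (w t1) (u t1) T0 T1 Nf SC Wu) as (sg & Hsg & Ew &
    Eu).
  pose proof (is_sign_sq sg Hsg) as sg2.
  (* At the end the curvature of the parallel takes up all of [k * k], so [b] vanishes; then
     [curvature_zero] makes the tangent parallel to the axis, against [0 < sin d]. *)
  assert (Hw : w t1 / z t1 * (w t1 / z t1) = k * k).
  { rewrite Ez1, Ezs, Ew. pose proof (Rabs_pos_lt _ cd).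
    transitivity (sg * sg * (k * k) * (cos d * cos d / (Rabs (cos d) * Rabs (cos d)))); [field;
      lra|].
    rewrite sg2, <- Rabs_mult, (Rabs_pos_eq (cos d * cos d)) by apply Rle_0_sqr. field.
      trivial. }
  pose proof (HEq t1 Jt1) as HE1. rewrite Hw in HE1.
  assert (b0 : b t1 = 0).
  { assert (E : b t1 / rho t1 * (b t1 / rho t1) = 0) by lra. apply Rmult_integral in E.
    assert (E' : b t1 / rho t1 = 0) by tauto.
      transitivity (b t1 / rho t1 * rho t1); [field; lra | rewrite E'; ring]. }
  destruct (curvature_zero J x z rho w u b k t1 HJ HD HEq Pk Jt1 b0) as (u0 & _).
  assert (0 < sin d) by (apply sin_gt_0; lra).
  rewrite u0 in Eu. destruct Hsg as [-> | ->]; lra.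
Qed.

(** * Level 0, where the two principal curvatures agree *)

Lemma tangent_sign_angle w u b : w * w + u * u = 1 -> b <> 0 ->
  exists sg s, is_sign sg /\ 0 < sg * b /\ - PI <= s <= PI /\ w = sg * cos s /\
    u = - sg * sin s.
Proof.
intros E Hb.
assert (Hsg : exists sg, is_sign sg /\ 0 < sg * b).
{ destruct (Rlt_le_dec 0 b); [exists 1 | exists (-1)]; unfold is_sign; split; try lra. }
destruct Hsg as (sg & Hsg & Pb). pose proof (is_sign_sq sg Hsg) as sg2.
destruct (angle_exists (sg * w) (- sg * u)) as (s & Bs & E1 & E2).
{ transitivity (sg * sg * (w * w + u * u)); [ring | rewrite sg2, E; ring]. }
exists sg, s. rewrite <- E1, <- E2. repeat split; trivial; try lra.
- transitivity (sg * sg * w); [rewrite sg2|]; ring.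
- transitivity (sg * sg * u); [rewrite sg2|]; ring.
Qed.

Lemma first_int_0_eq y W : 0 < y -> first_int y W = 0 -> y = W.
Proof.
intros Py E. unfold first_int in E. pose proof (hyp_pos y W Py).
  pose proof (exp_pos (- atan (W / y))).
apply Rmult_integral in E. destruct E as [E|E]; [|lra]. apply Rmult_integral in E. lra.
Qed.

(** [on_ref_all] puts the half circle on the surface but leaves open whether the profile has further
    points. Equality of the curvatures spreads over [J]: it is an open condition, being level 0 of
    the first integral, and a closed one by continuity. *)
Lemma umbilic_everywhere (J : R -> Prop) x z rho w u b k t0 t :
  open J -> (forall a b t, J a -> J b -> a <= t <= b -> J t) ->
  unit_tangent_data J x z rho w u b -> profile_equation J z rho w b k -> 0 < k ->
  J t0 -> J t -> b t0 / rho t0 = w t0 / z t0 -> b t / rho t = w t / z t.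
Proof.
intros HJ HC HD HEq Pk Jt0 Jt E0.
assert (JJ : forall s, Rmin t0 t <= s <= Rmax t0 t -> J s).
{ intros s Hs. unfold Rmin, Rmax in Hs.
  destruct (Rle_dec t0 t); [apply HC with t0 t | apply HC with t t0]; trivial. }
apply (interval_connected (fun s => b s / rho s = w s / z s) t0 t); trivial.
- intros s Hs Es. assert (Js := JJ s Hs). destruct (HD s Js) as ((Pz & Pr & W) & _).
  (* Otherwise both curvatures would vanish, against [0 < k]. *)
  assert (b0 : b s <> 0).
  { intros E. pose proof (HEq s Js) as Q. rewrite <- Es, E in Q. unfold Rdiv in Q. nra. }
  destruct (tangent_sign_angle (w s) (u s) (b s) W b0) as (sg & a & Hsg & Pb & Ba & Ew & Eu).
  pose proof (is_sign_sq sg Hsg) as sg2.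
  destruct (tangent_angle J x z rho w u b k s sg a HJ HD HEq Pk Js Hsg Pb Ew Eu) as (d & th &
    Pd & Th & B).
  exists d. split; trivial. intros r Hr. destruct (B r Hr) as (Jr & _ & Pbr & Ewr & Eur & EH).
  destruct (HD r Jr) as ((Pzr & Prr & _) & _).
  assert (Ec : sg * z s * b s / rho s = cos a).
  { transitivity (sg * z s * (b s / rho s)); [field; lra|]. rewrite Es, Ew.
    transitivity (sg * sg * cos a); [field; lra | rewrite sg2; ring]. }
  rewrite Ec in EH.
  assert (Z : first_int (cos a) (cos a) = 0) by (unfold first_int; ring). rewrite Z in EH.
  apply first_int_0_eq in EH.
  + rewrite Ewr, <- EH.
    transitivity (sg * sg * b r / rho r); [rewrite sg2; field; lra | field; lra].
  + replace (sg * z r * b r / rho r) with (z r * (sg * b r) / rho r) by (field; lra).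
    apply Rdiv_lt_0_compat; trivial. now apply Rmult_lt_0_compat.
- intros s Hs Ne Hr. assert (Js := JJ s Hs).
  destruct (HD s Js) as ((Pz & Pr & W) & (Dx & Dz) & (Dw & Du) & Cb & Crho).
  assert (C : forall f g : R -> R,
    continuous f s -> continuous g s -> g s <> 0 -> continuous (fun r => f r / g r) s).
  { intros f g Cf Cg g0. apply (continuous_mult_R f (fun r => / g r)); trivial.
    apply (continuous_comp g Rinv); trivial. now apply continuous_Rinv. }
  assert (Cw : continuous w s) by (exact (is_derive_continuous _ _ _ Dw)).
  assert (Cz : continuous z s) by (exact (is_derive_continuous _ _ _ Dz)).
  assert (C1 := C b rho Cb Crho ltac:(lra)). assert (C2 := C w z Cw Cz ltac:(lra)).
  apply not_eq_sym in Ne.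
  apply is_lim_seq_eq with (fun n => b (approach t0 s n) / rho (approach t0 s n)).
  + apply (is_lim_seq_continuous (fun r => b r / rho r)); [|apply approach_lim].
    apply continuity_pt_filterlim. exact C1.
  + apply is_lim_seq_ext with (fun n => w (approach t0 s n) / z (approach t0 s n)).
    * intros n. symmetry. destruct (approach_between t0 s n Ne). now apply Hr.
    * apply (is_lim_seq_continuous (fun r => w r / z r)); [|apply approach_lim].
      apply continuity_pt_filterlim. exact C2.
Qed.

(** The normal of the profile meets the axis at [x + z * u / w], at distance [Rabs (z / w)]. Equal
    curvatures make this point stationary, so it is the centre of a circle. *)
Lemma umbilic_center (J : R -> Prop) x z rho w u b k t0 t :
  (forall a b t, J a -> J b -> a <= t <= b -> J t) ->
  unit_tangent_data J x z rho w u b -> profile_equation J z rho w b k -> 0 < k ->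
  (forall t, J t -> b t / rho t = w t / z t) -> J t0 -> J t ->
  x t + z t * u t / w t = x t0 + z t0 * u t0 / w t0 /\ (z t / w t) * (z t / w t) = 2 / (k * k).
Proof.
intros HC HD HEq Pk Hum Jt0 Jt.
assert (W0 : forall s, J s -> w s <> 0 /\ (z s / w s) * (z s / w s) = 2 / (k * k)).
{ intros s Js. pose proof (HEq s Js) as Q. rewrite (Hum s Js) in Q.
  destruct (HD s Js) as ((Pz & Pr & _) & _).
  assert (w0 : w s <> 0) by (intros E; rewrite E in Q; unfold Rdiv in Q;
    assert (0 < k * k) by (now apply Rmult_lt_0_compat); lra).
  split; trivial. replace (k * k) with (2 * (w s / z s) * (w s / z s)) by lra. field.
    split; [lra | trivial]. }
split; [|apply W0; trivial].
assert (D : forall s, J s -> is_derive (fun s => x s + z s * u s / w s) s 0).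
{ intros s Js. destruct (W0 s Js) as (w0 & _).
  destruct (HD s Js) as ((Pz & Pr & WU) & (Dx & Dz) & (Dw & Du) & _).
  assert (Eb : b s = rho s * w s / z s) by (transitivity (rho s * (b s / rho s)); [field;
    lra | rewrite (Hum s Js); field; lra]).
  eapply is_derive_eq.
  - apply (is_derive_plus_R x (fun s => z s * u s / w s)); [exact Dx|].
    apply (is_derive_div (fun s => z s * u s) w); [|exact Dw|exact w0].
    apply is_derive_mult_R; [exact Dz | exact Du].
  - cbv beta. rewrite Eb.
    transitivity (rho s / w s * (w s * w s + u s * u s) * (1 - 1)); [field; lra | ring]. }
assert (JJ : forall s, Rmin t0 t <= s <= Rmax t0 t -> J s).
{ intros s Hs. unfold Rmin, Rmax in Hs.
  destruct (Rle_dec t0 t); [apply HC with t0 t | apply HC with t t0]; trivial. }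
destruct (Rle_lt_dec t0 t) as [L|L].
- apply (derive_0_const (fun s => x s + z s * u s / w s) t0 t L). intros s Hs. apply D, JJ.
  rewrite Rmin_left, Rmax_right by lra. lra.
- symmetry. apply (derive_0_const (fun s => x s + z s * u s / w s) t t0); [lra|]. intros s Hs.
  apply D, JJ. rewrite Rmin_right, Rmax_left by lra. lra.
Qed.

(** On level 0 [Y] is the cosine and the integrand of [refX] is [sqrt 2 * cos]: the reference curve
    is a half circle of radius [sqrt 2]. *)
Lemma refX_0_curve Y d s : level_curve 0 Y -> d = PI / 2 -> Rabs s < d -> (forall s,
  Rabs s < d -> first_int0 (cos s) < 0) ->
  refX Y s = sqrt 2 * sin s /\ refA Y s = sqrt 2 * cos s.
Proof.
intros HY Ed Hs Hd. pose proof PI_RGT_0.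
assert (Pc : forall s, Rabs s < d -> 0 < cos s) by (intros r Hr; apply Rabs_def2 in Hr;
  apply cos_gt_0; lra).
split; [|exact (proj2 (level_curve_0 Y s HY (Pc s Hs)))].
assert (E : refX Y s - sqrt 2 * sin s = refX Y 0 - sqrt 2 * sin 0).
{ apply (derive_0_const_around (fun s => refX Y s - sqrt 2 * sin s) 0 d);
  [|now rewrite Rminus_0_r].
  intros r Hr. rewrite Rminus_0_r in Hr.
    destruct (level_curve_0 Y r HY (Pc r Hr)) as (EY & EA). pose proof (Pc r Hr).
  eapply is_derive_eq.
  - apply is_derive_minus_R; [now apply (refX_derive 0 Y d)|].
    apply is_derive_scal. apply is_derive_sin.
  - cbv beta. rewrite EY, EA. field. lra. }
rewrite refX_0, sin_0 in E. lra.
Qed.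

(** A half circle has finite length, so completeness adds its end points. The sign [eps] selects the
    pole, by reflecting the angle. *)
Lemma pole_in (S : R3 -> Prop) o e1 e2 e3 x0 R0 eps : complete_surface S ->
  orthonormal e1 e2 e3 -> 0 < R0 -> (eps = 1 \/ eps = -1) ->
  (forall s, - (PI / 2) < s < PI / 2 ->
    S (meridian o e1 e2 e3 (x0 + R0 * sin s) (R0 * cos s))) ->
  S (meridian o e1 e2 e3 (x0 + eps * R0) 0).
Proof.
intros HC HO PR Heps HS. pose proof PI_RGT_0 as PP.
assert (eps2 : eps * eps = 1) by (destruct Heps as [-> | ->]; ring).
set (r := approach 0 (PI / 2)).
assert (Hr : forall n, 0 <= r n < PI / 2).
{ intros n. destruct (approach_between 0 (PI / 2) n ltac:(lra)) as (B & Ne).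
  rewrite Rmin_left, Rmax_right in B by lra. fold r in B, Ne. lra. }
assert (Lr : is_lim_seq r (PI / 2)) by apply approach_lim.
destruct (complete_limit S o e1 e2 e3 (fun s => 0 <= s < PI / 2) (fun s => x0 + eps * R0 * sin
  s) (fun s => R0 * cos s)
   (fun s => eps * R0 * cos s) (fun s => - R0 * sin s) (fun s => R0 * s) (fun _ => R0) r HC HO)
     as (xs & zs & Sp & LX & LZ).
- intros; lra.
- intros t _. split; [|split]; auto_derive; trivial; ring.
- intros t _. split; [|split]; [| |apply continuous_const].
  + apply (ex_derive_continuous (fun s => eps * R0 * cos s)). auto_derive. trivial.
  + apply (ex_derive_continuous (fun s => - R0 * sin s)). auto_derive. trivial.
- intros t Ht. replace (eps * R0 * sin t) with (R0 * sin (eps * t)).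
  + replace (cos t) with (cos (eps * t)).
    * apply HS. destruct Heps as [-> | ->]; lra.
    * destruct Heps as [-> | ->]; [f_equal; ring|]. replace (-1 * t) with (- t) by ring.
      apply cos_neg.
  + destruct Heps as [-> | ->]; [rewrite !Rmult_1_l; ring|].
    replace (-1 * t) with (- t) by ring. rewrite sin_neg. ring.
- intros t _. split; [|lra]. pose proof (sin_cos_sq t) as P. right.
  transitivity (R0 * R0 * (eps * eps * (cos t * cos t) + sin t * sin t)); [ring|]. rewrite eps2.
  transitivity (R0 * R0 * (sin t * sin t + cos t * cos t)); [ring | rewrite P; ring].
- exact Hr.
- exists (R0 * (PI / 2)). apply is_lim_seq_mult'; [apply is_lim_seq_const | exact Lr].
- assert (Ex : xs = x0 + eps * R0).
  { apply (is_lim_seq_eq _ _ _ LX).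
    replace (x0 + eps * R0) with (x0 + eps * R0 * sin (PI / 2)) by (rewrite sin_PI2; ring).
    apply (is_lim_seq_continuous (fun s => x0 + eps * R0 * sin s) r (PI / 2)); trivial.
      apply continuity_pt_filterlim.
    apply (ex_derive_continuous (fun s => x0 + eps * R0 * sin s)). auto_derive. trivial. }
  assert (Ez : zs = 0).
  { apply (is_lim_seq_eq _ _ _ LZ).
    replace 0 with (R0 * cos (PI / 2)) by (rewrite cos_PI2; ring).
    apply (is_lim_seq_continuous (fun s => R0 * cos s) r (PI / 2)); trivial.
      apply continuity_pt_filterlim.
    apply (ex_derive_continuous (fun s => R0 * cos s)). auto_derive. trivial. }
  now rewrite <- Ex, <- Ez.
Qed.

Lemma umbilic_profile_sphere (S : R3 -> Prop) o e1 e2 e3 (J : R ->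
  Prop) x z rho w u b k x0 Y d :
  embedded_C2_surface S -> complete_surface S -> profile_of S o e1 e2 e3 J x z ->
  unit_tangent_data J x z rho w u b -> profile_equation J z rho w b k -> 0 < k ->
  level_curve 0 Y -> d = PI / 2 -> (forall s, Rabs s < d -> first_int0 (cos s) < 0) ->
  (forall s, Rabs s < d -> exists t, on_ref J x z w u b k x0 Y s t) -> round_sphere S.
Proof.
intros HE HC HPr HD HEq Pk HY Ed Hd Hall. pose proof PI_RGT_0 as PP.
pose proof HPr as (HO & HP & HS). pose proof HP as (HJ & _ & Hconv & _).
(* The radius for which two principal curvatures [1 / R0] have squares adding up to [k * k]. *)
set (R0 := sqrt 2 / k).
assert (P2 : 0 < sqrt 2) by (apply sqrt_lt_R0; lra).
assert (PR : 0 < R0) by (apply Rdiv_lt_0_compat; lra).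
assert (R02 : R0 * R0 = 2 / (k * k)).
{ unfold R0. transitivity (sqrt 2 * sqrt 2 / (k * k)); [field; lra|]. rewrite sqrt_sqrt by lra.
  reflexivity. }
assert (Mer : forall s, - (PI / 2) < s < PI / 2 ->
  S (meridian o e1 e2 e3 (x0 + R0 * sin s) (R0 * cos s))).
{ intros s Hs. assert (As : Rabs s < d) by (apply Rabs_def1; lra).
  destruct (refX_0_curve Y d s HY Ed As Hd) as (EX & EA).
  pose proof (on_ref_in S o e1 e2 e3 J x z w u b k x0 Y s HPr (Hall s As)) as Q.
    rewrite EX, EA in Q.
  replace (R0 * sin s) with (sqrt 2 * sin s / k) by (unfold R0; field; lra).
  replace (R0 * cos s) with (sqrt 2 * cos s / k) by (unfold R0; field; lra). exact Q. }
assert (A0 : Rabs 0 < d) by (rewrite Rabs_R0; lra).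
destruct (Hall 0 A0) as (t0 & Jt0 & Ex0 & Ez0 & sg & Hsg & Pb0 & Ew0 & Eu0).
destruct (refX_0_curve Y d 0 HY Ed A0 Hd) as (EX0 & EA0).
rewrite cos_0 in *. rewrite sin_0 in *. rewrite EX0 in Ex0. rewrite EA0 in Ez0.
pose proof (is_sign_sq sg Hsg) as sg2.
destruct (HD t0 Jt0) as ((Pz0 & Pr0 & _) & _).
(* At angle 0 the two curvatures have the same square, and [sg] times either of them is positive. *)
assert (Um0 : b t0 / rho t0 = w t0 / z t0).
{ assert (Hw : w t0 / z t0 = sg * k / sqrt 2) by (rewrite Ew0, Ez0; field; lra).
  pose proof (HEq t0 Jt0) as Q.
  assert (Hw2 : (w t0 / z t0) * (w t0 / z t0) = k * k / 2).
  { rewrite Hw. transitivity (sg * sg * (k * k) / (sqrt 2 * sqrt 2)); [field; lra|].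
    rewrite sg2, sqrt_sqrt by lra. field. }
  rewrite Hw2 in Q.
  assert (F : (b t0 / rho t0 - w t0 / z t0) * (b t0 / rho t0 + w t0 / z t0) = 0).
  { transitivity (b t0 / rho t0 * (b t0 / rho t0) - w t0 / z t0 * (w t0 / z t0)); [ring|].
    rewrite Hw2. lra. }
  apply Rmult_integral in F. destruct F as [F|F]; [lra|]. exfalso.
  assert (G : sg * (b t0 / rho t0 + w t0 / z t0) = 0) by (rewrite F; ring).
  assert (0 < sg * b t0 / rho t0) by now apply Rdiv_lt_0_compat.
  assert (0 < k / sqrt 2) by now apply Rdiv_lt_0_compat.
  assert (sg * (b t0 / rho t0 + w t0 / z t0) = sg * b t0 / rho t0 + sg * sg * (k / sqrt 2)) by
    (rewrite Hw; field; lra).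
  rewrite sg2 in *. lra. }
assert (Um : forall t, J t -> b t / rho t = w t / z t).
{ intros t Jt. now apply (umbilic_everywhere J x z rho w u b k t0 t). }
assert (Circ : forall t, J t -> (x t - x0) * (x t - x0) + z t * z t = R0 * R0).
{ intros t Jt. destruct (umbilic_center J x z rho w u b k t0 t Hconv HD HEq Pk Um Jt0 Jt) as
  (E1 & E2).
  destruct (HD t Jt) as ((_ & _ & WU) & _).
  assert (w0 : w t <> 0).
  { intros E. pose proof (HEq t Jt) as Q. rewrite (Um t Jt), E in Q. unfold Rdiv in Q. nra. }
  rewrite R02, <- E2.
  assert (Ex : x t - x0 = - (z t * u t / w t)).
  { rewrite Ex0, Eu0 in E1.
    replace (x0 + sqrt 2 * 0 / k + z t0 * (- sg * 0) / w t0) with x0 in E1; [lra|].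
    rewrite !Rmult_0_r. unfold Rdiv. ring. }
  rewrite Ex. transitivity (z t / w t * (z t / w t) * (w t * w t + u t * u t)); [field;
    trivial | rewrite WU; ring]. }
assert (Sph : forall p, S (plus o (frame e1 e2 e3 p)) ->
  (cx p - x0) * (cx p - x0) + cy p * cy p + cz p * cz p = R0 * R0).
{ assert (Off : forall p, (cy p <> 0 \/ cz p <> 0) -> S (plus o (frame e1 e2 e3 p)) ->
  (cx p - x0) * (cx p - x0) + cy p * cy p + cz p * cz p = R0 * R0).
  { intros p Hoff Sp. apply HS in Sp; trivial. destruct Sp as (t & th & Jt & ->).
    unfold cx, cy, cz; simpl.
    rewrite <- (Circ t Jt). pose proof (sin_cos_sq th) as P.
    transitivity ((x t - x0) * (x t - x0) + z t * z t * (sin th * sin th + cos th * cos th));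
      [ring | rewrite P; ring]. }
  (* On the axis the equation follows by approximation: a nearby point off the axis satisfies it,
     and [eps] is so small that moving there changes the left side by at most half of the supposed
     defect. *)
  intros p Sp. destruct (off_axis_dec p) as [Hoff | (Y0 & Z0)]; [now apply Off|].
  rewrite Y0, Z0. set (D := cx p - x0).
  replace p with ((cx p, 0, 0) : R3) in Sp by (apply R3_eq; [reflexivity | symmetry;
    exact Y0 | symmetry; exact Z0]).
  apply NNPP. intros Ne. assert (Pe : 0 < Rabs (D * D - R0 * R0)) by (apply Rabs_pos_lt; lra).
  pose proof (Rabs_pos D) as PD.
  set (eps := Rmin 1 (Rabs (D * D - R0 * R0) / (2 * (2 * Rabs D + 3)))).
  assert (Peps : 0 < eps) by (apply Rmin_pos; [lra | apply Rdiv_lt_0_compat; lra]).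
  assert (eps1 : eps <= 1) by apply Rmin_l.
  assert (epsD : eps * (2 * Rabs D + 3) <= Rabs (D * D - R0 * R0) / 2).
  { apply Rle_trans with (Rabs (D * D - R0 * R0) / (2 * (2 * Rabs D + 3)) * (2 * Rabs D + 3));
    [apply Rmult_le_compat_r; [lra | apply Rmin_r]|].
    right. field. lra. }
  destruct (axis_limit S o e1 e2 e3 (cx p) eps HE HO Sp Peps) as (q & Hq & Sq & B1 & B2 & B3).
  pose proof (Off q Hq Sq) as Q. set (e := cx q - cx p) in *.
  assert (E : D * D - R0 * R0 = - (2 * D * e + e * e + cy q * cy q + cz q * cz q)) by (rewrite
    <- Q; unfold D, e; ring).
  assert (Bd : Rabs (D * D - R0 * R0) <= eps * (2 * Rabs D + 3)).
  { rewrite E, Rabs_Ropp.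
    eapply Rle_trans; [apply Rabs_triang|].
      eapply Rle_trans; [apply Rplus_le_compat_r, Rabs_triang|].
    eapply Rle_trans; [apply Rplus_le_compat_r, Rplus_le_compat_r, Rabs_triang|].
    rewrite !Rabs_mult, (Rabs_pos_eq 2) by lra.
    pose proof (Rabs_pos e). pose proof (Rabs_pos (cy q)). pose proof (Rabs_pos (cz q)).
    assert (Sm : forall v, 0 <= v -> v < eps -> v * v <= eps)
      by (intros v V1 V2; apply Rle_trans with (v * 1); [apply Rmult_le_compat_l |]; lra).
    pose proof (Sm _ (Rabs_pos e) B1). pose proof (Sm _ (Rabs_pos (cy q)) B2).
      pose proof (Sm _ (Rabs_pos (cz q)) B3).
    assert (2 * Rabs D * Rabs e <= 2 * Rabs D * eps) by (apply Rmult_le_compat_l; lra). lra. }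
  lra. }
exists (plus o (frame e1 e2 e3 (x0, 0, 0))), R0. split; trivial.
intros p. destruct (frame_coord o e1 e2 e3 p HO) as (p0 & ->). rewrite minus_frame.
  unfold enorm. rewrite (dot_frame _ _ _ _ _ HO).
replace (dot (minus p0 (x0, 0, 0)) (minus p0 (x0, 0,
  0))) with ((cx p0 - x0) * (cx p0 - x0) + cy p0 * cy p0 + cz p0 * cz p0) by (coords; ring).
split.
- intros Sp. rewrite (Sph p0 Sp). apply sqrt_square. lra.
- intros E. assert (E2 : (cx p0 - x0) * (cx p0 - x0) + cy p0 * cy p0 + cz p0 * cz p0 = R0 * R0).
  { rewrite <- E. symmetry. apply sqrt_sqrt.
    pose proof (Rle_0_sqr (cx p0 - x0)); pose proof (Rle_0_sqr (cy p0));
    pose proof (Rle_0_sqr (cz p0)). unfold Rsqr in *. lra. }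
  clear E. destruct (off_axis_dec p0) as [Hoff | (Y0 & Z0)].
  + destruct (polar_exists _ _ Hoff) as (r & th & Pr & Er & Ey & Ez).
    destruct (angle_exists (r / R0) ((cx p0 - x0) / R0)) as (s & Bs & Ec & Es).
    { transitivity (((cx p0 - x0) * (cx p0 - x0) + r * r) / (R0 * R0)); [field; lra|].
      rewrite Er, <- Rplus_assoc, E2. field. lra. }
    assert (Pc : 0 < cos s) by (rewrite <- Ec; now apply Rdiv_lt_0_compat).
    assert (Hs : - (PI / 2) < s < PI / 2).
    { split; apply Rnot_le_lt; intros L.
      - assert (cos s <= 0); [|lra]. rewrite <- (cos_neg s). apply cos_le_0; lra.
      - assert (cos s <= 0); [|lra]. apply cos_le_0; lra. }
    specialize (Mer s Hs). rewrite <- Ec, <- Es in Mer.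
    replace (x0 + R0 * ((cx p0 - x0) / R0)) with (cx p0) in Mer by (field; lra).
    replace (R0 * (r / R0)) with r in Mer by (field; lra).
    replace p0 with ((cx p0, r * sin th, r * cos th) : R3) by (apply R3_eq;
      [reflexivity | symmetry; exact Ey | symmetry; exact Ez]).
    now apply (rotate_in S o e1 e2 e3 J x z).
  + rewrite Y0, Z0 in E2.
    assert (F : (cx p0 - x0 - R0) * (cx p0 - x0 + R0) = 0) by lra.
    replace p0 with ((cx p0, 0, 0) : R3) by (apply R3_eq; [reflexivity | symmetry;
      exact Y0 | symmetry; exact Z0]).
    apply Rmult_integral in F. destruct F as [F|F].
    * replace (cx p0) with (x0 + 1 * R0) by lra. apply (pole_in S o e1 e2 e3 x0 R0 1); auto.
    * replace (cx p0) with (x0 + -1 * R0) by lra. apply (pole_in S o e1 e2 e3 x0 R0 (-1)); auto.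
Qed.

Theorem corollary1p2 (S : R * R * R -> Prop) :
  (embedded_C2_surface S /\ rotational S /\ complete_surface S /\
   exists c : R, 0 < c /\ constant_sqnorm_A S c) <->
  (round_sphere S \/ circular_cylinder S).
Proof.
split; [|apply constant_sqnorm_sphere_cylinder].
intros (HE & (T & J & x & z & (o & e1 & e2 & e3 & O1 & O2 & O3 & O4 & O5 & O6 & ET) & HP &
  Hrot) & HC & c & Pc & HA).
assert (HPr : profile_of S o e1 e2 e3 J x z).
{ split; [|split]; [repeat split; trivial | exact HP |].
  intros p Hp. rewrite <- (Hrot p Hp), ET. reflexivity. }
destruct (profile_unit_tangent J x z HP) as (rho & w & u & b & HD & Hexp).
pose proof (sqrt_lt_R0 c Pc) as Pk. set (k := sqrt c) in *.
assert (HEq : profile_equation J z rho w b k).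
{ intros t Jt. unfold k. rewrite sqrt_sqrt by lra.
  exact (profile_sqnorm S o e1 e2 e3 J x z c rho w u b HPr HA HD Hexp t Jt). }
(* The tangent angle can serve as a parameter only near a point where [b] is not zero; without such
   a point the profile is straight. *)
destruct (classic (exists t, J t /\ b t <> 0)) as [(t0 & Jt0 & b0) | Hflat].
2:{ right. apply (flat_profile_cylinder S o e1 e2 e3 J x z rho w u b k); trivial.
    intros t Jt. apply NNPP. intros Hb. apply Hflat. now exists t. }
left.
destruct (HD t0 Jt0) as ((Pz & Pr & WU) & _).
destruct (tangent_sign_angle (w t0) (u t0) (b t0) WU b0) as (sg & s0 & Hsg & Pb & Bs & Ew & Eu).
pose proof (is_sign_sq sg Hsg) as sg2.
(* [y0] and [cos s0] are the values at [t0] of the two variables of the first integral, and [K] is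
   the level through them. *)
set (y0 := sg * z t0 * b t0 / rho t0).
assert (Py : 0 < y0).
{ unfold y0. replace (sg * z t0 * b t0 / rho t0) with (z t0 * (sg * b t0) / rho t0) by (field;
  lra).
  apply Rdiv_lt_0_compat; trivial. now apply Rmult_lt_0_compat. }
set (K := first_int y0 (cos s0)).
assert (HK : first_int0 (cos s0) < K) by now apply first_int0_lt.
destruct (level_domain K s0 Bs HK) as (d & Pd & Hs0 & Hd & Hcase).
destruct (level_curve_exists K) as (Y & HY).
assert (EY : y0 = Y s0).
{ destruct (HY s0 HK) as (PY & E). apply first_int_inj with (cos s0); auto. }
(* The shift along the axis that makes the reference curve pass through the profile at [t0]. *)
set (x0 := x t0 - refX Y s0 / k).
assert (Hall : forall s, Rabs s < d -> exists t, on_ref J x z w u b k x0 Y s t).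
{ intros s Hs. apply (on_ref_all S o e1 e2 e3 J x z rho w u b k x0 K Y d s0 s); trivial.
  exists t0. split; trivial. split; [unfold x0; ring|]. split; [|exists sg; auto].
  unfold refA. rewrite <- EY. unfold y0.
    rewrite (profile_hyp _ _ (w t0) _ k sg _ sg2 Pz Pr Pk Ew (HEq t0 Jt0)). field. lra. }
destruct Hcase as [(K0 & Ed) | [(d1' & d2' & d3') | d1']].
- apply (umbilic_profile_sphere S o e1 e2 e3 J x z rho w u b k x0 Y d); trivial; rewrite <- K0;
  trivial.
- exfalso. apply (dead_end_absurd S o e1 e2 e3 J x z rho w u b k x0 K Y d); auto.
- exfalso. apply (self_crossing_absurd S o e1 e2 e3 J x z rho w u b k x0 K Y d); auto.
Qed.
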